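(* Let $\mu$ be a non-atomic self-similar measure on $\mathbb{R}$. Let $d\geq 2$ and assume that for every $\varepsilon>0$ there exist $p>1$ and $C>0$ such that for all $R>1$, $$\int_{B(R)}\big|\widehat{V_{d-1}\mu}(\xi)\big|^p\,d\xi\leq CR^{\varepsilon},$$ where $B(R)$ is the ball of radius $R$ around $0$ in $\mathbb{R}^{d-1}$. Let $g:U\to\mathbb{R}^{d-1}$ be a map defined on an open neighborhood $U$ of $\mathrm{supp}(\mu)$ such that $Q(x)=(x,g(x))$ is either a non-trapped real analytic curve, or a $C^{d+1}$ non-degenerate curve. Let $\nu=Q\mu$ be the pushforward of $\mu$ to the graph of $g$. For $R\ge 1$ and $\varepsilon>0$ let $$C_{R,\varepsilon}=\{(\theta,\zeta)\in\mathbb{R}\times\mathbb{R}^{d-1}:\ |\theta|^{\varepsilon}\leq\|\zeta\|\leq R\}.$$ Then for every $\varepsilon>0$ there is $p_0=p_0(\mu,g,\varepsilon)>1$ such that for all $p\geq p_0$ and all $R\geq 1$, $$\int_{C_{R,\varepsilon}}|\hat\nu(\xi)|^p\,d\xi=O_{\varepsilon}(R^{\varepsilon}).$$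
   Context: A self-similar measure on $\mathbb{R}$ is a Borel probability measure $\mu$ such that $\mu=\sum_{i=1}^n \mathbf{p}_i\, f_i\mu$ for some strictly positive probability vector $\mathbf{p}=(\mathbf{p}_1,\dots,\mathbf{p}_n)$ and affine maps $f_i:\mathbb{R}\to\mathbb{R}$ with $|f_i'|\in(0,1)$, where $f_i\mu$ denotes the pushforward of $\mu$ by $f_i$. The moment curve is $V_k(x)=(x,x^2,\dots,x^k)\in\mathbb{R}^k$ for $k\ge 1$ (so $V_1(x)=x$), and $V_k\mu$ is the pushforward of $\mu$ by $V_k$. Let $U\subseteq\mathbb{R}$ be open. A $C^{d+1}$ curve $Q:U\to\mathbb{R}^d$ is non-degenerate if $\det[Q^{(1)}(x)\,Q^{(2)}(x)\cdots Q^{(d)}(x)]\neq 0$ for all $x\in U$. A real analytic curve $Q:U\to\mathbb{R}^d$ is non-trapped if this determinant has at most finitely many zeros in any compact interval contained in $U$. The Fourier transform is $\hat\nu(\xi)=\int e^{2\pi i\langle \xi,x\rangle}\,d\nu(x)$, and $\|\cdot\|$ is the max norm. The implicit constant in $O_\varepsilon$ may depend on $\varepsilon$, $\mu$, $d$ and $g$, but not on $R$. *)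

(* Defs.v *)
From HB Require Import structures.
From mathcomp Require Import all_boot all_order all_algebra.
From mathcomp Require Import all_classical all_reals all_analysis.
From mathcomp Require Import complex.
Set Implicit Arguments.
Unset Strict Implicit.
Unset Printing Implicit Defensive.
Import Order.TTheory GRing.Theory Num.Theory.
Import numFieldNormedType.Exports.
Local Open Scope classical_set_scope.
Local Open Scope ring_scope.

(* The product sigma-algebra on row vectors, built exactly as the library
   does for n.-tuple T; on 'rV[R]_n it is the Borel sigma-algebra. *)
Section measurable_rV.
Context {d : measure_display} {T : measurableType d} (n : nat).

Let coord (i : 'I_n) (v : 'rV[T]_n) : T := v ord0 i.

Let rV_set0 : g_sigma_preimage coord set0.
Proof. exact: sigma_algebra0. Qed.

Let rV_setC A : g_sigma_preimage coord A -> g_sigma_preimage coord (~` A).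
Proof. exact: sigma_algebraC. Qed.

Let rV_bigcup (F : (set 'rV[T]_n)^nat) :
  (forall i, g_sigma_preimage coord (F i)) ->
  g_sigma_preimage coord (\bigcup_i F i).
Proof. exact: sigma_algebra_bigcup. Qed.

HB.instance Definition _ := @isMeasurable.Build (measure_tuple_display d)
  'rV[T]_n (g_sigma_preimage coord) rV_set0 rV_setC rV_bigcup.

End measurable_rV.

Lemma measurable_coord (d : measure_display) (T : measurableType d) (n : nat)
    (i : 'I_n) : measurable_fun [set: 'rV[T]_n] (fun v => v ord0 i).
Proof.
move=> _ Y mY; rewrite setTI; apply: sub_sigma_algebra => /=.
rewrite -bigcup_seq/=; exists i => /=; first by rewrite mem_index_enum.
by exists Y => //; rewrite setTI.
Qed.

Lemma measurable_fun_coordP (d1 d2 : measure_display) (T1 : measurableType d1)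
    (T2 : measurableType d2) (n : nat) (f : T1 -> 'rV[T2]_n) :
  measurable_fun [set: T1] f <->
  forall i, measurable_fun [set: T1] (fun x => f x ord0 i).
Proof.
split=> [mf i|mf].
  exact: (measurableT_comp (measurable_coord i) mf).
move=> _ Y mY; rewrite setTI.
suff : preimage_set_system [set: T1] f (@measurable _ 'rV[T2]_n) `<=` measurable.
  by apply; exists Y; rewrite ?setTI.
have -> : @measurable _ 'rV[T2]_n =
    g_sigma_preimage (fun i (v : 'rV[T2]_n) => v ord0 i) by [].
rewrite -(g_sigma_preimage_comp (T := 'rV[T2]_n)).
apply: smallest_sub; first exact: sigma_algebra_measurable.
move=> A; rewrite -bigcup_seq/= => -[i _ [B mB <-]].
exact: mf.
Qed.

(* Lebesgue measure on R^n.+1 is the image of the product of the Lebesgue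
   measures on R and R^n under concatenation. *)
Section lebesgue_rV.
Context {R : realType}.

Section step.
Variables (n : nat) (m : {sigma_finite_measure set 'rV[R]_n -> \bar R}).

Let cons_rV (p : measurableTypeR R * 'rV[R]_n) : 'rV[R]_n.+1 :=
  row_mx (const_mx p.1 : 'rV_1) p.2.

Definition lebesgue_rVS : set 'rV[R]_n.+1 -> \bar R :=
  pushforward (lebesgue_measure \x m)%E cons_rV.

Let measurable_cons_rV : measurable_fun setT cons_rV.
Proof.
apply/measurable_fun_coordP => i.
have [j ->|j ->] := split_ordP (i : 'I_(1 + n)).
  apply: (eq_measurable_fun fst); last exact: measurable_fst.
  by move=> p _; apply: esym; rewrite [LHS]row_mxEl mxE.
apply: (eq_measurable_fun (fun p : measurableTypeR R * 'rV[R]_n => p.2 ord0 j)).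
  by move=> p _; apply: esym; exact: row_mxEr.
exact: (measurableT_comp (measurable_coord j) measurable_snd).
Qed.

Let step0 : lebesgue_rVS set0 = 0%E.
Proof. exact: measure0. Qed.

Let step_ge0 A : (0 <= lebesgue_rVS A)%E.
Proof. exact: measure_ge0. Qed.

Let step_sigma_additive : semi_sigma_additive lebesgue_rVS.
Proof. exact: measure_semi_sigma_additive. Qed.

HB.instance Definition _ := isMeasure.Build _ _ _ lebesgue_rVS
  step0 step_ge0 step_sigma_additive.

Let uncons_rV (v : 'rV[R]_n.+1) : measurableTypeR R * 'rV[R]_n :=
  (v ord0 ord0, \row_j v ord0 (lift ord0 j)).

Let measurable_uncons_rV : measurable_fun setT uncons_rV.
Proof.
apply: measurable_fun_pair; first exact: measurable_coord.
apply/measurable_fun_coordP => i.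
apply: (eq_measurable_fun (fun v : 'rV[R]_n.+1 => v ord0 (lift ord0 i))).
  by move=> v _; rewrite mxE.
exact: measurable_coord.
Qed.

Let cons_rVK : cancel cons_rV uncons_rV.
Proof.
move=> [a u]; congr (_, _).
  have -> : ord0 = lshift n (ord0 : 'I_1) by exact/val_inj.
  by rewrite [LHS]row_mxEl mxE.
apply/rowP => j; rewrite mxE.
have -> : lift ord0 j = rshift 1 j by exact/val_inj.
exact: row_mxEr.
Qed.

Let sigma_finite_lebesgue_rVS : sigma_finite setT lebesgue_rVS.
Proof.
have [F FT Foo] : sigma_finite setT (lebesgue_measure \x m)%E.
  have /sigma_finiteP[F [FT ndF Foo]] := sigma_finiteT (@lebesgue_measure R).
  have /sigma_finiteP[G [GT ndG Goo]] := sigma_finiteT m.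
  exists (fun k => F k `*` G k).
    rewrite -setXTT FT GT predeqE => -[x y]; split.
      move=> [/= [j _ Fjx] [k _ Gky]]; exists (maxn j k) => //; split.
      - by move: x Fjx; exact/subsetPset/ndF/leq_maxl.
      - by move: y Gky; exact/subsetPset/ndG/leq_maxr.
    by move=> [k _ []/= ? ?]; split; exists k.
  move=> k; have [? ?] := Foo k; have [? ?] := Goo k.
  split; first exact: measurableX.
  by rewrite product_measure1E// lte_mul_pinfty// ge0_fin_numE.
exists (fun k => uncons_rV @^-1` F k).
  by rewrite -preimage_bigcup -FT preimage_setT.
move=> k; have [mF Fk] := Foo k; split.
  by rewrite -[X in measurable X]setTI; exact: measurable_uncons_rV.
rewrite /lebesgue_rVS /pushforward -comp_preimage.
rewrite (_ : uncons_rV \o cons_rV = id)//.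
by apply/funext => p; exact: cons_rVK.
Qed.

HB.instance Definition _ := Measure_isSigmaFinite.Build _ _ _ lebesgue_rVS
  sigma_finite_lebesgue_rVS.

End step.

Fixpoint lebesgue_rV (n : nat) : {sigma_finite_measure set 'rV[R]_n -> \bar R} :=
  match n with
  | 0 => \d_(0 : 'rV[R]_0)
  | n'.+1 => lebesgue_rVS (lebesgue_rV n')
  end.

End lebesgue_rV.

Section fourier.
Context {R : realType} {n : nat}.

(* Stated for a bare set function, like the library's \int, so that it applies
   to a pushforward without carrying a measurability proof. *)
Definition fourier (nu : set 'rV[R]_n -> \bar R) (xi : 'rV[R]_n) : R[i] :=
  let phase (x : 'rV[R]_n) := 2 * pi * \sum_(i < n) xi ord0 i * x ord0 i in
  Complex (fine (\int[nu]_x (cos (phase x))%:E))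
          (fine (\int[nu]_x (sin (phase x))%:E)).

End fourier.

Section measures_on_the_line.
Context {R : realType}.
Implicit Types mu : probability (measurableTypeR R) R.

Definition self_similar mu :=
  exists (n : nat) (w a b : 'I_n -> R),
    [/\ forall i, 0 < w i,
        \sum_(i < n) w i = 1,
        forall i, 0 < `|a i| < 1 &
        forall A, measurable A ->
          mu A = (\sum_(i < n) (w i)%:E *
            pushforward mu (fun x => a i * x + b i : measurableTypeR R)%R A)%E].

Definition non_atomic mu := forall x : R, mu [set x] = 0%E.

Definition msupport mu : set R :=
  [set x | forall V : set R, open V -> V x -> (0 < mu V)%E].

Definition moment_curve (k : nat) (x : R) : 'rV[R]_k := \row_(i < k) x ^+ i.+1.

(* The image of mu under a map Q that is only meaningful on a set U of full
   measure: the values of the total function Q outside U are ignored. *)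
Definition pushforward_on (U : set R) {n : nat} (Q : R -> 'rV[R]_n) mu :
    set 'rV[R]_n -> \bar R :=
  fun A => mu (U `&` Q @^-1` A).

End measures_on_the_line.

Section curves.
Context {R : realType} {n : nat}.
Implicit Types (U : set R) (Q : R -> 'rV[R]_n).

Definition continuously_differentiable_on (k : nat) U Q :=
  (forall j x, (j < k)%N -> U x -> derivable (derive1n j Q) x 1) /\
  (forall x, U x -> {for x, continuous (derive1n k Q)}).

Definition analytic_on U Q :=
  forall (i : 'I_n) x, U x -> exists c : R^nat,
    \forall y \near x, pseries c (y - x) @ \oo --> Q y ord0 i.

Definition curve_det Q (x : R) : R :=
  \det (\matrix_(i < n, j < n) derive1n j.+1 Q x ord0 i).

Definition non_degenerate U Q :=
  continuously_differentiable_on n.+1 U Q /\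
  forall x, U x -> curve_det Q x != 0.

Definition non_trapped U Q :=
  analytic_on U Q /\
  forall a b : R, `[a, b] `<=` U ->
    finite_set [set x | x \in `[a, b] /\ curve_det Q x = 0].

End curves.

Definition graph_curve {R : realType} {m : nat} (g : R -> 'rV[R]_m) (x : R) :
  'rV[R]_(1 + m) := row_mx (const_mx x) (g x).

(* `|_| on 'rV[R]_m is the max norm. *)
Definition fourier_region {R : realType} {m : nat} (r eps : R) :
    set 'rV[R]_(1 + m) :=
  [set xi : 'rV[R]_(1 + m) | let theta := lsubmx xi ord0 ord0 in let zeta := rsubmx xi in
            `|theta| `^ eps <= `|zeta| <= r].

(* Main.v *)
Require Import Defs.
From mathcomp Require Import all_boot all_order all_algebra.
From mathcomp Require Import all_classical all_reals all_analysis measurable_realfun.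
From mathcomp Require Import complex.
From mathcomp Require Import ring lra zify.
Set Implicit Arguments.
Unset Strict Implicit.
Unset Printing Implicit Defensive.
Import Order.TTheory GRing.Theory Num.Theory.
Import numFieldNormedType.Exports.
Local Open Scope classical_set_scope.
Local Open Scope ring_scope.

(** Write [xi = (th, ze)] and [t = |ze|].  It suffices to prove the
    pointwise bound [|nu^(xi)| <= C t^(-sg)] for [t >= 1] and [|th|^eps <= t]: on
    that region [t] dominates a power of [|xi|], so for large [p] the integral
    even converges, by comparison with the product of the [1 / (1 + xi_i^2)].

    For the pointwise bound, subdivide [mu] into affine images [f_w mu] of ratio
    [a_w] comparable to [t^(-3/4)].  On such a piece the phase is affine up to an
    error [O(t^(-1/2))], so [|nu^(xi)|] is at most the average over [w] of
    [|mu^(a_w h(x_w))|], up to that error, where [h = th + <ze, g'>].  Since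
    [mu^] is the restriction of the transform of [V_(d-1) mu] to the first axis,
    the hypothesis and the Lipschitz property of the transform show that [|mu^|]
    exceeds a small negative power of [T] in [[-T, T]] only on few unit
    intervals, and the ratios [a_w] take only polylogarithmically many values
    because the products of the contractions commute.  So it remains to bound,
    for an interval [J] much shorter than [t], the [mu]-measure of [h^-1(J)].
    Non-degeneracy, as well as analyticity without trapping, provides around each
    point of the support a derivative of [h] comparable to [t]; hence [h^-1(J)] is
    covered by boundedly many intervals of length [t^(-c)], and these have small
    mass because a non-atomic self-similar measure is Hoelder regular. *)

(** * Sublevel sets of functions with a large derivative *)

Section sublevel_sets.
Context {R : realType}.
Implicit Types (E : set R) (h : nat -> R -> R).

(** A piece [f_w] sees only the frequency [a_w h(x_w)], and both factors depend on [w]. A bad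
    frequency confines [h(x_w)] to an interval only once the ratio is known; hence the union bound
    runs over pairs of a ratio and a bad interval, and there must be few distinct ratios. The
    exponent 3/4 could be any [c] with [1/2 < c < 1]. Pieces of size [t^(-c)] give a quadratic error
    [t^(1 - 2c)], which asks for [c > 1/2]; a bounded interval of frequencies pulls back to an
    interval of length about [t^c] for [h], which is much shorter than [t] only if [c < 1], and
    which exceeds the variation [t^(1 - c)] of [h] on a piece. The order of choices matters. The
    Hoelder exponent and the orders of the derivatives fix a gain [t^(-e)]; the counts of ratios and
    of bad intervals may then lose [t^(e/4)] each; only after that does the hypothesis return the
    threshold below which a frequency is good. The condition [|th|^eps <= |ze|] keeps [h] below a
    fixed power of [t], so that these losses are indeed powers of [t]. *)

Lemma mvt_le (f df : R -> R) (x y M : R) :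
  (forall z, Num.min x y <= z <= Num.max x y -> is_derive z 1 f (df z)) ->
  (forall z, Num.min x y <= z <= Num.max x y -> `|df z| <= M) ->
  `|f x - f y| <= M * `|x - y|.
Proof.
wlog xy : x y / x < y.
  move=> h; have [->|] := eqVneq x y; first by rewrite !subrr normr0 mulr0.
  rewrite neq_lt => /orP[/h//|/h].
  by rewrite minC maxC distrC [`|y - x|]distrC.
rewrite (min_l (ltW xy)) (max_r (ltW xy)) => dfz dfM.
have [||c] := @MVT R f df x y xy.
- by move=> z; rewrite in_itv/= => zxy; apply: dfz; lra.
- apply: derivable_within_continuous => z; rewrite in_itv/= => zxy.
  by apply: (@ex_derive _ _ _ _ _ _ (df z)); apply: dfz.
rewrite in_itv/= => cxy fyx.
rewrite distrC fyx normrM [`|x - y|]distrC ler_wpM2r//.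
by apply: dfM; lra.
Qed.

(** Greedy selection from the left: a point of [E] within [dl] of the infimum is kept and everything
    up to [inf E + 2 * dl] is discarded, so the next point is at least [dl] away. The infimum need
    not be attained, whence covering intervals of length [2 * dl]. *)
Lemma separated_or_covered (K : nat) E (dl m : R) : 0 < dl ->
  (forall x, E x -> m <= x) ->
  (exists x : nat -> R, (forall i, (i <= K)%N -> E (x i)) /\
     (forall i, (i < K)%N -> x i + dl <= x i.+1)) \/
  (exists s : seq R, (size s <= K)%N /\
     forall y, E y -> exists2 t, t \in s & t <= y <= t + 2 * dl).
Proof.
move=> dl0; elim: K E m => [|K IH] E m Em.
  have [->|/set0P[x Ex]] := eqVneq E set0; first by right; exists [::].
  by left; exists (fun=> x).
have [E0|/set0P E0] := eqVneq E set0.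
  by right; exists [::]; split => // y; rewrite E0.
have infE : has_inf E by split => //; exists m.
have [x0 Ex0 x0l] := @inf_adherent _ E dl dl0 infE.
have lbE y : E y -> inf E <= y by exact: ge_inf infE.2 _.
have [|[x [Ex sx]]|[s [ss sE]]] := IH (E `&` [set y | inf E + 2 * dl < y]) m.
- by move=> x [/Em].
- left; exists (fun i => if i is j.+1 then x j else x0); split.
    by case=> // i /Ex[].
  case=> [_|i]; last exact: sx.
  by have [_ /=] := Ex 0%N isT; lra.
- right; exists (inf E :: s); split => // y Ey.
  have [yl|yl] := leP y (inf E + 2 * dl).
    by exists (inf E); rewrite ?inE ?eqxx// yl lbE.
  have [t ts ty] := sE y (conj Ey yl).
  by exists t; rewrite ?inE ?ts ?orbT.
Qed.

(* The mean value theorem applied between consecutive points gives a small value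
   of the derivative; every other of these intermediate points is again separated. *)
Lemma separated_sublevel (k : nat) h (u v c dl l : R) (x : nat -> R) : 0 < dl ->
  (forall j y, (j < k)%N -> u < y < v -> is_derive y 1 (h j) (h j.+1 y)) ->
  (forall y, u < y < v -> c <= `|h k y|) ->
  (forall i, (i < 2 ^ k)%N -> u < x i < v) ->
  (forall i, (i.+1 < 2 ^ k)%N -> x i + dl <= x i.+1) ->
  (forall i, (i < 2 ^ k)%N -> `|h 0%N (x i)| <= l) ->
  c <= (2 / dl) ^+ k * l.
Proof.
move=> dl0; elim: k h l x => [|k IH] h l x dh hc xI xs xl.
  by rewrite expr0 mul1r (le_trans (hc _ (xI 0%N isT))) ?xl.
have stepy i : (i.+1 < 2 ^ k.+1)%N ->
    {y | x i < y < x i.+1 & `|h 1%N y| <= 2 / dl * l}.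
  move=> ik; apply/cid2.
  have si := xs _ ik.
  have xI0 := xI _ (ltnW ik); have xI1 := xI _ ik.
  have [|||y] := @MVT R (h 0%N) (h 1%N) (x i) (x i.+1).
  - lra.
  - by move=> y; rewrite in_itv/= => yx; apply: dh => //; lra.
  - apply: derivable_within_continuous => y; rewrite in_itv/= => yx.
    by apply: (@ex_derive _ _ _ _ _ _ (h 1%N y)); apply: dh => //; lra.
  rewrite in_itv/= => yx hy; exists y => //.
  have lt0 : 0 < x i.+1 - x i by lra.
  have : `|h 1%N y| * (x i.+1 - x i) <= 2 * l.
    rewrite -{1}(gtr0_norm lt0) -normrM -hy.
    have := ler_normB (h 0%N (x i.+1)) (h 0%N (x i)).
    have := xl _ ik; have := xl _ (ltnW ik); lra.
  have h0 : 0 <= `|h 1%N y| by [].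
  move=> hl; rewrite mulrAC ler_pdivlMr//; apply: le_trans hl.
  by rewrite ler_wpM2l//; lra.
have ik i : (i < 2 ^ k)%N -> ((i.*2).+1 < 2 ^ k.+1)%N by rewrite expnS; lia.
pose y i := if pselect (i < 2 ^ k)%N is left p then s2val (stepy _ (ik i p)) else 0.
have yP i : (i < 2 ^ k)%N ->
    x i.*2 < y i < x i.*2.+1 /\ `|h 1%N (y i)| <= 2 / dl * l.
  by rewrite /y => p; case: pselect => // q; case: (stepy _ _) => z /=.
rewrite exprSr -mulrA.
apply: (IH (fun j => h j.+1) _ y) => //.
- by move=> j z jk; apply: dh.
- move=> i ik2; have [yi _] := yP _ ik2.
  have := xI _ (ik _ ik2); have := xI _ (ltnW (ik _ ik2)); lra.
- move=> i ik2; have [yi _] := yP _ (ltnW ik2); have [yi1 _] := yP _ ik2.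
  have := xs i.*2.+1; rewrite -doubleS => /(_ (ltnW (ik _ ik2))); lra.
- by move=> i /yP[].
Qed.

(** The dichotomy is applied with [2 ^ k - 1] intervals, since [2 ^ k] separated points would
    contradict [separated_sublevel]. *)
Lemma sublevel_cover (k : nat) h (u v c dl l a : R) : (0 < k)%N -> 0 < dl ->
  (forall j y, (j < k)%N -> u < y < v -> is_derive y 1 (h j) (h j.+1 y)) ->
  (forall y, u < y < v -> c <= `|h k y|) ->
  (2 / dl) ^+ k * l < c ->
  exists s : seq R, (size s <= 2 ^ k)%N /\
    forall y, u < y < v -> `|h 0%N y - a| <= l ->
      exists2 t, t \in s & t <= y <= t + 2 * dl.
Proof.
move=> k0 dl0 dh hc lc.
have [| |[s [ss sE]]] := @separated_or_covered (2 ^ k).-1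
    [set y | u < y < v /\ `|h 0%N y - a| <= l] dl u dl0.
- by move=> x [/andP[/ltW]].
- move=> [x [xE xs]]; suff : c <= (2 / dl) ^+ k * l by rewrite leNgt lc.
  have k2 : (0 < 2 ^ k)%N by rewrite expn_gt0.
  (* Subtracting [a] changes only the function itself; as [k > 0], the derivative of order [k] stays
     the same. *)
  pose h' j y := if j is 0%N then h 0%N y - a else h j y.
  apply: (@separated_sublevel k h' u v c dl l x) => //.
  + case=> [|j] y jk uv /=; last exact: dh.
    have := dh 0%N y k0 uv => d1.
    have -> : h 1%N y = h 1%N y - 0 by rewrite subr0.
    exact: is_deriveB.
  + by case: k k0 hc {dh lc xE xs k2} => // k _ hc y /hc.
  + by move=> i ik; have [|] := xE i; [lia|].
  + by move=> i ik; apply: xs; lia.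
  + by move=> i ik; have [|] := xE i; [lia|].
- exists s; split; first by apply: leq_trans ss _; exact: leq_pred.
  by move=> y uv hy; apply: sE.
Qed.

End sublevel_sets.

(** * Self-similar measures *)

Section expectation.
Context {R : realType}.
Variable mu : probability (measurableTypeR R) R.
Implicit Types (A B : set R) (f : R -> R).

Definition mass A : R := fine (mu A).

Lemma massE A : measurable A -> mu A = (mass A)%:E.
Proof. by move=> mA; rewrite /mass fineK// fin_num_measure. Qed.

Lemma mass_ge0 A : 0 <= mass A.
Proof. by rewrite /mass fine_ge0. Qed.

Lemma massT : mass setT = 1.
Proof. by rewrite /mass probability_setT. Qed.

Lemma le_mass A B : measurable A -> measurable B -> A `<=` B ->
  mass A <= mass B.
Proof.
move=> mA mB AB; rewrite -lee_fin -!massE//.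
by apply: le_measure => //; rewrite inE.
Qed.

Lemma mass_le1 A : measurable A -> mass A <= 1.
Proof. by move=> mA; rewrite -massT; exact: le_mass. Qed.

Lemma massC A : measurable A -> mass (~` A) = 1 - mass A.
Proof.
move=> mA; apply: EFin_inj; rewrite -massE; last exact: measurableC.
by rewrite probability_setC// EFinB -massE.
Qed.

Lemma massU A B : measurable A -> measurable B ->
  mass (A `|` B) <= mass A + mass B.
Proof.
move=> mA mB; rewrite -lee_fin EFinD -!massE//; last exact: measurableU.
exact: measureU2.
Qed.

Lemma mass_setI_full A B : measurable A -> measurable B -> mass B = 1 ->
  mass (A `&` B) = mass A.
Proof.
move=> mA mB B1; apply/eqP; rewrite eq_le; apply/andP; split.
  by apply: le_mass => //; exact: measurableI.
have mAB : measurable (A `&` B) by exact: measurableI.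
have mBC : measurable (~` B) by exact: measurableC.
have : mass A <= mass ((A `&` B) `|` ~` B).
  apply: le_mass => //; first exact: measurableU.
  by move=> x Ax; have [Bx|nBx] := pselect (B x); [left|right].
move=> /le_trans/(_ (massU mAB mBC)).
by rewrite massC// B1 subrr addr0.
Qed.

Lemma mass_seq_cover (I : eqType) (s : seq I) (F : I -> set R) A (M : R) :
  measurable A -> (forall i, measurable (F i)) ->
  (forall x, A x -> exists2 i, i \in s & F i x) ->
  (forall i, mass (F i) <= M) -> mass A <= (size s)%:R * M.
Proof.
move=> mA mF cov leM.
elim: s A mA cov => [|i s IH] A mA cov.
  rewrite mul0r (_ : A = set0) ?/mass ?measure0//.
  by apply/seteqP; split => // x /cov[].
have mFi := mF i.
have mAF : measurable (A `\` F i) by exact: measurableD.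
have := massU mFi mAF; rewrite /= -natr1 mulrDl mul1r => le1.
apply: (@le_trans _ _ (mass (F i `|` (A `\` F i)))).
  apply: le_mass => //; first exact: measurableU.
  by move=> x Ax; have [Fx|nFx] := pselect (F i x); [left|right].
apply: (le_trans le1); rewrite addrC lerD//; apply: IH => // x [/cov[j]].
by rewrite inE => /orP[/eqP -> //|js Fx _]; exists j.
Qed.

End expectation.

(** * Refinements of an iterated function system *)

Section iterated_function_systems.
Context {R : realType}.
Variable mu : probability (measurableTypeR R) R.
Notation m := (mass mu).

(* A piece [(w, a, b)] stands for the map [x |-> a x + b] taken with weight [w]. *)
Definition piece : Type := (R * R * R)%type.
Definition weight (t : piece) := t.1.1.
Definition ratio (t : piece) := t.1.2.
Definition aff (t : piece) (x : R) : R := ratio t * x + t.2.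
Definition piece_comp (t s : piece) : piece :=
  (weight t * weight s, ratio t * ratio s, ratio t * s.2 + t.2).

(** Ratios are merely nonzero, so that the identity with weight 1 qualifies: subdivisions start from
    it. *)
Definition represents (L : seq piece) :=
  [/\ forall t, t \in L -> 0 < weight t /\ ratio t != 0,
      \sum_(t <- L) weight t = 1 &
      forall A : set R, measurable A ->
        m A = \sum_(t <- L) weight t * m (aff t @^-1` A)].

Lemma aff_comp t s x : aff (piece_comp t s) x = aff t (aff s x).
Proof. by rewrite /aff /piece_comp /ratio /=; ring. Qed.

Lemma continuous_aff t : continuous (aff t).
Proof.
by move=> x; apply: cvgD; [apply: cvgMr; exact: cvg_id|exact: cvg_cst].
Qed.

Lemma measurable_aff t : measurable_fun [set: R] (aff t).
Proof. apply: continuous_measurable_fun; exact: continuous_aff. Qed.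

Lemma measurable_preimage_aff t A : measurable A -> measurable (aff t @^-1` A).
Proof. by move=> mA; rewrite -[X in measurable X]setTI; exact: measurable_aff. Qed.

Lemma self_similar_represents : self_similar mu ->
  exists L, represents L /\ forall t, t \in L -> `|ratio t| < 1.
Proof.
move=> [n [w [a [b [w0 w1 a1 muE]]]]].
pose L : seq piece := [seq (w i, a i, b i) | i <- index_enum 'I_n].
exists L; split; last first.
  by move=> t /mapP[i _ ->]; have /andP[] := a1 i.
split.
- move=> t /mapP[i _ ->]; split; first exact: w0.
  by have /andP[] := a1 i; rewrite normr_gt0.
- by rewrite /L big_map.
- move=> A mA; rewrite /L big_map; apply: EFin_inj.
  rewrite -massE// muE// -sumEFin; apply: eq_bigr => i _.
  rewrite EFinM -massE//.
  exact: (@measurable_preimage_aff (w i, a i, b i)).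
Qed.

(** [P] is the stopping rule of the subdivision. *)
Definition refine (P : pred piece) (L0 L : seq piece) : seq piece :=
  flatten [seq if P t then [:: t] else [seq piece_comp t s | s <- L0] | t <- L].

Lemma represents_refine P L0 L :
  represents L0 -> represents L -> represents (refine P L0 L).
Proof.
move=> [w0 s0 m0] [w1 s1 m1]; split.
- move=> t /flattenP[l /mapP[u uL ->]].
  have [wu au] := w1 _ uL.
  case: ifP => _; first by rewrite inE => /eqP ->.
  move=> /mapP[s sL ->]; have [ws as_] := w0 _ sL.
  by rewrite /piece_comp /weight /ratio/= mulr_gt0// mulf_neq0.
- rewrite /refine big_flatten/= big_map -[RHS]s1; apply: eq_bigr => t _.
  case: ifP => _; first by rewrite big_seq1.
  by rewrite big_map/= -mulr_sumr s0 mulr1.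
- move=> A mA; rewrite m1// /refine big_flatten/= big_map.
  apply: eq_bigr => t _.
  case: ifP => _; first by rewrite big_seq1.
  rewrite big_map m0; last exact: measurable_preimage_aff.
  rewrite mulr_sumr; apply: eq_bigr => s _.
  rewrite mulrA; congr (_ * m _).
  by apply/seteqP; split => x /=; rewrite aff_comp.
Qed.

Lemma represents_id : represents [:: (1, 1, 0)].
Proof.
split.
- by move=> t; rewrite inE => /eqP ->; rewrite /weight /ratio/=.
- by rewrite big_seq1.
- move=> A mA; rewrite big_seq1 mul1r; congr m.
  by apply/seteqP; split => x; rewrite /aff /ratio /preimage/= mul1r addr0.
Qed.

Lemma mass_represents_gt0 L t A : represents L -> t \in L -> measurable A ->
  0 < m (aff t @^-1` A) -> 0 < m A.
Proof.
move=> [w1 _ mE] tL mA A0; rewrite mE// (big_rem t)//= ltr_pwDl//.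
  by rewrite mulr_gt0//; have [] := w1 _ tL.
by rewrite big_seq sumr_ge0// => s /mem_rem/w1[/ltW ? _]; rewrite mulr_ge0// mass_ge0.
Qed.

(** Only the number of uses of each map is recorded, not their order. Words of length [k] therefore
    give polynomially many ratios in [k], although there are exponentially many words. *)
Definition generated (L0 : seq piece) (t : piece) :=
  exists c : 'I_(size L0) -> nat,
    ratio t = \prod_(i < size L0) ratio (nth (1, 1, 0) L0 i) ^+ c i.

(* Keep replacing the pieces of ratio larger than [dl] by their children. *)
Lemma represents_scale L0 (rho lam dl : R) : represents L0 ->
  0 < rho -> lam < 1 ->
  (forall t, t \in L0 -> rho <= `|ratio t| <= lam) -> 0 < dl <= 1 ->
  exists L, represents L /\
    forall t, t \in L -> rho * dl <= `|ratio t| <= dl /\ generated L0 t.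
Proof.
move=> L0r rho0 lam1 aL0 /andP[dl0 dl1].
have L0_ex : exists t, t \in L0.
  case: L0 L0r {aL0} => [[_ + _]|t s _]; last by exists t; rewrite inE eqxx.
  by rewrite big_nil => /esym/eqP; rewrite oner_eq0.
have rho1 : rho <= 1.
  by have [t /aL0/andP[/le_trans h /h /le_trans]] := L0_ex; apply; exact: ltW.
have lam0 : 0 < lam.
  by have [t /aL0/andP[/(lt_le_trans rho0)/lt_le_trans]] := L0_ex; apply.
(* After [k] rounds a piece has stopped or has ratio at most [lam ^+ k]. A piece is divided only
   while its ratio exceeds [dl], so its children keep a ratio of at least [rho * dl]. *)
have step k : exists L, represents L /\ forall t, t \in L ->
    [/\ rho * dl <= `|ratio t|, `|ratio t| <= dl \/ `|ratio t| <= lam ^+ k &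
        generated L0 t].
  elim: k => [|k [L [Lr aL]]].
    exists [:: (1, 1, 0)]; split; first exact: represents_id.
    move=> t; rewrite inE => /eqP ->; split.
    - by rewrite /ratio/= normr1; nra.
    - by right; rewrite expr0 /ratio /= normr1.
    - by exists (fun=> 0%N); rewrite big1.
  exists (refine (fun t => `|ratio t| <= dl) L0 L); split.
    exact: represents_refine.
  move=> t /flattenP[l /mapP[u uL ->]].
  have [au1 au2 [c cu]] := aL _ uL.
  case: ifP => ud.
    by rewrite inE => /eqP ->; split => //; [left|exists c].
  move=> /mapP[s sL ->].
  have au3 : `|ratio u| <= lam ^+ k by case: au2 => //; rewrite ud.
  have ud' : dl < `|ratio u| by rewrite ltNge ud.
  have /andP[as1 as2] := aL0 _ sL.
  rewrite /generated /piece_comp /ratio/= -/(ratio u) -/(ratio s) normrM; split.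
  - nra.
  - by right; rewrite exprSr ler_pM.
  - have sidx : (index s L0 < size L0)%N by rewrite index_mem.
    pose i0 := Ordinal sidx.
    exists (fun i => (c i + (i == i0))%N).
    rewrite cu [RHS](eq_bigr (fun i : 'I_(size L0) => ratio (nth (1, 1, 0) L0 i) ^+ c i *
      ratio (nth (1, 1, 0) L0 i) ^+ (i == i0))); last by move=> i _; rewrite exprD.
    rewrite big_split/=; congr (_ * _).
    rewrite (bigD1 i0)//= eqxx expr1 nth_index// big1 ?mulr1// => i /negbTE ->.
    by rewrite expr0.
have [k kdl] : exists k, lam ^+ k <= dl.
  have lam1' : `|lam| < 1 by rewrite gtr0_norm.
  have /cvgrPdist_le/(_ _ dl0)[k _ /(_ k (leqnn k))] := cvg_expr lam1'.
  rewrite /= sub0r normrN ger0_norm; first by exists k.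
  by rewrite exprn_ge0// ltW.
have [L [Lr aL]] := step k; exists L; split => // t /aL[-> h ?].
by split => //=; case: h => // /le_trans; apply.
Qed.

End iterated_function_systems.

(** * The support of a self-similar measure *)

Section support.
Context {R : realType}.
Variable mu : probability (measurableTypeR R) R.
Notation m := (mass mu).
Local Notation represents := (represents mu).

Lemma seq_lt_ub (T : eqType) (s : seq T) (f : T -> R) (c : R) :
  (forall t, t \in s -> f t < c) ->
  exists M, M < c /\ forall t, t \in s -> f t <= M.
Proof.
elim: s => [_|t s IH fc]; first by exists (c - 1); split => //; lra.
have [|M [Mc sM]] := IH; first by move=> u us; apply: fc; rewrite inE us orbT.
exists (Num.max (f t) M); split.
  by rewrite gt_max Mc fc// inE eqxx.
by move=> u; rewrite inE le_max => /orP[/eqP -> |/sM ->]; rewrite ?lexx ?orbT.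
Qed.

Lemma ratio_bounds (L : seq (piece (R := R))) : represents L ->
  (forall t, t \in L -> `|ratio t| < 1) ->
  exists rho lam : R, [/\ 0 < rho < 1, 0 < lam < 1 &
    forall t, t \in L -> rho <= `|ratio t| <= lam].
Proof.
move=> [w1 _ _] aL.
have [M [M0 LM]] : exists M, M < 0 /\ forall t, t \in L -> - `|ratio t| <= M.
  by apply: seq_lt_ub => t /w1[_ a0]; rewrite oppr_lt0 normr_gt0.
have [N [N1 LN]] := seq_lt_ub aL.
exists (Num.min (- M) (1 / 2)), (Num.max N (1 / 2)); split.
- by rewrite lt_min gt_min oppr_gt0 M0 /=; apply/andP; split; [|apply/orP; right]; lra.
- by rewrite lt_max gt_max N1 /=; apply/andP; split; [apply/orP; right|]; lra.
- move=> t tL; rewrite ge_min le_max (LN t tL) /= andbT.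
  by apply/orP; left; have := LM t tL; lra.
Qed.

Lemma measurable_gt_norm (M : R) : measurable [set x : R | M < `|x|].
Proof.
rewrite -[X in measurable X]setTI.
rewrite (_ : [set x | _] = Num.norm @^-1` `]M, +oo[).
  by apply: normr_measurable => //; exact: measurable_itv.
by apply/seteqP; split => x /=; rewrite in_itv/= andbT.
Qed.

Lemma mass_decreasing_limit (F : (set R)^nat) (e : R) :
  (forall n, measurable (F n)) -> (forall n, F n.+1 `<=` F n) ->
  mu (\bigcap_n F n) = 0%E -> 0 < e -> exists n, m (F n) < e.
Proof.
move=> mF Fn F0 e0.
have : mu \o F @ \oo --> mu (\bigcap_n F n).
  apply: nonincreasing_cvg_mu.
  - by apply: (le_lt_trans (probability_le1 mu (mF 0%N))); exact: ltry.
  - exact: mF.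
  - exact: bigcapT_measurable.
  - by apply/nonincreasing_seqP => n; apply/subsetPset; exact: Fn.
rewrite F0 => /fine_cvgP[_] /cvgrPdist_lt/(_ _ e0)[n _ /(_ n (leqnn n))] /=.
by rewrite sub0r normrN ger0_norm ?mass_ge0//; exists n.
Qed.

Lemma mass_tail (e : R) : 0 < e -> exists n : nat, m [set x | n%:R < `|x|] < e.
Proof.
move=> e0.
apply: (@mass_decreasing_limit (fun n => [set x : R | n%:R < `|x|])) => //.
- by move=> n; exact: measurable_gt_norm.
- by move=> n x /=; apply: le_lt_trans; rewrite ler_nat.
- rewrite (_ : \bigcap_n _ = set0) ?measure0//.
  apply/seteqP; split => // x /= /(_ (Num.truncn `|x|).+1 I) /=.
  by rewrite ltNge (ltW (truncnS_gt _)).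
Qed.

(** If [|a x + b| > M0 + r], then [|x| > M0 + r / lam], because [lam * M0 + bt <= M0], where [bt]
    bounds the translations. The tail beyond [M0 + 1] is thus at most arbitrarily remote tails, and
    vanishes. *)
Lemma mass_bounded (L : seq (piece (R := R))) : represents L ->
  (forall t, t \in L -> `|ratio t| < 1) ->
  exists B : R, 1 <= B /\ m `[- B, B] = 1.
Proof.
move=> Lr aL; have [rho [lam [_ /andP[lam0 lam1] aL1]]] := ratio_bounds Lr aL.
have [bt [_ bL]] : exists M, M < \sum_(t <- L) `|t.2| + 1 /\
    forall t, t \in L -> `|t.2| <= M.
  apply: seq_lt_ub => t tL; rewrite (big_rem t)//= -addrA ltrDl.
  by rewrite ltr_wpDl// sumr_ge0.
have lam1' : 0 < 1 - lam by lra.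
pose M0 := Num.max bt 0 / (1 - lam).
have btm : bt <= (1 - lam) * M0.
  by rewrite mulrC mulfVK ?gt_eqF// le_max lexx.
have M00 : 0 <= M0 by rewrite divr_ge0// ?le_max ?lexx ?orbT// ltW.
pose T (M : R) := m [set x | M < `|x|].
have T_le M N : M <= N -> T N <= T M.
  move=> MN; apply: le_mass; [exact: measurable_gt_norm..|].
  by move=> x /=; exact: le_lt_trans.
have step r : 0 < r -> T (M0 + r) <= T (M0 + r / lam).
  move=> r0; have [w1 s1 mE] := Lr.
  rewrite /T mE; last exact: measurable_gt_norm.
  rewrite -[leRHS]mul1r -s1 mulr_suml big_seq [leRHS]big_seq.
  apply: ler_sum => t tL; have [/ltW wt _] := w1 _ tL.
  rewrite ler_wpM2l//; apply: le_mass.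
  - by apply: measurable_preimage_aff; exact: measurable_gt_norm.
  - exact: measurable_gt_norm.
  - move=> x /=; rewrite /aff => h.
    have := le_lt_trans (lexx _) (lt_le_trans h (ler_normD _ _)).
    rewrite normrM => {}h; have := bL _ tL; have /andP[_ al] := aL1 _ tL => bl.
    have : lam * `|x| > lam * M0 + r.
      have : `|ratio t| * `|x| <= lam * `|x| by rewrite ler_wpM2r.
      lra.
    have -> : lam * M0 + r = lam * (M0 + r / lam).
      by rewrite mulrDr [lam * (r / _)]mulrC divfK// gt_eqF.
    by rewrite ltr_pM2l.
have stepn k : T (M0 + 1) <= T (M0 + lam^-1 ^+ k).
  elim: k => [|k IH]; first by rewrite expr0.
  apply: (le_trans IH); rewrite exprSr; apply: step.
  by rewrite exprn_gt0// invr_gt0.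
have T0 : T (M0 + 1) = 0.
  apply/eqP; rewrite eq_le mass_ge0 andbT leNgt; apply/negP => T1.
  have [n Tn] := mass_tail T1.
  have [k nk] : exists k, n%:R <= M0 + lam^-1 ^+ k.
    have lam2 : `|lam| < 1 by rewrite gtr0_norm.
    have n1 : 0 < (n.+1%:R : R)^-1 by [].
    have /cvgrPdist_le/(_ _ n1)[k _ /(_ k (leqnn k))] := cvg_expr lam2.
    rewrite /= sub0r normrN ger0_norm ?exprn_ge0 ?(ltW lam0)// => h; exists k.
    rewrite exprVn; apply: (@le_trans _ _ (lam ^+ k)^-1); last by lra.
    apply: (@le_trans _ _ n.+1%:R); first by rewrite ler_nat.
    by rewrite -[leLHS]invrK lef_pV2 ?posrE ?invr_gt0 ?exprn_gt0.
  have := le_trans (stepn k) (T_le _ _ nk); rewrite leNgt => /negP; exact.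
exists (M0 + 1); split; first lra.
have : m (~` `[- (M0 + 1), M0 + 1]) = 0.
  rewrite (_ : ~` _ = [set x | M0 + 1 < `|x|])//.
  apply/seteqP; split => x /=; rewrite in_itv/= -ler_norml.
    by move=> /negP; rewrite -ltNge.
  by rewrite ltNge => /negP.
by rewrite massC; [lra|exact: measurable_itv].
Qed.

Local Notation S := (msupport mu).

(** Rational endpoints leave only countably many null intervals, so that the complement of the
    support is a null set. *)
Lemma msupportPn x : ~ S x -> exists p q : R, [/\ p < x < q, m `]p, q[ = 0,
  exists a : rat, p = ratr a & exists b : rat, q = ratr b].
Proof.
move=> /existsNP[V /not_implyP[oV /not_implyP[Vx /negP mV]]].
have {}mV : mu V = 0%E by apply/eqP; rewrite -measure_le0 leNgt.
have /nbhs_ballP[e /= e0 eV] : nbhs x V by exact: open_nbhs_nbhs.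
have lt1 : x - e < x by lra.
have lt2 : x < x + e by lra.
have [p] := @rat_in_itvoo R (x - e) x lt1.
have [q] := @rat_in_itvoo R x (x + e) lt2.
rewrite !in_itv/= => qx px; exists (ratr p), (ratr q); split.
- lra.
- apply/eqP; rewrite eq_le mass_ge0 andbT.
  have -> : 0 = m V by rewrite /mass mV.
  apply: le_mass; [exact: measurable_itv|exact: open_measurable|].
  move=> y /=; rewrite in_itv/= => ypq; apply: eV.
  by rewrite /ball/= ltr_norml; lra.
- by exists p.
- by exists q.
Qed.

Lemma msupport_closed : closed S.
Proof.
rewrite -openC openE => x /msupportPn[p [q [xpq m0 _ _]]].
apply: (filterS _ (near_in_itvoo (_ : x \in `]p, q[))); last by rewrite in_itv.
have oI : open (`]p, q[%classic : set R) by exact: interval_open.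
move=> y ypq Sy; have := Sy _ oI ypq.
by rewrite (massE mu) ?m0 ?ltxx//; exact: measurable_itv.
Qed.

Lemma measurable_msupport : measurable S.
Proof. by apply: closed_measurable; exact: msupport_closed. Qed.

Lemma mass_msupport : m S = 1.
Proof.
suff : m (~` S) = 0 by rewrite massC; [lra|exact: measurable_msupport].
(* An enumeration of the rational intervals of mass zero; all other codes give the empty set. *)
pose F n : set R := if unpickle n is Some (a, b) then
  let I := `]ratr a, ratr b[%classic : set R in
  if m I == 0 then I else set0 else set0.
have mF n : measurable (F n).
  rewrite /F; case: (unpickle n) => [[a b]|]; last exact: measurable0.
  by case: ifP => _; [exact: measurable_itv|exact: measurable0].
have F0 n : mu (F n) = 0%E.
  rewrite /F; case: (unpickle n) => [[a b]|]; last exact: measure0.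
  case: ifPn => [/eqP h|_]; last exact: measure0.
  by rewrite (massE mu) ?h//; exact: measurable_itv.
have : mu.-negligible (\bigcup_k F k).
  apply: negligible_bigcup => k; exists (F k); split;
    [exact: mF|exact: F0|by []].
move=> /(negligibleP mu (bigcupT_measurable _ mF)) FU.
apply/eqP; rewrite eq_le mass_ge0 andbT.
have -> : 0 = m (\bigcup_k F k) by rewrite /mass FU.
apply: le_mass.
- by apply: measurableC; exact: measurable_msupport.
- exact: bigcupT_measurable.
move=> x /msupportPn[p [q [xpq m0 [a pa] [b qb]]]].
have Fab : F (pickle (a, b)) = `]p, q[%classic by rewrite /F pickleK -pa -qb m0 eqxx.
by exists (pickle (a, b)); rewrite ?Fab//= in_itv.
Qed.

Lemma msupport_nonempty : exists x, S x.
Proof.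
apply/set0P/eqP => S0; have := mass_msupport.
by rewrite S0 /mass measure0 /= => /esym/eqP; rewrite oner_eq0.
Qed.

Lemma msupport_sub A : closed A -> m A = 1 -> S `<=` A.
Proof.
move=> cA A1 x Sx; apply/not_notP => nA.
have := Sx (~` A) (closed_openC cA) nA.
by rewrite (massE mu) ?massC ?A1 ?subrr ?ltxx//; [|apply: measurableC]; exact: closed_measurable.
Qed.

Lemma msupport_aff (L : seq (piece (R := R))) t x : represents L -> t \in L ->
  S x -> S (aff t x).
Proof.
move=> Lr tL Sx V oV Vx.
have mV := open_measurable oV.
rewrite (massE mu)// lte_fin; apply: (mass_represents_gt0 Lr tL mV).
rewrite -lte_fin -(massE mu); last exact: measurable_preimage_aff.
apply: Sx => //; apply: open_comp => // y _; exact: continuous_aff.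
Qed.

End support.

(** * Number of ratios at a given scale, and Hoelder regularity *)

Section frostman.
Context {R : realType}.
Variable mu : probability (measurableTypeR R) R.
Notation m := (mass mu).
Local Notation represents := (represents mu).
Local Notation S := (msupport mu).

Lemma geometric_bracket (c x : R) : 0 < c < 1 -> 0 < x <= 1 ->
  exists k : nat, c ^+ k.+1 < x <= c ^+ k.
Proof.
move=> /andP[c0 c1] /andP[x0 x1].
have ex : exists k, c ^+ k < x.
  have c1' : `|c| < 1 by rewrite gtr0_norm.
  have /cvgrPdist_lt/(_ _ x0)[k _ /(_ k (leqnn k))] := cvg_expr c1'.
  by rewrite /= sub0r normrN ger0_norm ?exprn_ge0 ?(ltW c0)//; exists k.
case: (ex_minnP ex) => -[|k] kx kmin; first by rewrite expr0 ltNge x1 in kx.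
exists k; rewrite kx /= leNgt; apply/negP => /kmin; lia.
Qed.

(** Bernoulli's inequality for [e = c ^ q]: raising [k] by 1 adds [1 - e] to [(1 - e) * k.+1] and at
    least [e^-1 - 1] to [e^-1 ^+ k]. It bounds a logarithm of a scale by a small power of that
    scale. *)
Lemma natr_le_powR (c q : R) (k : nat) : 0 < c < 1 -> 0 < q ->
  k.+1%:R <= (1 - c `^ q)^-1 * (c ^+ k) `^ (- q).
Proof.
move=> /andP[c0 c1] q0.
pose e := c `^ q; have e0 : 0 < e by exact: powR_gt0.
have e1 : e < 1.
  by have := @gt0_ltr_powR R q q0 c 1; rewrite powR1/=; apply; rewrite ?nnegrE ?ler01 ?(ltW c0).
rewrite -/e ler_pdivlMl ?subr_gt0//.
have -> : (c ^+ k) `^ (- q) = e^-1 ^+ k.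
  by rewrite powRN -powR_mulrn ?ltW// -powRrM mulrC powRrM powR_mulrn ?powR_ge0// exprVn.
have : (1 - e) * k.+1%:R = 1 - e + (1 - e) * k%:R by rewrite -natr1; ring.
move=> ->; elim: k => [|k IH]; first by rewrite mulr0 addr0 expr0; lra.
have eV : 1 < e^-1 by rewrite invf_gt1.
have ek : 1 <= e^-1 ^+ k by rewrite exprn_ege1// ltW.
rewrite exprS -natr1.
have e' : 1 - e <= e^-1 - 1.
  have : e * e^-1 = 1 by rewrite mulfV// gt_eqF.
  nra.
nra.
Qed.

(** A ratio of size at least [rho * dl] uses each map at most [k] times, where
    [lam ^+ k.+1 < rho * dl]. This leaves [k.+1 ^ n] vectors of exponents, a power of the logarithm
    of the scale, which is recorded as an arbitrarily small power of [dl]. *)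
Lemma generated_ratios (L0 : seq (piece (R := R))) (rho lam kap : R) :
  0 < rho < 1 -> 0 < lam < 1 ->
  (forall t, t \in L0 -> rho <= `|ratio t| <= lam) -> 0 < kap ->
  exists C : R, 0 < C /\ forall dl, 0 < dl <= 1 -> exists As : seq R,
    (size As)%:R <= C * dl `^ (- kap) /\
    forall t, generated L0 t -> rho * dl <= `|ratio t| -> ratio t \in As.
Proof.
move=> /andP[rho0 rho1] /andP[lam0 lam1] aL kap0.
pose n := size L0.
(* Each of the [n] factors [k.+1] costs a multiple of [dl ^ (- q)], and [n * q <= kap]. *)
pose q := kap / n.+1%:R; have q0 : 0 < q by rewrite divr_gt0.
pose D := (1 - lam `^ q)^-1 * rho `^ (- q).
exists (D ^+ n + 1); split.
  rewrite ltr_wpDl// exprn_ge0// /D mulr_ge0 ?powR_ge0//.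
  have := @natr_le_powR lam q 0; rewrite expr0 powR1/= mulr1 lam0 lam1 => /(_ isT q0).
  by apply: le_trans.
move=> dl /andP[dl0 dl1].
have rd0 : 0 < rho * dl by rewrite mulr_gt0.
have [k /andP[k1 k2]] : exists k : nat, lam ^+ k.+1 < rho * dl <= lam ^+ k.
  by apply: geometric_bracket; rewrite ?lam0 ?rd0//=; nra.
pose val (c : {ffun 'I_n -> 'I_k.+1}) :=
  \prod_(i < n) ratio (nth (1, 1, 0) L0 i) ^+ c i.
exists [seq val c | c <- enum {ffun 'I_n -> 'I_k.+1}]; split; last first.
  move=> t [c tc] at_.
  have ck i : (c i < k.+1)%N.
    rewrite ltnS leqNgt; apply/negP => kc; move: at_; apply/negP; rewrite -ltNge.
    apply: le_lt_trans k1; rewrite tc normr_prod (bigD1 i)//=.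
    have al (j : 'I_(size L0)) : `|ratio (nth (1, 1, 0) L0 j)| <= lam.
      by have /aL/andP[] : nth (1, 1, 0) L0 j \in L0 by exact: mem_nth.
    rewrite -[leRHS]mulr1 ler_pM//; last first.
      apply: prodr_ile1 => j _; rewrite normr_ge0 normrX exprn_ile1//.
      by rewrite (le_trans (al j))// ltW.
      rewrite normrX (@le_trans _ _ (lam ^+ c i))//.
        by rewrite lerXn2r ?nnegrE// ltW.
      by rewrite ler_wiXn2l// ltW.
    by apply: prodr_ge0.
  apply/mapP; exists [ffun i => Ordinal (ck i)]; first by rewrite mem_enum.
  by rewrite tc /val; apply: eq_bigr => i _; rewrite ffunE.
rewrite size_map -cardE card_ffun !card_ord natrX.
have kD : k.+1%:R <= D * dl `^ (- q).
  have := @natr_le_powR lam q k; rewrite lam0 lam1 => /(_ isT q0) /le_trans; apply.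
  have lq : 0 < (1 - lam `^ q)^-1.
    have := @natr_le_powR lam q 0; rewrite expr0 powR1/= mulr1 lam0 lam1 => /(_ isT q0).
    exact: lt_le_trans.
  rewrite /D -mulrA ler_wpM2l ?(ltW lq)// -powRM ?(ltW rho0) ?(ltW dl0)//.
  by rewrite !powRN lef_pV2 ?posrE ?powR_gt0 ?exprn_gt0// ge0_ler_powR ?nnegrE ?(ltW q0) ?(ltW rd0) ?exprn_ge0// ltW.
have D0 : 0 <= D.
  have dq : 0 < dl `^ (- q) by exact: powR_gt0.
  by rewrite -(pmulr_lge0 _ dq); apply: le_trans kD.
apply: (@le_trans _ _ ((D * dl `^ (- q)) ^+ n)).
  by rewrite lerXn2r ?nnegrE// (le_trans _ kD).
rewrite exprMn; apply: ler_pM.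
- by rewrite exprn_ge0.
- by rewrite exprn_ge0// powR_ge0.
- by rewrite lerDl.
rewrite -powR_mulrn ?powR_ge0// -powRrM ger_powR ?dl0//.
rewrite mulNr lerN2 /q mulrAC ler_pdivrMr// ler_wpM2l ?(ltW kap0)//.
by rewrite ler_nat.
Qed.

Lemma mass_small_nbhs : non_atomic mu -> forall x, exists n : nat,
  m `[x - n.+1%:R^-1, x + n.+1%:R^-1] < 1 / 2.
Proof.
move=> na x.
apply: (@mass_decreasing_limit _ mu (fun n => `[x - n.+1%:R^-1, x + n.+1%:R^-1]%classic)).
- by move=> n; exact: measurable_itv.
- move=> n y /=; rewrite !in_itv/=.
  have : (n.+2%:R : R)^-1 <= n.+1%:R^-1 by rewrite lef_pV2 ?posrE// ler_nat.
  by move: (n.+2%:R^-1) (n.+1%:R^-1) => a b; lra.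
- rewrite (_ : \bigcap_n _ = [set x]); first exact: na.
  apply/seteqP; split => [y yx|y -> n _ /=]; last first.
    rewrite in_itv/=; have : 0 < (n.+1%:R : R)^-1 by [].
    by move: (n.+1%:R^-1) => a; lra.
  apply/eqP; rewrite -subr_eq0 -normr_le0 leNgt; apply/negP => y0.
  have [n ny] : exists n : nat, n.+1%:R^-1 < `|y - x|.
    exists (Num.truncn `|y - x|^-1); rewrite -[ltRHS]invrK ltf_pV2 ?posrE ?invr_gt0//.
    exact: truncnS_gt.
  have := yx n I; rewrite /= in_itv/= => yn.
  by move: ny yn; rewrite ltNge ler_norml; move: (n.+1%:R^-1) => a; lra.
- by rewrite divr_gt0.
Qed.

Lemma msupport_compact (B : R) : m `[- B, B] = 1 -> compact S.
Proof.
move=> B1; apply: (subclosed_compact (@msupport_closed _ mu) (@segment_compact _ (- B) B)).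
by apply: msupport_sub B1; exact: interval_closed.
Qed.

(** Compactness makes the radius uniform over centres in the support. A short interval that meets
    the support lies in one centred there; any other is null. *)
Lemma uniformly_non_atomic : non_atomic mu -> compact S ->
  exists2 r : R, 0 < r & forall t, m `[t, t + r] <= 1 / 2.
Proof.
move=> na /compact_near_coveringP cS.
have [] := cS R (0^'+) (fun r x => m `[x - r, x + r] <= 1 / 2).
  move=> x Sx; have [n mn] := mass_small_nbhs na x.
  have n0 : 0 < (n.+1%:R : R)^-1 / 2 by rewrite divr_gt0.
  exists ([set y | `|x - y| < n.+1%:R^-1 / 2], [set r | r < n.+1%:R^-1 / 2]) => /=.
    split; first by apply/nbhs_ballP; exists (n.+1%:R^-1 / 2).
    exact: nbhs_right_lt.
  move=> [y r] /= [xy rn]; apply: le_trans (ltW mn).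
  apply: le_mass; [exact: measurable_itv..|].
  by move=> z /=; rewrite !in_itv/=; move: xy rn; rewrite ltr_norml; move: (n.+1%:R^-1) => a; lra.
move=> e /= e0 he; exists (e / 2); first by rewrite divr_gt0.
move=> t; have [[x [Sx xt]]|nS] := pselect (exists x, S x /\ x \in `[t, t + e / 2]).
  have e2 : e / 2 < e by lra.
  have e20 : 0 < e / 2 by rewrite divr_gt0.
  have := he (e / 2); rewrite /ball_/= sub0r normrN gtr0_norm//.
  move=> /(_ e2 e20 x Sx); apply: le_trans.
  apply: le_mass; [exact: measurable_itv..|].
  by move=> z /=; move: xt; rewrite /= !in_itv/=; lra.
suff -> : m `[t, t + e / 2] = 0 by lra.
apply/eqP; rewrite eq_le mass_ge0 andbT.
have <- : m (~` S) = 0 by rewrite massC ?mass_msupport ?subrr//; exact: measurable_msupport.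
apply: le_mass; [exact: measurable_itv|by apply: measurableC; exact: measurable_msupport|].
by move=> x xt Sx; apply: nS; exists x.
Qed.

(* Two pieces with disjoint images of the support: a short interval misses one
   of them, which costs a fixed proportion of the mass at each scale. *)
Lemma frostman (L0 : seq (piece (R := R))) : represents L0 ->
  (forall t, t \in L0 -> `|ratio t| < 1) -> non_atomic mu ->
  exists s C : R, [/\ 0 < s, 1 <= C &
    forall t dl, 0 < dl -> m `[t, t + dl] <= C * dl `^ s].
Proof.
move=> L0r aL0 na.
have [B [B1 mB]] := mass_bounded L0r aL0.
have [rho [lam [/andP[rho0 rho1] /andP[lam0 lam1] aL]]] := ratio_bounds L0r aL0.
have [r r0 half] := uniformly_non_atomic na (msupport_compact mB).
have B0 : 0 < B by lra.
(* The 16 serves in a contradiction below: if all translations were within [4 * eta] of one another,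
   an interval of length [16 * eta <= r] would carry the whole mass. *)
pose eta := Num.min (r / 16) 1.
have eta0 : 0 < eta by rewrite lt_min ltr01 andbT divr_gt0.
have eta1 : eta <= 1 by rewrite ge_min lexx orbT.
have etar : 16 * eta <= r.
  have : eta <= r / 16 by rewrite ge_min lexx.
  lra.
have etaB : 0 < eta / B <= 1.
  by rewrite divr_gt0//= ler_pdivrMr// mul1r (le_trans eta1).
have [L [Lr aLd]] := represents_scale L0r rho0 lam1 aL etaB.
have [w1 s1 mE] := Lr.
have imL t x : t \in L -> `[- B, B]%classic x -> `|aff t x - t.2| <= eta.
  move=> tL; rewrite /= in_itv/= -ler_norml => xB.
  have [/andP[_ at_] _] := aLd t tL.
  rewrite /aff addrK normrM -[eta](divfK (lt0r_neq0 B0)).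
  by rewrite ler_pM.
have [t [s [tL sL ts]]] : exists t s, [/\ t \in L, s \in L & 4 * eta < `|t.2 - s.2|].
  apply: contrapT => nts.
  have [t0 t0L] : exists t0, t0 \in L.
    case: L s1 {mE nts imL aLd w1 Lr} => [|t L _]; last by exists t; rewrite inE eqxx.
    by rewrite big_nil => /esym/eqP; rewrite oner_eq0.
  have : m `[t0.2 - 8 * eta, t0.2 - 8 * eta + r] = 1.
    rewrite mE; last exact: measurable_itv.
    rewrite -[RHS]s1 big_seq [RHS]big_seq; apply: eq_bigr => t tL.
    rewrite -[RHS]mulr1; congr (_ * _); apply/eqP; rewrite eq_le mass_le1/=; last first.
      by apply: measurable_preimage_aff; exact: measurable_itv.
    rewrite -[leLHS]mB; apply: le_mass; first exact: measurable_itv.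
      by apply: measurable_preimage_aff; exact: measurable_itv.
    move=> x xB; rewrite /= in_itv/=.
    have := imL t x tL xB.
    have : `|t.2 - t0.2| <= 4 * eta.
      by rewrite leNgt; apply/negP => h; apply: nts; exists t, t0.
    by rewrite !ler_norml; lra.
  have h := half (t0.2 - 8 * eta); move=> h1; move: h; rewrite h1; lra.
pose rho' := rho * (eta / B).
have rho'0 : 0 < rho' by rewrite mulr_gt0//; case/andP: etaB.
have rho'1 : rho' < 1 by rewrite /rho'; case/andP: etaB; nra.
pose w := Num.min (weight t) (weight s).
have w0 : 0 < w by rewrite lt_min; have [-> _] := w1 t tL; have [-> _] := w1 s sL.
(* [1 - w] bounds the weight that remains when one of the two pieces is missed; the 1/2 keeps [ka]
   positive, as its logarithm is taken below. *)
pose ka := Num.max (1 - w) (1 / 2).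
have ka0 : 0 < ka by rewrite lt_max; apply/orP; right; lra.
have ka1 : ka < 1 by rewrite gt_max; apply/andP; split; lra.
(* The two images of the support are more than [2 * eta] apart, so an interval of length at most
   [eta] misses one of them. Its preimages under the other pieces have length at most
   [dl / rho']. *)
have contract dl M : 0 < dl -> dl <= eta -> 0 <= M ->
    (forall u, m `[u, u + dl / rho'] <= M) -> forall u, m `[u, u + dl] <= ka * M.
  move=> dl0 dle M0 hM u.
  have mJ : measurable `[u, u + dl] by exact: measurable_itv.
  have pre z : z \in L -> m (aff z @^-1` `[u, u + dl]) <= M.
    move=> zL; have [/andP[za _] _] := aLd z zL.
    have za0 : 0 < `|ratio z| by apply: lt_le_trans za.
    pose c := (u + dl / 2 - z.2) / ratio z.
    apply: le_trans (hM (c - dl / rho' / 2)).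
    apply: le_mass.
    - exact: measurable_preimage_aff.
    - exact: measurable_itv.
    move=> x /=; rewrite !in_itv/= => xu.
    have : `|aff z x - (u + dl / 2)| <= dl / 2 by rewrite ler_norml; lra.
    have -> : aff z x - (u + dl / 2) = ratio z * (x - c).
      by rewrite /aff /c; field; rewrite -normr_gt0.
    rewrite normrM => h.
    have : rho' * `|x - c| <= dl / 2 by apply: le_trans h; rewrite ler_wpM2r.
    rewrite -ler_pdivlMl// => {}h.
    have e : rho'^-1 * (dl / 2) = dl / rho' / 2 by rewrite mulrCA mulrA.
    by rewrite e ler_norml in h; lra.
  have [z [zL wz mz]] : exists z, [/\ z \in L, w <= weight z &
      m (aff z @^-1` `[u, u + dl]) = 0].
    have null z : z \in L -> (forall x, `[- B, B]%classic x ->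
        `[u, u + dl]%classic (aff z x) -> False) ->
        m (aff z @^-1` `[u, u + dl]) = 0.
      move=> zL h; apply/eqP; rewrite eq_le mass_ge0 andbT.
      have <- : m (~` `[- B, B]) = 0.
        by rewrite massC ?mB ?subrr//; exact: measurable_itv.
      apply: le_mass.
      - exact: measurable_preimage_aff.
      - by apply: measurableC; exact: measurable_itv.
      - by move=> x xz xB; exact: h xB xz.
    have [[x [xB xt]]|nx] := pselect (exists x, `[- B, B]%classic x /\
        `[u, u + dl]%classic (aff t x)).
      exists s; split => //; first by rewrite ge_min lexx orbT.
      apply: null => // y yB ys.
      have := imL _ _ tL xB; have := imL _ _ sL yB; move: xt ys ts.
      rewrite /= !in_itv/= ltNge => xt ys /negP ts ys' xt'; apply: ts.
      by move: ys' xt'; rewrite !ler_norml; lra.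
    exists t; split => //; first by rewrite ge_min lexx.
    by apply: null => // x xB xt; apply: nx; exists x.
  rewrite mE// (big_rem z)//= mz mulr0 add0r.
  apply: (@le_trans _ _ ((1 - weight z) * M)); last first.
    by rewrite ler_wpM2r// le_max; apply/orP; left; lra.
  rewrite -s1 (big_rem z zL)/= addrAC subrr add0r mulr_suml big_seq [leRHS]big_seq.
  apply: ler_sum => y yL; have yL' := mem_rem yL.
  by rewrite ler_wpM2l ?pre//; have [/ltW] := w1 y yL'.
have iter k : forall u, m `[u, u + eta * rho' ^+ k] <= ka ^+ k.
  elim: k => [u|k IH u]; first by rewrite mulr1 expr0 mass_le1//; exact: measurable_itv.
  rewrite [ka ^+ _]exprS; apply: contract.
  - by rewrite mulr_gt0// exprn_gt0.
  - by rewrite ler_piMr ?(ltW eta0)// exprn_ile1// ltW.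
  - by rewrite exprn_ge0// ltW.
  - by move=> v; rewrite exprS mulrCA mulrAC mulfV ?mul1r// gt_eqF.
(* The exponent with [rho' ^ sg = ka]: lengths shrink by [rho'] while the bound on the mass shrinks
   by [ka]. *)
pose sg := ln ka / ln rho'.
have lnr : ln rho' < 0 by rewrite ln_lt0// rho'0.
have sg0 : 0 < sg.
  by rewrite /sg nmulr_rgt0 ?invr_lt0// ln_lt0// ka0.
have rs : rho' `^ sg = ka.
  by rewrite /powR gt_eqF// /sg divfK ?lt_eqF// lnK// posrE.
exists sg, (Num.max 1 (ka^-1 * eta `^ (- sg))); split => //.
  by rewrite le_max lexx.
move=> u dl dl0; have [dl1|dl1] := leP dl eta; last first.
  apply: (@le_trans _ _ 1); first by apply: mass_le1; exact: measurable_itv.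
  apply: (@le_trans _ _ (ka^-1 * eta `^ (- sg) * dl `^ sg)); last first.
    by rewrite ler_wpM2r ?powR_ge0// le_max lexx orbT.
  apply: (@le_trans _ _ (ka^-1 * 1)); first by rewrite mulr1 invf_ge1// ltW.
  rewrite -mulrA ler_wpM2l ?invr_ge0 ?(ltW ka0)// powRN mulrC ler_pdivlMr ?powR_gt0//.
  by rewrite mul1r ge0_ler_powR ?nnegrE ?(ltW sg0) ?(ltW eta0) ?(ltW dl0)// ltW.
apply: (@le_trans _ _ (ka^-1 * eta `^ (- sg) * dl `^ sg)); last first.
  by rewrite ler_wpM2r ?powR_ge0// le_max lexx orbT.
have [k /andP[k1 k2]] : exists k : nat, rho' ^+ k.+1 < dl / eta <= rho' ^+ k.
  apply: geometric_bracket; first by rewrite rho'0.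
  by rewrite divr_gt0//= ler_pdivrMr ?mul1r.
apply: (@le_trans _ _ (ka ^+ k)).
  apply: le_trans (iter k u); apply: le_mass; [exact: measurable_itv..|].
  move=> x /=; rewrite !in_itv/=.
  by move: k2; rewrite ler_pdivrMr// mulrC; lra.
have -> : ka ^+ k = ka^-1 * ka ^+ k.+1 by rewrite exprS mulKf// gt_eqF.
rewrite -mulrA ler_wpM2l ?invr_ge0 ?(ltW ka0)//.
have -> : eta `^ (- sg) * dl `^ sg = (dl / eta) `^ sg.
  rewrite powRM ?invr_ge0 ?(ltW eta0) ?(ltW dl0)//.
  by rewrite -[eta^-1]powR_inv1 ?(ltW eta0)// -powRrM mulN1r mulrC.
rewrite -rs -powR_mulrn ?powR_ge0// -powRrM mulrC powRrM powR_mulrn ?(ltW rho'0)//.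
rewrite ge0_ler_powR ?nnegrE ?(ltW sg0) ?exprn_ge0 ?(ltW rho'0) ?(ltW k1)//.
by rewrite divr_ge0 ?(ltW dl0) ?(ltW eta0).
Qed.

End frostman.

(** * Oscillatory integrals *)

Section oscillatory_integrals.
Context {R : realType}.
Variable mu : probability (measurableTypeR R) R.
Notation m := (mass mu).
Local Notation represents := (represents mu).
Local Notation S := (msupport mu).
Local Notation mfun f := (measurable_fun [set: R] (f : R -> R)).
Implicit Types (f g phi psi : R -> R).

Definition mean f : R := fine (\int[mu]_x (f x)%:E).

Lemma integrable_bounded f M : mfun f -> (forall x, `|f x| <= M) ->
  mu.-integrable setT (EFin \o f).
Proof.
move=> mf fM; apply: measurable_bounded_integrable => //.
- by apply: (le_lt_trans (probability_le1 mu measurableT)); exact: ltry.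
- by exists M; split; [exact: num_real|move=> y /ltW My x _; exact: le_trans My].
Qed.

Lemma meanD f g M : mfun f -> mfun g -> (forall x, `|f x| <= M) ->
  (forall x, `|g x| <= M) -> mean (fun x => f x + g x) = mean f + mean g.
Proof.
move=> mf mg fM gM.
by apply: (@RintegralD _ _ R mu setT f g) => //; exact: integrable_bounded.
Qed.

Lemma meanZ f k M : mfun f -> (forall x, `|f x| <= M) ->
  mean (fun x => k * f x) = k * mean f.
Proof.
move=> mf fM.
by apply: (@RintegralZl _ _ R mu setT f k) => //; exact: integrable_bounded.
Qed.

Lemma mean_cst c : mean (fun=> c) = c.
Proof.
by rewrite /mean integral_cst// [X in (_ * X)%E](probability_setT mu) mule1.
Qed.

Lemma le_mean_full f g A M : mfun f -> mfun g -> (forall x, `|f x| <= M) ->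
  (forall x, `|g x| <= M) -> measurable A -> m A = 1 ->
  (forall x, A x -> f x <= g x) -> mean f <= mean g.
Proof.
move=> mf mg fM gM mA A1 fg.
have mAC0 : mu (~` A) = 0%E.
  by rewrite (massE mu) ?massC ?A1 ?subrr//; exact: measurableC.
have f_int := integrable_bounded mf fM; have g_int := integrable_bounded mg gM.
have E h : mfun h -> mu.-integrable setT (EFin \o h) -> mean h = mean (h \_ A).
  move=> mh h_int; rewrite /mean; congr fine.
  apply: ae_eq_integral => //.
  - exact/measurable_EFinP.
  - apply/measurable_EFinP/(measurable_restrictT _ mA).
    exact: measurable_funTS.
  - exists (~` A); split.
    + exact: measurableC.
    + exact: mAC0.
    + move=> x /= h' Ax; apply: h' => _; rewrite /patch ifT// inE//.
have I h : mfun h -> mu.-integrable setT (EFin \o h) ->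
    mu.-integrable setT (EFin \o (h \_ A)).
  move=> mh h_int; rewrite -restrict_EFin.
  apply: (proj1 (@integrable_mkcond _ _ R mu A (EFin \o h) mA)).
  exact: (@integrableS _ _ R mu setT A).
rewrite (E f)// (E g)//; apply: (@le_Rintegral _ _ R mu setT) => //; [exact: I..|].
by move=> x _; rewrite /patch; case: ifPn => // /set_mem/fg.
Qed.

(** The identity between masses of sets makes [mu] a finite sum of scaled images of itself, against
    which nonnegative functions can be integrated term by term. *)
Lemma mean_represents (L : seq (piece (R := R))) f M : represents L ->
  mfun f -> (forall x, `|f x| <= M) ->
  mean f = \sum_(t <- L) weight t * mean (f \o aff t).
Proof.
move=> Lr mf fM; have [w1 s1 mE] := Lr.
have M0 : 0 <= M by exact: le_trans (fM 0).
have maff t : mfun (aff t) by exact: measurable_aff.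
have mfa t : mfun (f \o aff t) by exact: measurableT_comp.
(* A bounded function becomes nonnegative on adding [M]; the weights sum to 1, so this constant
   cancels. *)
suff pos g N : mfun g -> (forall x, 0 <= g x <= N) ->
    mean g = \sum_(t <- L) weight t * mean (g \o aff t).
  have /(_ (fun x => f x + M) (M + M)) := pos.
  have -> : mean (fun x => f x + M) = mean f + M.
    rewrite -[X in _ = _ + X](mean_cst M); apply: (@meanD _ _ M) => // x.
    by rewrite ger0_norm.
  move=> h; apply: (addIr M); rewrite h; first 1 last.
  - exact: measurable_funD.
  - by move=> x; have := fM x; rewrite ler_norml; lra.
  rewrite -[X in _ = _ + X]mul1r -s1 mulr_suml -big_split/=.
  apply: eq_bigr => t _; rewrite -mulrDr; congr (_ * _).
  rewrite -[X in _ = _ + X](mean_cst M); apply: (@meanD _ _ M) => //.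
  - exact: mfa.
  - by move=> x; rewrite ger0_norm.
move=> mg g0.
pose t0 : piece (R := R) := (0, 1, 0).
pose pf t : {measure set (measurableTypeR R) -> \bar R} :=
  @measure_function_pushforward__canonical__measure_function_Measure 
    _ _ (measurableTypeR R) (measurableTypeR R) R mu (aff t) (maff t).
pose ms i : {measure set (measurableTypeR R) -> \bar R} :=
  mscale (NngNum (normr_ge0 (weight (nth t0 L i)))) (pf (nth t0 L i)).
have gE x : (0 <= (g x)%:E)%E by rewrite lee_fin; have /andP[] := g0 x.
have mgE : measurable_fun [set: measurableTypeR R] (EFin \o g) by exact/measurable_EFinP.
have nE (i : 'I_(size L)) :
    (NngNum (normr_ge0 (weight (nth t0 L i))))%:num = weight (nth t0 L i).
  by rewrite /= ger0_norm//; have [/ltW] := w1 _ (mem_nth t0 (ltn_ord i)).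
have muE A : measurable A -> mu A = msum ms (size L) A.
  move=> mA; rewrite massE// mE// /msum (big_nth t0) big_mkord -sumEFin.
  apply: eq_bigr => i _; rewrite EFinM; congr (_ * _)%E; first exact: (esym (congr1 EFin (nE i))).
  by rewrite -massE//; exact: measurable_preimage_aff.
transitivity (fine (\int[msum ms (size L)]_x (g x)%:E)%E).
  by congr fine; apply: eq_measure_integral => A mA _; exact: muE.
rewrite ge0_integral_measure_sum// (big_nth t0) big_mkord.
have fin_g t : (\int[mu]_x (g (aff t x))%:E)%E \is a fin_num.
  apply: integrable_fin_num => //; apply: (@integrable_bounded (g \o aff t) N).
    exact: measurableT_comp.
  by move=> x; have := g0 (aff t x); rewrite ler_norml /=; lra.
transitivity (fine (\sum_(i < size L) (weight (nth t0 L i) * mean (g \o aff (nth t0 L i)))%:E)%E).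
  congr fine; apply: eq_bigr => i _.
  rewrite ge0_integral_mscale// EFinM; congr (_ * _)%E; first exact: (congr1 EFin (nE i)).
  rewrite /mean fineK; last exact: fin_g.
  exact: (@ge0_integral_pushforward _ _ (measurableTypeR R) (measurableTypeR R) R _ (maff _) mu setT).
by rewrite sumEFin.
Qed.

(** The modulus of the integral of [exp(i phi)] against [mu]. The transforms of [mu] and of its
    images along curves are all of this form. *)
Definition osc phi : R :=
  Normc.normc (Complex (mean (fun x => cos (phi x))) (mean (fun x => sin (phi x)))).

Lemma measurable_cos_comp phi : mfun phi -> mfun (fun x => cos (phi x)).
Proof.
move=> mphi; apply: measurableT_comp => //.
by apply: continuous_measurable_fun; exact: continuous_cos.
Qed.

Lemma measurable_sin_comp phi : mfun phi -> mfun (fun x => sin (phi x)).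
Proof.
move=> mphi; apply: measurableT_comp => //.
by apply: continuous_measurable_fun; exact: continuous_sin.
Qed.

Lemma norm_cos_le1 (x : R) : `|cos x| <= 1.
Proof. by rewrite ler_norml cos_geN1 cos_le1. Qed.

Lemma norm_sin_le1 (x : R) : `|sin x| <= 1.
Proof. by rewrite ler_norml sin_geN1 sin_le1. Qed.

(* [wave u v phi] is the real part of [conj(u + i v) exp(i phi)]; the modulus of
   the integral of [exp(i phi)] is the maximum of its mean over unit [(u, v)]. *)
Definition wave (u v : R) phi (x : R) := u * cos (phi x) + v * sin (phi x).

(** Cauchy-Schwarz, by Lagrange's identity. *)
Lemma wave_unit (u v c s : R) : u ^+ 2 + v ^+ 2 = 1 ->
  u * c + v * s <= Num.sqrt (c ^+ 2 + s ^+ 2).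
Proof.
move=> uv; apply: (le_trans (ler_norm _)); rewrite -sqrtr_sqr ler_sqrt; last first.
  by rewrite addr_ge0// sqr_ge0.
have : 0 <= (u * s - v * c) ^+ 2 by exact: sqr_ge0.
have -> : (u * s - v * c) ^+ 2 =
  (u ^+ 2 + v ^+ 2) * (c ^+ 2 + s ^+ 2) - (u * c + v * s) ^+ 2 by ring.
by rewrite uv; lra.
Qed.

Lemma unit_bounds (u v : R) : u ^+ 2 + v ^+ 2 = 1 -> `|u| <= 1 /\ `|v| <= 1.
Proof.
move=> uv; rewrite -[`|u|]sqrtr_sqr -[`|v|]sqrtr_sqr -sqrtr1.
have := sqr_ge0 u; have := sqr_ge0 v => v0 u0.
by split; rewrite ler_sqrt//; lra.
Qed.

Lemma norm_wave_le2 (u v : R) phi x : u ^+ 2 + v ^+ 2 = 1 ->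
  `|wave u v phi x| <= 2.
Proof.
move=> /unit_bounds[u1 v1]; apply: (le_trans (ler_normD _ _)); rewrite !normrM.
have := norm_cos_le1 (phi x); have := norm_sin_le1 (phi x) => h1 h2.
rewrite [2](_ : _ = 1 * 1 + 1 * 1); last by ring.
by apply: lerD; exact: ler_pM.
Qed.

Lemma measurable_wave (u v : R) phi : mfun phi -> mfun (wave u v phi).
Proof.
move=> mphi; apply: measurable_funD; apply: measurable_funM => //.
  exact: measurable_cos_comp.
exact: measurable_sin_comp.
Qed.

Lemma mean_wave (u v : R) phi : mfun phi ->
  mean (wave u v phi) = u * mean (fun x => cos (phi x)) + v * mean (fun x => sin (phi x)).
Proof.
move=> mphi.
have mc := measurable_cos_comp mphi; have ms := measurable_sin_comp mphi.
rewrite (@meanD (fun x => u * cos (phi x)) (fun x => v * sin (phi x)) (`|u| + `|v|)).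
- rewrite (@meanZ (fun x => cos (phi x)) u 1) ?(@meanZ (fun x => sin (phi x)) v 1)//.
  + by move=> x; exact: norm_sin_le1.
  + by move=> x; exact: norm_cos_le1.
- exact: measurable_funM.
- exact: measurable_funM.
- move=> x; rewrite normrM ler_wpDr// ler_piMr// ?norm_cos_le1//.
- by move=> x; rewrite normrM ler_wpDl// ler_piMr// norm_sin_le1.
Qed.

Lemma mean_wave_le_osc (u v : R) phi : mfun phi -> u ^+ 2 + v ^+ 2 = 1 ->
  mean (wave u v phi) <= osc phi.
Proof. by move=> mphi uv; rewrite mean_wave//; exact: wave_unit. Qed.

(** The maximizing vector is [(c, s) / osc phi]; if [osc phi] vanishes, so do both means, and
    [(1, 0)] serves. Inequalities between moduli thus reduce to inequalities between means of real
    functions. *)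
Lemma osc_wave phi : mfun phi ->
  exists u v : R, u ^+ 2 + v ^+ 2 = 1 /\ osc phi = mean (wave u v phi).
Proof.
move=> mphi; set c := mean (fun x => cos (phi x)); set s := mean (fun x => sin (phi x)).
have oscE : osc phi = Num.sqrt (c ^+ 2 + s ^+ 2) by [].
have cs0 : 0 <= c ^+ 2 + s ^+ 2 by rewrite addr_ge0// sqr_ge0.
have [n0|n0] := eqVneq (osc phi) 0.
  have cs : c ^+ 2 + s ^+ 2 = 0.
    by move/eqP: n0; rewrite oscE sqrtr_eq0 => n0; apply/eqP; rewrite eq_le n0.
  have c0 : c = 0.
    by apply/eqP; rewrite -(sqrf_eq0 c) eq_le sqr_ge0 andbT; have := sqr_ge0 s; lra.
  have s0 : s = 0.
    by apply/eqP; rewrite -(sqrf_eq0 s) eq_le sqr_ge0 andbT; have := sqr_ge0 c; lra.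
  exists 1, 0; split; first by ring.
  by rewrite mean_wave// -/c -/s n0 c0 s0; ring.
have n2 : osc phi ^+ 2 = c ^+ 2 + s ^+ 2 by rewrite oscE sqr_sqrtr.
exists (c / osc phi), (s / osc phi); split.
  by rewrite !expr_div_n -mulrDl -n2 divff// expf_neq0.
rewrite mean_wave// -/c -/s.
apply: (mulfI n0); rewrite -expr2 n2; field; exact: n0.
Qed.

Lemma osc_le1 phi : mfun phi -> osc phi <= 1.
Proof.
move=> mphi; have [u [v [uv ->]]] := osc_wave mphi.
rewrite -[leRHS](mean_cst 1).
apply: (@le_mean_full _ _ setT 2) => //.
- exact: measurable_wave.
- by move=> x; exact: norm_wave_le2.
- by move=> x; rewrite normr1 ler1n.
- exact: massT.
- move=> x _; apply: (le_trans (wave_unit _ _ uv)).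
  by rewrite cos2Dsin2 sqrtr1.
Qed.

(** Adding a constant to the phase rotates the vector [(u, v)]. *)
Lemma osc_shift phi b : mfun phi -> osc (fun x => phi x + b) <= osc phi.
Proof.
move=> mphi; have mb : mfun (fun x => phi x + b) by exact: measurable_funD.
have [u [v [uv ->]]] := osc_wave mb.
pose u' := u * cos b + v * sin b; pose v' := v * cos b - u * sin b.
have -> : wave u v (fun x => phi x + b) = wave u' v' phi.
  by apply/funext => x; rewrite /wave cosD sinD /u' /v'; ring.
apply: mean_wave_le_osc => //.
have -> : u' ^+ 2 + v' ^+ 2 = (u ^+ 2 + v ^+ 2) * (cos b ^+ 2 + sin b ^+ 2).
  by rewrite /u' /v'; ring.
by rewrite uv cos2Dsin2 mulr1.
Qed.

Lemma lipschitz_cos (x y : R) : `|cos x - cos y| <= `|x - y|.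
Proof.
rewrite -[leRHS]mul1r; apply: (@mvt_le _ cos (fun z => - sin z)) => z _.
by rewrite normrN norm_sin_le1.
Qed.

Lemma lipschitz_sin (x y : R) : `|sin x - sin y| <= `|x - y|.
Proof.
rewrite -[leRHS]mul1r; apply: (@mvt_le _ sin cos) => z _.
exact: norm_cos_le1.
Qed.

(** Cosine and sine are 1-Lipschitz and [|u|, |v| <= 1], so each of the two terms of [wave] moves by
    at most [e]. *)
Lemma osc_perturb phi psi e : mfun phi -> mfun psi ->
  (forall x, S x -> `|phi x - psi x| <= e) -> osc phi <= osc psi + 2 * e.
Proof.
move=> mphi mpsi d; have [u [v [uv ->]]] := osc_wave mphi.
have e0 : 0 <= e by have [x Sx] := msupport_nonempty mu; exact: le_trans (d x Sx).
apply: (@le_trans _ _ (mean (wave u v psi) + 2 * e)); last first.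
  by rewrite lerD2r mean_wave_le_osc.
have mw := measurable_wave u v mpsi.
rewrite -[in leRHS](mean_cst (2 * e)) -(@meanD _ _ (2 + 2 * e))//; last 2 first.
- by move=> x; apply: (le_trans (norm_wave_le2 _ _ uv)); lra.
- by move=> x; rewrite ger0_norm; lra.
apply: (@le_mean_full _ _ S (2 + (2 * e + 2 * e))).
- exact: measurable_wave.
- exact: measurable_funD.
- by move=> x; apply: (le_trans (norm_wave_le2 _ _ uv)); lra.
- move=> x; apply: (le_trans (ler_normD _ _)); rewrite [`|2 * e|]ger0_norm; last lra.
  by have := norm_wave_le2 psi x uv; lra.
- exact: measurable_msupport.
- exact: mass_msupport.
move=> x Sx; rewrite -lerBlDl /wave.
have -> : u * cos (phi x) + v * sin (phi x) - (u * cos (psi x) + v * sin (psi x)) =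
  u * (cos (phi x) - cos (psi x)) + v * (sin (phi x) - sin (psi x)) by ring.
apply: (le_trans (ler_norm _)); apply: (le_trans (ler_normD _ _)); rewrite !normrM.
have [u1 v1] := unit_bounds uv.
have := le_trans (lipschitz_cos (phi x) (psi x)) (d x Sx).
have := le_trans (lipschitz_sin (phi x) (psi x)) (d x Sx) => hs hc.
rewrite mulr2n mulrDl mul1r; apply: lerD; rewrite -[leRHS]mul1r; exact: ler_pM.
Qed.

(** The triangle inequality: the vector [(u, v)] that is optimal for [phi] is used on every
    piece. *)
Lemma osc_represents (L : seq (piece (R := R))) phi : represents L -> mfun phi ->
  osc phi <= \sum_(t <- L) weight t * osc (phi \o aff t).
Proof.
move=> Lr mphi; have [u [v [uv ->]]] := osc_wave mphi.
have [w1 _ _] := Lr.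
rewrite (mean_represents (M := 2) Lr); last 2 first.
- exact: measurable_wave.
- by move=> x; exact: norm_wave_le2.
rewrite big_seq [leRHS]big_seq; apply: ler_sum => t tL.
have [/ltW wt _] := w1 _ tL; rewrite ler_wpM2l//.
apply: (@mean_wave_le_osc u v (phi \o aff t)) => //.
by apply: measurableT_comp => //; exact: measurable_aff.
Qed.

End oscillatory_integrals.

(** * Lebesgue measure on row vectors *)

Section lebesgue_product.
Context {R : realType}.

Lemma measurable_prod_coord (n : nat) (F : 'I_n -> R -> R) :
  (forall i, measurable_fun [set: R] (F i)) ->
  measurable_fun [set: 'rV[R]_n] (fun v : 'rV[R]_n => \prod_(i < n) F i (v ord0 i)).
Proof.
move=> mF; apply: measurable_prod => i _.
by apply: measurableT_comp => //; exact: measurable_coord.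
Qed.

(** Tonelli, along the recursive definition of [lebesgue_rV]. It yields the volumes of cubes, from
    products of indicators, and the integral of the product of the [1 / (1 + xi_i ^ 2)]. *)
Lemma integral_prod_rV (n : nat) (F : 'I_n -> R -> R) (c : 'I_n -> R) :
  (forall i, measurable_fun [set: R] (F i)) -> (forall i x, 0 <= F i x) ->
  (forall i, (\int[@lebesgue_measure R]_x (F i x)%:E)%E = (c i)%:E) ->
  (\int[lebesgue_rV n]_v (\prod_(i < n) F i (v ord0 i))%:E)%E = (\prod_(i < n) c i)%:E.
Proof.
elim: n F c => [|n IH] F c mF F0 Fc.
  rewrite [LHS](_ : _ = (\int[\d_(0%R : 'rV[R]_0)]_(v in setT) (cst 1%E v))%E); last first.
    by apply: eq_integral => v _; rewrite big_ord0.
  by rewrite integral_dirac// big_ord0 diracT mul1e.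
pose cons (p : measurableTypeR R * 'rV[R]_n) : 'rV[R]_n.+1 :=
  row_mx (const_mx p.1 : 'rV_1) p.2.
have consl p : cons p ord0 ord0 = p.1.
  have -> : ord0 = lshift n (ord0 : 'I_1) by exact/val_inj.
  by rewrite [LHS]row_mxEl mxE.
have consr p j : cons p ord0 (lift ord0 j) = p.2 ord0 j.
  have -> : lift ord0 j = rshift 1 j by exact/val_inj.
  exact: row_mxEr.
have mcons : measurable_fun setT cons.
  apply/measurable_fun_coordP => i; have [j ->|->] := unliftP ord0 i.
    apply: (eq_measurable_fun (fun p : measurableTypeR R * 'rV[R]_n => p.2 ord0 j)).
      by move=> p _; rewrite consr.
    exact: (measurableT_comp (measurable_coord j) measurable_snd).
  apply: (eq_measurable_fun fst); last exact: measurable_fst.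
  by move=> p _; rewrite consl.
have mprod := measurable_prod_coord mF.
have prod0 k (G : 'I_k -> R -> R) (v : 'rV[R]_k) : (forall i x, 0 <= G i x) ->
    (0 <= (\prod_(i < k) G i (v ord0 i))%:E)%E.
  by move=> G0; rewrite lee_fin; apply: prodr_ge0.
transitivity (\int[(@lebesgue_measure R \x lebesgue_rV n)%E]_p
    (\prod_(i < n.+1) F i (cons p ord0 i))%:E)%E.
  apply: (@ge0_integral_pushforward _ _ _ _ R cons mcons _ setT
    (fun v => (\prod_(i < n.+1) F i (v ord0 i))%:E)) => //.
  - exact/measurable_EFinP.
  - by move=> v _; exact: prod0.
rewrite fubini_tonelli1//=; last 2 first.
- apply/measurable_EFinP.
  exact: (measurableT_comp mprod mcons).
- by move=> p; exact: prod0.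
pose c' := \prod_(i < n) c (lift ord0 i).
have mF' i : measurable_fun [set: R] (F (lift ord0 i)) by exact: mF.
have IH' := IH (fun i => F (lift ord0 i)) (fun i => c (lift ord0 i)) mF'
  (fun i => F0 _) (fun i => Fc _).
have c'0 : 0 <= c'.
  apply: prodr_ge0 => i _; rewrite -lee_fin -Fc; apply: integral_ge0 => x _.
  by rewrite lee_fin.
transitivity (\int[@lebesgue_measure R]_x ((F ord0 x)%:E * c'%:E))%E.
  apply: eq_integral => x _; rewrite /fubini_F.
  transitivity (\int[lebesgue_rV n]_y ((F ord0 x)%:E *
      (\prod_(i < n) F (lift ord0 i) (y ord0 i))%:E))%E.
    apply: eq_integral => y _; rewrite -EFinM big_ord_recl consl.
    by congr ((_ * _)%:E); apply: eq_bigr => i _; rewrite consr.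
  rewrite ge0_integralZl ?lee_fin//.
  - by rewrite IH'.
  - by apply/measurable_EFinP; exact: (measurable_prod_coord mF').
  - by move=> y _; exact: (prod0 n (fun i => F (lift ord0 i))).
rewrite ge0_integralZr//.
- by rewrite Fc -EFinM big_ord_recl.
- by apply/measurable_EFinP; exact: mF.
- by move=> x _; rewrite lee_fin.
Qed.

Lemma integral_oneDsqrV :
  (\int[@lebesgue_measure R]_x ((1 + x ^+ 2)^-1)%:E)%E = (@pi R)%:E.
Proof.
have -> : (fun x : R => ((1 + x ^+ 2)^-1)%:E) = (fun x => ((oneDsqr x)^-1)%:E) by [].
rewrite ge0_symfun_integralT.
- rewrite -set_itvcy integral0y_oneDsqr -EFinM; congr _%:E; lra.
- by move=> x; rewrite invr_ge0 (le_trans ler01)// oneDsqr_ge1.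
- exact: continuous_oneDsqrV.
- by move=> x; rewrite /= /oneDsqr sqrrN.
Qed.

End lebesgue_product.

(** * Level sets of the transform of the moment curve *)

Section level_sets.
Context {R : realType}.
Import HBNNSimple.

(** The integral involves only the values of the set function on level sets of simple functions,
    which are measurable. This lets a bare set function such as [pushforward_on] be replaced by a
    measure inside [fourier]. *)
Lemma eq_integral_set_function d (T : measurableType d) (nu1 nu2 : set T -> \bar R)
    (f : T -> \bar R) : (forall A, measurable A -> nu1 A = nu2 A) ->
  (\int[nu1]_x f x = \int[nu2]_x f x)%E.
Proof.
move=> nu12; rewrite /integral.
have E (h : T -> \bar R) : [set sintegral nu1 k | k in
      [set k : {nnsfun T >-> R} | forall x, ((k x)%:E <= h x)%E]] =
    [set sintegral nu2 k | k in
      [set k : {nnsfun T >-> R} | forall x, ((k x)%:E <= h x)%E]].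
  have e (k : {nnsfun T >-> R}) : sintegral nu1 k = sintegral nu2 k.
    by rewrite /sintegral; apply: eq_fsbigr => r _; rewrite nu12.
  by apply/seteqP; split => _ [k kh <-]; exists k; rewrite ?e.
by rewrite !E.
Qed.

(* The integral of a nonnegative function is a supremum over simple functions,
   hence monotone without any measurability. *)
Lemma ge0_le_integral_sup d (T : measurableType d) (mu : {measure set T -> \bar R})
    (f g : T -> \bar R) (D E : set T) :
  (forall x, (0 <= (f \_ D) x <= (g \_ E) x)%E) ->
  (\int[mu]_(x in D) f x <= \int[mu]_(x in E) g x)%E.
Proof.
move=> fg; rewrite integral_mkcond [leRHS]integral_mkcond !ge0_integralTE.
- apply: ereal_sup_le => _ [h hf <-]; exists h => // x.
  by apply: (le_trans (hf x)); have /andP[] := fg x.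
- by move=> x; have /andP[/le_trans] := fg x; apply.
- by move=> x; have /andP[] := fg x.
Qed.

Variable mu : probability (measurableTypeR R) R.
Notation m := (mass mu).
Local Notation S := (msupport mu).
Local Notation mfun f := (measurable_fun [set: R] (f : R -> R)).

Definition phase (n : nat) (Q : R -> 'rV[R]_n) (xi : 'rV[R]_n) (x : R) : R :=
  2 * pi * \sum_(i < n) xi ord0 i * Q x ord0 i.

Lemma measurable_phase (n : nat) (Q : R -> 'rV[R]_n) xi :
  (forall i, mfun (fun x => Q x ord0 i)) -> mfun (phase Q xi).
Proof.
move=> mQ; apply: measurable_funM => //; apply: measurable_sum => i.
exact: measurable_funM.
Qed.

(** The passage from the transforms of the statement to [osc]. It is applied to the moment curve and
    to the graph curve extended by 0 outside [U]. *)
Lemma fourier_set_function (n : nat) (Q : R -> 'rV[R]_n) (nu : set 'rV[R]_n -> \bar R) xi :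
  (forall i, mfun (fun x => Q x ord0 i)) ->
  (forall A, measurable A -> nu A = mu (Q @^-1` A)) ->
  Normc.normc (fourier nu xi) = osc mu (phase Q xi).
Proof.
move=> mQ nuE.
have mQ' : measurable_fun [set: measurableTypeR R] Q.
  by apply/measurable_fun_coordP => i; exact: mQ.
have mp : measurable_fun [set: 'rV[R]_n]
    (fun v : 'rV[R]_n => 2 * pi * \sum_(i < n) xi ord0 i * v ord0 i).
  apply: measurable_funM => //; apply: measurable_sum => i.
  by apply: measurable_funM => //; exact: measurable_coord.
have E (h : R -> R) : mfun h -> (forall x, `|h x| <= 1) ->
    (\int[nu]_v (h (2 * pi * \sum_(i < n) xi ord0 i * v ord0 i)%R)%:E =
     \int[mu]_x (h (phase Q xi x))%:E)%E.
  move=> mh h1; rewrite (@eq_integral_set_function _ _ nu (pushforward mu Q))//.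
  apply: (@integral_pushforward _ _ (measurableTypeR R) _ R Q mQ' mu setT
    (fun v : 'rV[R]_n => (h (2 * pi * \sum_(i < n) xi ord0 i * v ord0 i)%R)%:E)) => //.
  - by apply/measurable_EFinP; exact: measurableT_comp.
  - rewrite preimage_setT.
    apply: (@integrable_bounded _ mu (h \o phase Q xi) 1).
      by apply: measurableT_comp => //; exact: measurable_phase.
    by move=> x; exact: h1.
rewrite /fourier /osc /mean E ?E//.
- by apply: continuous_measurable_fun; exact: continuous_sin.
- exact: norm_sin_le1.
- by apply: continuous_measurable_fun; exact: continuous_cos.
- exact: norm_cos_le1.
Qed.

Lemma separated_le (x : nat -> R) (dl : R) (K : nat) : 0 < dl ->
  (forall i, (i < K)%N -> x i + dl <= x i.+1) ->
  forall i j, (i < j <= K)%N -> x i + dl <= x j.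
Proof.
move=> dl0 sx i; elim=> [|j IH] /andP[]; first by [].
rewrite ltnS leq_eqVlt => /orP[/eqP <- iK|ij jK]; first exact: sx.
have := sx j jK; have := IH; rewrite ij (ltnW jK) => /(_ isT); lra.
Qed.

(** The factor [4 * pi] is the 2 of [osc_perturb] times the [2 * pi] of the phase, and [B ^+ n]
    bounds all the monomials on the support. *)
Lemma osc_moment_lipschitz (n : nat) (B e : R) (xi xi' : 'rV[R]_n) : 1 <= B ->
  S `<=` `[- B, B] -> (forall i, `|xi ord0 i - xi' ord0 i| <= e) ->
  osc mu (phase (moment_curve n) xi) <=
  osc mu (phase (moment_curve n) xi') + 4 * pi * n%:R * B ^+ n * e.
Proof.
move=> B1 SB d.
have mphi zeta : mfun (phase (moment_curve n) zeta).
  apply: measurable_phase => i.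
  apply: (eq_measurable_fun (fun x : R => x ^+ i.+1)); first by move=> x _; rewrite mxE.
  exact: measurable_funX.
apply: (@le_trans _ _ (osc mu (phase (moment_curve n) xi') +
    2 * (2 * pi * (n%:R * B ^+ n * e)))); last by rewrite lerD2l; lra.
apply: osc_perturb => // x /SB; rewrite /= in_itv/= -ler_norml => xB.
rewrite /phase -mulrBr normrM ger0_norm; last by rewrite mulr_ge0// pi_ge0.
rewrite ler_wpM2l ?mulr_ge0 ?pi_ge0// -sumrB.
apply: (le_trans (ler_norm_sum _ _ _)).
apply: (@le_trans _ _ (\sum_(i < n) B ^+ n * e)); last first.
  by rewrite sumr_const card_ord -[leLHS]mulr_natl mulrA.
apply: ler_sum => i _; rewrite -mulrBl normrM mulrC mxE normrX.
apply: ler_pM => //; apply: (@le_trans _ _ (B ^+ i.+1)).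
  by rewrite lerXn2r ?nnegrE//; lra.
by rewrite ler_weXn2l.
Qed.

(** Suppose there are many separated [y] with [|mu^(y)| >= a], where [a = T^(-tau)]. Around each
    point [(y, 0, ..., 0)] the transform of the moment curve is at least [a / 2] on a cube of side
    [a / La]; these disjoint cubes lie in the ball of radius [2 * T] and contribute more to the
    integral than the hypothesis allows. *)
Lemma level_set_cover (n : nat) (B : R) : 1 <= B -> m `[- B, B] = 1 ->
  (forall eps : R, 0 < eps -> exists p C : R,
    [/\ 1 < p, 0 < C & forall r : R, 1 < r ->
      (\int[lebesgue_rV n.+1]_(xi in ball (0 : 'rV[R]_n.+1)%R r)
         (Normc.normc (fourier (pushforward mu (moment_curve n.+1)) xi) `^ p)%:E
       <= (C * r `^ eps)%:E)%E]) ->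
  forall kap : R, 0 < kap -> exists tau C : R, [/\ 0 < tau, 0 < C &
    forall T, 1 <= T -> exists s : seq R, (size s)%:R <= C * T `^ kap /\
      forall y, `|y| <= T -> T `^ (- tau) <= osc mu (fun x => 2 * pi * (y * x)) ->
        exists2 t, t \in s & t <= y <= t + 2].
Proof.
move=> B1 mB H kap kap0.
have SB : S `<=` `[- B, B] by apply: msupport_sub => //; exact: interval_closed.
have kap2 : 0 < kap / 2 by rewrite divr_gt0.
have [p [C0 [p1 C00 HC]]] := H _ kap2.
pose W xi := osc mu (phase (moment_curve n.+1) xi).
have mQ i : mfun (fun x => (moment_curve n.+1 x : 'rV[R]_n.+1) ord0 i).
  apply: (eq_measurable_fun (fun x : R => x ^+ i.+1)); first by move=> x _; rewrite mxE.
  exact: measurable_funX.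
have WE xi : Normc.normc (fourier (pushforward mu (moment_curve n.+1)) xi) = W xi.
  exact: fourier_set_function.
pose La : R := 4 * pi * n.+1%:R * B ^+ n.+1.
have La1 : 1 <= La.
  have : 1 <= B ^+ n.+1 by rewrite exprn_ege1.
  have : (1 : R) <= n.+1%:R by rewrite ler1n.
  have := pi_ge2 R; rewrite /La.
  move: (n.+1%:R : R) (B ^+ n.+1) => a b pi2 a1 b1.
  have h : 1 <= a * b by nra.
  by rewrite -mulrA; nra.
have La0 : 0 < La by lra.
have p0 : 0 < p by lra.
pose q : R := n.+1%:R + p.
have q0 : 0 < q by rewrite addr_gt0.
(* The exponent [p] is fixed by now. A cube contributes a multiple of
   [a ^ (p + n.+1) = T ^ (- (kap / 2))], and the whole integral is at most of order [T ^ (kap / 2)],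
   so about [T ^ kap] cubes fit. *)
pose tau := kap / 2 / q.
have tau0 : 0 < tau by rewrite divr_gt0.
(* In turn: the constant of the hypothesis, its radius [2 * T], the side [a / La] of the cubes and
   the lower bound [a / 2]. *)
pose C1 := C0 * 2 `^ (kap / 2) * La ^+ n.+1 * 2 `^ p.
have C10 : 0 < C1 by rewrite !mulr_gt0// ?powR_gt0// exprn_gt0.
exists tau, C1; split => // T T1.
have T0 : 0 < T by lra.
pose E := [set y | `|y| <= T /\ T `^ (- tau) <= osc mu (fun x => 2 * pi * (y * x))].
pose K := Num.truncn (C1 * T `^ kap).
have CT0 : 0 <= C1 * T `^ kap by rewrite mulr_ge0 ?powR_ge0 ?ltW.
have [||[x [xE xs]]|[s [ss sE]]] := @separated_or_covered R K E 1 (- T).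
- by [].
- by move=> y []; rewrite ler_norml => /andP[].
- exfalso.
  pose a := T `^ (- tau); have a0 : 0 < a by exact: powR_gt0.
  have a1 : a <= 1.
    by rewrite /a -(powRr0 T) ler_powR// oppr_le0 ltW.
  (* Half the side of the cubes: the Lipschitz constant [La] turns it into a loss of [a / 2], and
     being at most 1/2 it keeps cubes around 1-separated points disjoint. *)
  pose sg := a / (2 * La).
  have sg0 : 0 < sg by rewrite divr_gt0// mulr_gt0.
  have La2 : 0 < 2 * La by rewrite mulr_gt0.
  have sg1 : sg <= 1 / 2.
    rewrite /sg ler_pdivrMr//.
    have -> : 1 / 2 * (2 * La) = La by rewrite mulrA div1r mulVf ?mul1r.
    exact: le_trans La1.
  have [sgE sgE2] : La * sg = a / 2 /\ 2 * sg = a / La.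
    rewrite /sg; move: (La) La0 => c c0; clearbody a.
    by split; field; rewrite gt_eqF.
  clearbody sg.
  (* The centres lie on the first axis, where the transform of the moment curve is that of [mu]. *)
  pose ctr (j : 'I_K.+1) (i : 'I_n.+1) : R := if i == ord0 then x j else 0.
  have xT (j : 'I_K.+1) : `|x j| <= T by have [] := xE j (ltn_ord j).
  have ctrT j i : `|ctr j i| <= T by rewrite /ctr; case: ifP => // _; rewrite normr0 ltW.
  pose box (j : 'I_K.+1) (v : 'rV[R]_n.+1) : R :=
    \prod_(i < n.+1) \1_(ball (ctr j i) sg) (v ord0 i).
  have box01 j v : box j v = 1 /\ (forall i, `|ctr j i - v ord0 i| < sg) \/ box j v = 0.
    have [[i ni]|ai] := pselect (exists i, ~ `|ctr j i - v ord0 i| < sg).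
      right; rewrite /box (bigD1 i)//= indicE memNset ?mul0r//.
    left; have {}ai i : `|ctr j i - v ord0 i| < sg by apply: contrapT => h; apply: ai; exists i.
    by split => //; rewrite /box big1// => i _; rewrite indicE mem_set//; exact: ai.
  have disj j k (v : 'rV[R]_n.+1) : (forall i, `|ctr j i - v ord0 i| < sg) ->
      (forall i, `|ctr k i - v ord0 i| < sg) -> j = k.
    move=> /(_ ord0); rewrite /ctr eqxx => hj /(_ ord0); rewrite eqxx => hk.
    have sep := separated_le ltr01 xs.
    move: hj hk; rewrite !ltr_norml => hj hk.
    apply/val_inj; case: (ltngtP (j : nat) k) => // jk; exfalso.
      have := sep _ _ (introT andP (conj jk (ltn_ord k))) => h; lra.
    have := sep _ _ (introT andP (conj jk (ltn_ord j))) => h; lra.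
  pose c := (a / 2) `^ p.
  have c0 : 0 < c by rewrite powR_gt0// divr_gt0.
  pose D := ball (0 : 'rV[R]_n.+1) (2 * T).
  have boxW j (v : 'rV[R]_n.+1) : (forall i, `|ctr j i - v ord0 i| < sg) -> D v /\ c <= W v `^ p.
    move=> hv; split.
      rewrite /D; split; first by rewrite mulr_gt0.
      move=> i0 i; rewrite ord1 !mxE /ball/= sub0r normrN.
      have := hv i; have := ctrT j i; rewrite !ltr_norml ler_norml; lra.
    have [_ Ej] := xE j (ltn_ord j).
    have := @osc_moment_lipschitz n.+1 B sg (\row_i ctr j i) v B1 SB.
    have -> : phase (moment_curve n.+1) (\row_i ctr j i) = (fun y => 2 * pi * (x j * y)).
      apply/funext => y; rewrite /phase (bigD1 ord0)//= !mxE /ctr eqxx expr1.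
      by rewrite big1 ?addr0// => i /negbTE i0; rewrite !mxE i0 mul0r.
    move=> /(_ (fun i => _)) h.
    have {}h : a <= W v + La * sg.
      apply: (le_trans Ej); apply: h => i; rewrite mxE; exact: ltW (hv i).
    have aW : a / 2 <= W v by move: h; rewrite sgE; lra.
    rewrite /c ge0_ler_powR ?nnegrE ?(ltW p0)//; first by rewrite divr_ge0// ltW.
    by apply: le_trans aW; rewrite divr_ge0// ltW.
  have box_ge0 j (v : 'rV[R]_n.+1) : 0 <= box j v by have [[->]|->] := box01 j v.
  pose g (v : 'rV[R]_n.+1) := \sum_(j < K.+1) c * box j v.
  have gW (v : 'rV[R]_n.+1) : (0 <= (EFin \o g) v <= ((fun xi => (Normc.normc
      (fourier (pushforward mu (moment_curve n.+1)) xi) `^ p)%:E) \_ D) v)%E.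
    apply/andP; split.
      by rewrite lee_fin; apply: sumr_ge0 => j _; rewrite mulr_ge0// ltW.
    have patch0 : (0 <= ((fun xi => (Normc.normc
        (fourier (pushforward mu (moment_curve n.+1)) xi) `^ p)%:E) \_ D) v)%E.
      by rewrite /patch; case: ifP => // _; rewrite lee_fin powR_ge0.
    have [[j vj]|nj] := pselect (exists j, forall i, `|ctr j i - v ord0 i| < sg).
      have [Dv cW] := boxW j v vj.
      rewrite /patch mem_set// WE /= lee_fin /g (bigD1 j)//= big1.
        rewrite addr0; apply: le_trans cW; rewrite ler_piMr ?(ltW c0)//.
        by have [[->]|->] := box01 j v.
      move=> k kj; have [[_ vk]|->] := box01 k v; last by rewrite mulr0.
      by rewrite (disj k j v vk vj) eqxx in kj.
    rewrite /= /g big1// => j _; have [[_ vj]|->] := box01 j v; last by rewrite mulr0.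
    by case: nj; exists j.
  have T2 : 1 < 2 * T by lra.
  have := HC _ T2; apply/negP; rewrite -ltNge.
  apply: (@lt_le_trans _ _ (\int[lebesgue_rV n.+1]_v (g v)%:E)%E); last first.
    apply: ge0_le_integral_sup => v; rewrite patch_setT; exact: gW.
  have int_box j : (\int[lebesgue_rV n.+1]_v (box j v)%:E)%E = ((2 * sg) ^+ n.+1)%:E.
    transitivity (\prod_(i < n.+1) (2 * sg))%:E; last by rewrite prodr_const card_ord.
    apply: (@integral_prod_rV R n.+1 (fun i => \1_(ball (ctr j i) sg)) (fun=> 2 * sg)).
    - by move=> i; apply: measurable_indic; exact: measurable_ball.
    - by move=> i y; rewrite indicE.
    - move=> i; rewrite integral_indic//; last exact: measurable_ball.
      rewrite setIT; apply: (eq_trans (lebesgue_measure_ball (ctr j i) (ltW sg0))).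
      by rewrite mulr_natl.
  have mbox j : measurable_fun [set: 'rV[R]_n.+1] (box j).
    apply: (@measurable_prod_coord R n.+1 (fun i => \1_(ball (ctr j i) sg))) => i; apply: measurable_indic; exact: measurable_ball.
  have -> : (\int[lebesgue_rV n.+1]_v (g v)%:E)%E =
      (K.+1%:R * (c * (2 * sg) ^+ n.+1))%:E.
    transitivity (\int[lebesgue_rV n.+1]_v \sum_(j < K.+1) (c%:E * (box j v)%:E))%E.
      by apply: eq_integral => v _; rewrite /g -sumEFin.
    rewrite ge0_integral_sum//; last 2 first.
    - move=> j; apply/measurable_EFinP; exact: measurable_funM.
    - by move=> j v _; rewrite -EFinM lee_fin mulr_ge0// ltW.
    transitivity (\sum_(j < K.+1) (c * (2 * sg) ^+ n.+1)%:E)%E.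
      apply: eq_bigr => j _; rewrite ge0_integralZl ?lee_fin ?(ltW c0)//.
      - by rewrite int_box.
      - exact/measurable_EFinP.
      - by move=> v _; rewrite lee_fin.
    by rewrite sumEFin sumr_const card_ord; congr _%:E; rewrite -[LHS]mulr_natl.
  rewrite lte_fin.
  have aq : a `^ p * a ^+ n.+1 = T `^ (- (kap / 2)).
    rewrite -powR_mulrn ?(ltW a0)// -powRD ?(gt_eqF a0) ?implybT//.
    by rewrite /a -powRrM mulNr [p + _]addrC -/q divfK// gt_eqF.
  have La_n0 : La ^+ n.+1 != 0 by rewrite gt_eqF// exprn_gt0.
  have p2 : 2 `^ p != 0 :> R by rewrite gt_eqF// powR_gt0.
  have KC : C1 * T `^ kap < K.+1%:R by exact: truncnS_gt.
  have -> : c * (2 * sg) ^+ n.+1 = T `^ (- (kap / 2)) / (2 `^ p * La ^+ n.+1).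
    rewrite sgE2 /c powRM ?invr_ge0 ?(ltW a0)// expr_div_n -aq.
    have -> : (2^-1 : R) `^ p = (2 `^ p)^-1.
      by rewrite -powRN -[2^-1]powR_inv1// -powRrM mulN1r.
    rewrite invfM; ring.
  have rw : C0 * (2 * T) `^ (kap / 2) =
      C1 * T `^ kap * (T `^ (- (kap / 2)) / (2 `^ p * La ^+ n.+1)).
    have -> : T `^ kap = T `^ (kap / 2) * T `^ (kap / 2).
      by rewrite -powRD ?(gt_eqF T0) ?implybT//; congr (_ `^ _); lra.
    have Tk : T `^ (kap / 2) != 0 by rewrite gt_eqF// powR_gt0.
    rewrite powRN powRM// ?(ltW T0)// /C1.
    move: (La ^+ n.+1) (2 `^ p) (T `^ (kap / 2)) (2 `^ (kap / 2)) La_n0 p2 Tk => u1 u2 u3 u4 h1 h2 h3.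
    by field; rewrite h1 h2 h3.
  rewrite rw ltr_pM2r// divr_gt0 ?powR_gt0//.
  by rewrite mulr_gt0 ?powR_gt0 ?exprn_gt0.
- exists s; split.
    apply: (@le_trans _ _ K%:R); first by rewrite ler_nat.
    by have /andP[] := truncn_itv CT0.
  move=> y yT yE; have [t ts ty] := sE y (conj yT yE); exists t => //.
  by move: ty; rewrite mulr1.
Qed.

End level_sets.

(** * Curves of finite type *)

Section curves.
Context {R : realType}.

Definition derivable_upto {V : normedModType R} (k : nat) (f : R -> V) (U : set R) :=
  forall j x, (j < k)%N -> U x -> derivable (derive1n j f) x 1.

Lemma is_derive_derive1n (k j : nat) (f : R -> R) (U : set R) x :
  derivable_upto k f U -> (j < k)%N -> U x ->
  is_derive x 1 (derive1n j f) (derive1n j.+1 f x).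
Proof.
move=> df jk Ux; rewrite derive1nS derive1E.
exact: derivableP (df j x jk Ux).
Qed.

Lemma is_derive_lincomb (m : nat) (ze : 'rV[R]_m) (f : 'I_m -> R -> R) (df : 'I_m -> R) (y : R) :
  (forall i, is_derive y 1 (f i) (df i)) ->
  is_derive y 1 (fun x => \sum_(i < m) ze ord0 i * f i x) (\sum_(i < m) ze ord0 i * df i).
Proof.
move=> dfy.
have d i : is_derive y 1 (ze ord0 i \*: f i) (ze ord0 i *: df i) by exact: is_deriveZ.
rewrite (_ : (fun x => _) = \sum_(i < m) (ze ord0 i \*: f i)).
  exact: is_derive_sum.
by apply/funext => x; rewrite fct_sumE.
Qed.

Lemma near_open (U : set R) (P : R -> Prop) x : open U -> U x ->
  (forall y, U y -> P y) -> \forall y \near x, P y.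
Proof. by move=> oU Ux UP; apply: filterS UP _; exact: open_nbhs_nbhs. Qed.

Definition coord {n : nat} (Q : R -> 'rV[R]_n) (i : 'I_n) (x : R) : R := Q x ord0 i.

(** The derivatives of [Q] and of its coordinates are compared on [U] only; the induction passes
    from one order to the next through germs, whence [U] open. *)
Lemma derive1n_coord (n k : nat) (Q : R -> 'rV[R]_n) (U : set R) : open U ->
  (forall i, derivable_upto k (coord Q i) U) ->
  forall j, (j <= k)%N -> forall x, U x ->
    (forall i, derive1n j Q x ord0 i = derive1n j (coord Q i) x) /\
    ((j < k)%N -> derivable (derive1n j Q) x 1).
Proof.
move=> oU dQ.
have der j : (j < k)%N -> (forall x, U x -> forall i,
      derive1n j Q x ord0 i = derive1n j (coord Q i) x) ->
    forall x, U x -> derivable (derive1n j Q) x 1.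
  move=> jk E x Ux; apply/derivable_mxP => i0 i; rewrite ord1.
  apply: near_eq_derivable (dQ i j x jk Ux).
  by apply: (near_open oU Ux) => y Uy; rewrite E.
elim=> [|j IH] jk x Ux.
  by split => [i|k0]; [|apply: der].
have E y : U y -> forall i, derive1n j.+1 Q y ord0 i = derive1n j.+1 (coord Q i) y.
  move=> Uy i; have dj : derivable (derive1n j Q) y 1 by have [_] := IH (ltnW jk) y Uy; apply.
  rewrite !derive1nS !derive1E derive_mx// mxE.
  apply: near_eq_derive; apply: (near_open oU Uy) => t Ut.
  by have [] := IH (ltnW jk) t Ut.
by split; [exact: E|move=> jk1; exact: der].
Qed.

Lemma derivable_upto_coord (n k : nat) (Q : R -> 'rV[R]_n) (U : set R) : open U ->
  derivable_upto k Q U -> forall i, derivable_upto k (coord Q i) U.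
Proof.
move=> oU; elim: k => [|k IH] dQ i j x; first by [].
have IH' : forall i, derivable_upto k (coord Q i) U.
  by apply: IH => l y lk; apply: dQ; exact: ltnW.
rewrite ltnS leq_eqVlt => /orP[/eqP -> Ux|jk]; last exact: IH'.
have dk := dQ k x (leqnn _) Ux.
have := (derivable_mxP _ _ _).1 dk ord0 i; apply: near_eq_derivable.
by apply: (near_open oU Ux) => y Uy; have [-> //] := derive1n_coord oU IH' (leqnn k) Uy.
Qed.

Section graph.
Variables (m : nat) (g : R -> 'rV[R]_m).
Let Q := graph_curve g.

Lemma coord_graphl i : coord Q (lshift m i) = id.
Proof. by apply/funext => x; rewrite /coord /Q /graph_curve row_mxEl mxE. Qed.

Lemma coord_graphr i : coord Q (rshift 1 i) = coord g i.
Proof. by apply/funext => x; rewrite /coord /Q /graph_curve row_mxEr. Qed.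

Lemma derive1n_id j (x : R) : derive1n j.+1 (id : R -> R) x = (j == 0%N)%:R.
Proof.
elim: j x => [|j IH] x; first by rewrite derive1n1 derive1_id.
rewrite derive1nS (_ : derive1n j.+1 id = cst (j == 0%N)%:R); last exact/funext.
by rewrite derive1_cst.
Qed.

(** The nonzero row [(th, ze)] kills the matrix: its product with column [j] is the derivative of
    order [j + 1] of [th * x + <ze, g x>]. *)
Lemma curve_det_eq0 (th : R) (ze : 'rV[R]_m) (U : set R) x : open U -> U x ->
  (forall i, derivable_upto (1 + m) (coord Q i) U) -> ze != 0 ->
  (forall j, (j < 1 + m)%N -> th * (j == 0%N)%:R +
     \sum_(i < m) ze ord0 i * derive1n j.+1 (coord g i) x = 0) ->
  curve_det Q x = 0.
Proof.
move=> oU Ux dQ ze0 h; apply/eqP/det0P.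
exists (row_mx (const_mx th) ze).
  apply: contra ze0 => /eqP e; apply/eqP/rowP => i.
  by have := congr1 (fun M : 'rV_(1 + m) => M ord0 (rshift 1 i)) e; rewrite row_mxEr !mxE.
apply/rowP => j; rewrite !mxE big_split_ord/= big_ord1 -[RHS](h j (ltn_ord j)).
congr (_ + _).
  rewrite row_mxEl !mxE; congr (_ * _).
  have [-> _] := derive1n_coord oU dQ (ltn_ord j) Ux.
  by rewrite coord_graphl derive1n_id.
apply: eq_bigr => i _; rewrite row_mxEr !mxE; congr (_ * _).
have [-> _] := derive1n_coord oU dQ (ltn_ord j) Ux.
by rewrite coord_graphr.
Qed.

(** The property shared by the two kinds of curves. A derivative of [<ze, g>] of order [k >= 2] is
    one of order at least 1 of [h = th + <ze, g'>], hence independent of [th]; the [k.+1]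
    derivatives make it continuous. The first clause provides Taylor bounds of second order. *)
Definition finite_type_at (z : R) :=
  (exists U, [/\ open U, U z & forall i, derivable_upto 3 (coord g i) U]) /\
  forall ze : 'rV[R]_m, ze != 0 -> exists k U, [/\ (2 <= k)%N, open U, U z,
    forall i, derivable_upto k.+1 (coord g i) U &
    \sum_(i < m) ze ord0 i * derive1n k (coord g i) z != 0].

(** If the derivatives of [<ze, g>] of orders 2 to [1 + m] vanish at [z], then [th = - <ze, g'(z)>]
    also cancels the first column, and the determinant is zero. *)
Lemma finite_type_non_degenerate (U : set R) z : (0 < m)%N -> open U -> U z ->
  non_degenerate U Q -> finite_type_at z.
Proof.
move=> m0 oU Uz [[dQ _] detQ].
have dQ' : derivable_upto (1 + m).+1 Q U by move=> j x jm Ux; exact: dQ.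
have dc := derivable_upto_coord oU dQ'.
have dg i : derivable_upto (1 + m).+1 (coord g i) U by rewrite -coord_graphr.
split; first by exists U; split => // i j x j3; apply: dg; apply: leq_trans j3 _.
move=> ze ze0; apply: contrapT => nk.
have nk' k : (2 <= k <= 1 + m)%N -> \sum_(i < m) ze ord0 i * derive1n k (coord g i) z = 0.
  move=> /andP[k2 km]; apply/eqP; apply: contrapT => /negP h; apply: nk.
  exists k, U; split => // i j x jk; apply: dg; exact: leq_trans jk _.
have := detQ z Uz; rewrite (@curve_det_eq0
  (- \sum_(i < m) ze ord0 i * derive1n 1 (coord g i) z) ze U z) ?eqxx//.
  by move=> i j x jm; apply: dc; exact: ltnW.
case=> [|j] jm; first by rewrite mulr1 addNr.
by rewrite mulr0 add0r nk'.
Qed.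

End graph.

End curves.

(** * Non-trapped analytic curves are of finite type *)

Section analytic_curves.
Context {R : realType}.

Lemma natr_geometric_le (q : R) (n : nat) : 0 <= q < 1 ->
  n.+1%:R * q ^+ n <= (1 - q)^-1.
Proof.
move=> /andP[q0 q1]; have q1' : 0 < 1 - q by lra.
rewrite -[leRHS]mul1r ler_pdivlMr//.
(* The right-hand side is [1 - q] times the sum of the [q ^+ i] for [i <= n]; in this form the
   induction closes. *)
suff : n.+1%:R * q ^+ n * (1 - q) <= 1 - q ^+ n.+1.
  by move/le_trans; apply; rewrite gerBl exprn_ge0.
elim: n => [|n IH]; first by rewrite expr0 expr1 !mul1r.
have qn : q ^+ n.+1 <= 1 by rewrite exprn_ile1// ltW.
have qn0 : 0 <= q ^+ n.+1 by rewrite exprn_ge0.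
have -> : n.+2%:R * q ^+ n.+1 * (1 - q) =
    q * (n.+1%:R * q ^+ n * (1 - q)) + q ^+ n.+1 * (1 - q).
  by rewrite -[n.+2%:R]natr1 exprS; ring.
have : q * (n.+1%:R * q ^+ n * (1 - q)) <= q * (1 - q ^+ n.+1) by rewrite ler_wpM2l.
rewrite [q ^+ n.+2]exprS; move: (q ^+ n.+1) qn qn0 => a a1 a0.
nra.
Qed.

(** For [|h| < r < rho] the series converges absolutely at [r], and [(|h| / r) ^+ n] absorbs the
    factor [n.+1]. The radius does not shrink, so derivatives of all orders are obtained on one
    disc. *)
Lemma is_cvg_pseries_diffs (c : R^nat) (rho : R) :
  (forall h, `|h| < rho -> cvgn (pseries c h)) ->
  forall h, `|h| < rho -> cvgn (pseries (pseries_diffs c) h).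
Proof.
move=> cc h hr; have h0 := normr_ge0 h.
pose r := (`|h| + rho) / 2; pose r' := (r + rho) / 2.
have hr1 : `|h| < r by rewrite /r; lra.
have r0 : 0 < r by lra.
have rr' : `|r| < `|r'| by rewrite !gtr0_norm /r' /r; lra.
have r'rho : `|r'| < rho by rewrite gtr0_norm /r' /r; lra.
have cn := is_cvg_pseries_inside_norm (cc _ r'rho) rr'.
have q01 : 0 <= `|h| / r < 1 by rewrite divr_ge0 ?(ltW r0)//= ltr_pdivrMr ?mul1r.
pose u := fun i => `|c i| * r ^+ i.
have cu : cvgn (series (fun n => u n.+1)).
  have -> : series (fun n => u n.+1) = (fun n => series u n.+1 - u 0%N).
    by apply/funext => n; rewrite /series/= big_nat_recl// addrAC subrr add0r.
  apply: is_cvgB; last exact: is_cvg_cst.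
  by have /cvg_ex[l ul] := cn; apply/cvg_ex; exists l; rewrite (cvg_shiftS (series u)).
apply: normed_cvg.
pose C := (1 - `|h| / r)^-1 / r.
apply: (@series_le_cvg R _ (fun n => C * u n.+1)).
- by move=> n; exact: normr_ge0.
- move=> n; rewrite mulr_ge0//; last by rewrite mulr_ge0// exprn_ge0// ltW.
  by rewrite divr_ge0 ?(ltW r0)// invr_ge0; lra.
- move=> n /=; rewrite /pseries_diffs !normrM normrX ger0_norm// /u /C.
  have -> : n.+1%:R * `|c n.+1| * `|h| ^+ n =
      n.+1%:R * (`|h| / r) ^+ n * (`|c n.+1| * r ^+ n).
    have rn : r ^+ n != 0 by rewrite gt_eqF// exprn_gt0.
    by rewrite expr_div_n; field.
  have -> : (1 - `|h| / r)^-1 / r * (`|c n.+1| * r ^+ n.+1) =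
      (1 - `|h| / r)^-1 * (`|c n.+1| * r ^+ n).
    by move: (_^-1) => e; rewrite exprS; field; rewrite gt_eqF.
  rewrite ler_wpM2r//; first by rewrite mulr_ge0// exprn_ge0// ltW.
  exact: natr_geometric_le.
- exact: is_cvg_seriesZ.
Qed.

Lemma iter_pseries_diffs (c : R^nat) j n :
  iter j (@pseries_diffs R) c n = ((n + j) ^_ j)%:R * c (n + j)%N.
Proof.
elim: j n => [|j IH] n; first by rewrite addn0 ffactn0 mul1r.
rewrite iterS /pseries_diffs IH addSnnS mulrA; congr (_ * _).
by rewrite -natrM ffactnSr addnS subSn ?leq_addl// addnK mulnC.
Qed.

Lemma lim_pseries0 (c : R^nat) : limn (pseries c 0) = c 0%N.
Proof.
apply/cvg_lim => //; rewrite -cvg_shiftS.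
apply: (@cvg_trans _ (cst (c 0%N) @ \oo)); last exact: cvg_cst.
rewrite (_ : (fun _ => _) = cst (c 0%N))//; apply/funext => n /=.
rewrite /pseries /series/= big_nat_recl// expr0 mulr1 big1 ?addr0// => i _.
by rewrite exprS mul0r mulr0.
Qed.

Lemma derive1n_pseries (c : R^nat) (f : R -> R) (z rho : R) :
  (forall y, `|y - z| < rho -> pseries c (y - z) @ \oo --> f y) ->
  forall j y, `|y - z| < rho ->
    derive1n j f y = limn (pseries (iter j (@pseries_diffs R) c) (y - z)) /\
    derivable (derive1n j f) y 1.
Proof.
move=> fc.
have cc j h : `|h| < rho -> cvgn (pseries (iter j (@pseries_diffs R) c) h).
  elim: j h => [|j IH] h hr; last by rewrite iterS; exact: is_cvg_pseries_diffs IH _ hr.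
  have := fc (z + h); rewrite addrAC subrr add0r => /(_ hr) l.
  by apply/cvg_ex; exists (f (z + h)).
pose F j y := limn (pseries (iter j (@pseries_diffs R) c) (y - z)).
have dF j y : `|y - z| < rho -> is_derive y 1 (F j) (F j.+1 y).
  move=> yr; pose K := (`|y - z| + rho) / 2.
  have y0 := normr_ge0 (y - z).
  have K0 : 0 <= K by rewrite /K; lra.
  have Kr : `|K| < rho by rewrite ger0_norm// /K; lra.
  have yK : `|y - z| < `|K| by rewrite (ger0_norm K0) /K; lra.
  have h := pseries_snd_diffs (cc j _ Kr) (cc j.+1 _ Kr) (cc j.+2 _ Kr) yK.
  have sh : is_derive y (1 : R) (fun t => t - z) 1 by exact: is_derive_shift.
  have := @is_derive1_comp R (fun x => limn (pseries (iter j (@pseries_diffs R) c) x))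
    (fun t => t - z) y _ _ h sh.
  by rewrite mulr1.
have oV : open [set y | `|y - z| < rho].
  rewrite (_ : [set _ | _] = ball z rho); first exact: ball_open.
  by apply/seteqP; split => y; rewrite /ball/= distrC.
have E j : forall y, `|y - z| < rho -> derive1n j f y = F j y.
  elim: j => [y yr|j IH y yr]; first by rewrite /= /F; apply/esym/cvg_lim => //; exact: fc.
  rewrite derive1nS derive1E (@near_eq_derive _ _ _ _ (F j)).
    exact: (@derive_val _ _ _ _ _ _ _ (dF j y yr)).
  by apply: (near_open oV yr).
move=> j y yr; split; first exact: E.
apply: (@near_eq_derivable _ _ _ (F j)).
  by apply: (near_open oV yr) => t tr; rewrite E.
exact: (@ex_derive _ _ _ _ _ _ _ (dF j y yr)).
Qed.

(** If all derivatives of [<ze, g>] of order at least 2 vanish at [z], its power series is affine.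
    Then a single row [(th, ze)] lies in the kernel at every point near [z], and the determinant
    vanishes on a whole interval. *)
Lemma finite_type_non_trapped (m : nat) (g : R -> 'rV[R]_m) (U : set R) z :
  open U -> U z -> non_trapped U (graph_curve g) -> finite_type_at g z.
Proof.
move=> oU Uz [anQ finQ].
have /boolp.choice[c cg] : forall i : 'I_m, exists ci : R^nat,
    \forall y \near z, pseries ci (y - z) @ \oo --> coord g i y.
  move=> i; have [c h] := anQ (rshift 1 i) z Uz; exists c.
  by rewrite -coord_graphr.
have near_all : \forall y \near z, U y /\
    forall i, pseries (c i) (y - z) @ \oo --> coord g i y.
  apply: filterI; first exact: open_nbhs_nbhs.
  exact: (@filter_forall _ _ (fun i y => pseries (c i) (y - z) @ \oo --> coord g i y) (nbhs z)).
have /nbhs_ballP[rho /= rho0 h] := near_all.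
have {}h y : `|y - z| < rho -> U y /\
    forall i, pseries (c i) (y - z) @ \oo --> coord g i y.
  by move=> yr; apply: h; rewrite /ball/= distrC.
pose V := ball z rho.
have oV : open V by exact: ball_open.
have Vz : V z by exact: ballxx.
have VE y : V y -> `|y - z| < rho by rewrite /V /ball/= distrC.
have der i j y : V y -> derive1n j (coord g i) y =
    limn (pseries (iter j (@pseries_diffs R) (c i)) (y - z)) /\
    derivable (derive1n j (coord g i)) y 1.
  move=> /VE yr; apply: (@derive1n_pseries _ _ _ rho) => // t tr.
  by have [_] := h t tr; apply.
have dg k i : derivable_upto k (coord g i) V by move=> j x _ Vx; have [] := der i j x Vx.
split; first by exists V.
move=> ze ze0; apply: contrapT => nk.
have c0 k : (2 <= k)%N -> \sum_(i < m) ze ord0 i * c i k = 0.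
  move=> k2; have : \sum_(i < m) ze ord0 i * derive1n k (coord g i) z = 0.
    by apply/eqP; apply: contrapT => /negP e; apply: nk; exists k, V; split.
  have -> : \sum_(i < m) ze ord0 i * derive1n k (coord g i) z =
      (k`!)%:R * \sum_(i < m) ze ord0 i * c i k.
    rewrite mulr_sumr; apply: eq_bigr => i _; have [-> _] := der i k z Vz.
    by rewrite subrr lim_pseries0 iter_pseries_diffs add0n ffactnn mulrCA.
  by move/eqP; rewrite mulf_eq0 pnatr_eq0 eqn0Ngt fact_gt0 /= => /eqP.
pose e k := \sum_(i < m) ze ord0 i * c i k.
pose comb k y := \sum_(i < m) ze ord0 i * derive1n k (coord g i) y.
have comb0 y : V y -> comb 0%N y = e 0%N + e 1%N * (y - z).
  move=> Vy; have [_ gy] := h y (VE y Vy).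
  pose s n := \sum_(i < m) ze ord0 i * pseries (c i) (y - z) n.
  have s1 : s @ \oo --> comb 0%N y.
    apply: (cvg_big (op := +%R) (P := xpredT)) => [|i _]; first exact: add_continuous.
    by apply: cvgM; [exact: cvg_cst|exact: gy].
  have s2 : s @ \oo --> e 0%N + e 1%N * (y - z).
    apply: cvg_near_cst; exists 2%N => // n /= n2.
    transitivity (\sum_(0 <= k < n) e k * (y - z) ^+ k).
      rewrite /s /pseries /series/=.
      under eq_bigr do rewrite mulr_sumr.
      rewrite exchange_big/=; apply: eq_bigr => k _.
      by rewrite mulr_suml; apply: eq_bigr => i _; rewrite mulrA.
    case: n n2 => [|[|n]]// _; rewrite !big_nat_recl// expr0 expr1 mulr1 addrA.
    by rewrite big1 ?addr0// => k _; rewrite /e c0// mul0r.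
  exact: (cvg_unique _ s1 s2).
have dcomb k y : V y -> is_derive y 1 (comb k) (comb k.+1 y).
  by move=> Vy; apply: is_derive_lincomb => i; exact: (is_derive_derive1n (dg k.+1 i)).
have comb1 y : V y -> comb 1%N y = e 1%N.
  move=> Vy; rewrite -(@derive_val _ _ _ _ _ _ _ (dcomb 0%N y Vy)).
  rewrite (@near_eq_derive _ _ _ _ (fun t => e 0%N + e 1%N * (t - z))); last exact: (near_open oV Vy).
  have d : is_derive y (1 : R) (fun t => e 0%N + e 1%N * (t - z)) (0 + e 1%N *: 1).
    by apply: is_deriveD; apply: is_deriveZ; exact: is_derive_shift.
  by rewrite (@derive_val _ _ _ _ _ _ _ d) add0r [_ *: _]mulr1.
have combS k y : V y -> comb k.+2 y = 0.
  elim: k y => [|k IH] y Vy.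
    rewrite -(@derive_val _ _ _ _ _ _ _ (dcomb 1%N y Vy)).
    by rewrite (@near_eq_derive _ _ _ _ (cst (e 1%N))) ?derive_cst//; exact: (near_open oV Vy).
  rewrite -(@derive_val _ _ _ _ _ _ _ (dcomb k.+2 y Vy)).
  by rewrite (@near_eq_derive _ _ _ _ (cst 0)) ?derive_cst//; exact: (near_open oV Vy).
have det0 x : V x -> curve_det (graph_curve g) x = 0.
  move=> Vx; apply: (@curve_det_eq0 R m g (- e 1%N) ze V) => //.
    move=> i j t _ Vt; have [k ->|k ->] := split_ordP i; last first.
      by rewrite coord_graphr; have [] := der k j t Vt.
    rewrite coord_graphl; case: j => [|j]; first exact: derivable_id.
    rewrite (_ : derive1n j.+1 id = cst (j == 0%N)%:R); last first.
      by apply/funext => u; rewrite derive1n_id.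
    exact: derivable_cst.
  case=> [|j] _; first by rewrite mulr1 -/(comb 1%N x) comb1// addNr.
  by rewrite mulr0 add0r -/(comb j.+2 x) combS.
have := finQ (z - rho / 2) (z + rho / 2).
have itvV : `[z - rho / 2, z + rho / 2]%classic `<=` V.
  by move=> t; rewrite /= in_itv/= /V /ball/= ltr_norml; lra.
move=> /(_ (fun t ht => (h t (VE t (itvV t ht))).1)).
rewrite (_ : [set x | _] = `[z - rho / 2, z + rho / 2]%classic); last first.
  apply/seteqP; split => [t []//|t ht]; split => //; exact: det0 (itvV t ht).
(* A finite set is Lebesgue null, unlike an interval of length [rho]. *)
move=> /finite_set_countable/countable_lebesgue_measure0.
rewrite lebesgue_measure_itv/= lte_fin ifT; last by lra.
by rewrite -EFinB => lz; have [] := lz; lra.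
Qed.

End analytic_curves.

(** * Uniform bounds on the support *)

Section uniform_bounds.
Context {R : realType}.
Variable K : set R.
Hypothesis cK : compact K.

Lemma ball_between (z r x y t : R) : `|z - x| < r -> `|z - y| < r ->
  Num.min x y <= t <= Num.max x y -> `|z - t| < r.
Proof.
have [xy|xy] := leP x y; rewrite !ltr_norml; lra.
Qed.

Lemma dist_between (x y t : R) :
  Num.min x y <= t <= Num.max x y -> `|t - x| <= `|y - x|.
Proof.
have [xy|xy] := leP x y => h; first by rewrite !ger0_norm; lra.
by rewrite !ler0_norm; lra.
Qed.

(** The segment between two points of [K] may leave the domain where [f] is smooth, so the mean
    value theorem serves only for nearby points. For distant ones, bounds on [f] and on its
    derivative are enough. *)
Lemma uniform_C2 (f : R -> R) :
  (forall z, K z -> exists U, [/\ open U, U z & derivable_upto 3 f U]) ->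
  exists M, 0 <= M /\ forall x y, K x -> K y ->
    `|derive1n 1 f x - derive1n 1 f y| <= M * `|x - y| /\
    `|f y - f x - derive1n 1 f x * (y - x)| <= M * (y - x) ^+ 2.
Proof.
move=> fU; pose f1 := derive1n 1 f; pose f2 := derive1n 2 f.
(* A single parameter is both the bound and the inverse of the radius, so that compactness is used
   once, for [M] near infinity. *)
pose P (M x : R) := [/\ `|f x| <= M, `|f1 x| <= M &
  forall y, `|x - y| < M^-1 -> `|f1 x - f1 y| <= M * `|x - y| /\
    `|f y - f x - f1 x * (y - x)| <= M * (y - x) ^+ 2].
have [M [M1 MP]] : exists M, 1 <= M /\ K `<=` P M.
  have [] := @filter_ex _ (pinfty_nbhs R) _ ([set M | 1 <= M] `&` [set M | K `<=` P M]).
    apply: filterI; first exact: nbhs_pinfty_ge.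
    have /compact_near_coveringP/(_ R (pinfty_nbhs R) P _) := cK; apply => z Kz.
    have [U [oU Uz df]] := fU z Kz.
    have cont j : (j < 3)%N -> {for z, continuous (derive1n j f)}.
      by move=> j3; apply/differentiable_continuous/derivable1_diffP; exact: df.
    have bnd j : (j < 3)%N -> \forall x \near z, `|derive1n j f x| <= `|derive1n j f z| + 1.
      move=> /cont/cvgrPdist_le/(_ _ ltr01); apply: filterS => x h.
      have := ler_normB (derive1n j f z) (derive1n j f z - derive1n j f x).
      by rewrite opprB addrC subrK; lra.
    have U1 : nbhs z U by exact: open_nbhs_nbhs.
    have /nbhs_ballP[r /= r0 hr'] : nbhs z (U `&` [set x | `|f x| <= `|f z| + 1] `&`
        ([set x | `|f1 x| <= `|f1 z| + 1] `&` [set x | `|f2 x| <= `|f2 z| + 1])).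
      by apply: filterI; apply: filterI => //; [exact: (bnd 0%N)|exact: (bnd 1%N)|exact: (bnd 2%N)].
    have hr x : `|z - x| < r -> [/\ U x, `|f x| <= `|f z| + 1,
        `|f1 x| <= `|f1 z| + 1 & `|f2 x| <= `|f2 z| + 1].
      by move=> /hr'[[? ?] [? ?]].
    pose A := `|f z| + `|f1 z| + `|f2 z| + 1.
    have A0 : 0 <= A by rewrite !addr_ge0.
    have z0 := normr_ge0 (f z); have z1 := normr_ge0 (f1 z); have z2 := normr_ge0 (f2 z).
    have [Af Af1 Af2] : [/\ `|f z| + 1 <= A, `|f1 z| + 1 <= A & `|f2 z| + 1 <= A].
      by rewrite /A; move: (`|f z|) (`|f1 z|) (`|f2 z|) z0 z1 z2 => a b c; split; lra.
    clearbody A.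
    exists (ball z (r / 2), [set M | A + 2 / r < M]) => /=.
      split; first by apply/nbhs_ballP; exists (r / 2); rewrite //= divr_gt0.
      by apply: nbhs_pinfty_gt; exact: num_real.
    move=> [x M] /= [zx AM].
    have r2 : 0 < 2 / r by rewrite divr_gt0.
    have M0 : 0 < M by lra.
    have xr : `|z - x| < r by move: zx; rewrite /ball/=; lra.
    have [Ux fx f1x f2x] := hr x xr.
    have AM' : A <= M by rewrite (le_trans _ (ltW AM))// lerDl ltW.
    split; [exact: le_trans fx (le_trans Af AM')|exact: le_trans f1x (le_trans Af1 AM')|].
    move=> y xy.
    have Mr : M^-1 < r / 2.
      by rewrite -(invf_div 2 r) ltf_pV2 ?posrE// (le_lt_trans _ AM)// lerDr.
    have yr : `|z - y| < r.
      rewrite (le_lt_trans (ler_distD x z y))// [ltRHS]splitr ltrD//.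
      exact: lt_trans xy Mr.
    have btw t : Num.min x y <= t <= Num.max x y -> `|z - t| < r by exact: ball_between.
    have d1 : `|f1 x - f1 y| <= A * `|x - y|.
      apply: (@mvt_le _ f1 f2) => t /btw/hr[Ut _ _ f2t].
        exact: (is_derive_derive1n df).
      exact: le_trans Af2.
    have AMx : A * `|x - y| <= M * `|x - y| by rewrite ler_wpM2r.
    split; first exact: le_trans AMx.
    have : `|(f y - f1 x * y) - (f x - f1 x * x)| <= (A * `|x - y|) * `|y - x|.
      apply: (@mvt_le _ (fun t => f t - f1 x * t) (fun t => f1 t - f1 x)).
        move=> t; rewrite minC maxC => /btw/hr[Ut _ _ _].
        have dft : is_derive t (1 : R) f (f1 t) by exact: (is_derive_derive1n (j := 0) df).
        have dl : is_derive t (1 : R) (f1 x \*: (id : R -> R)) (f1 x *: 1).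
          exact: is_deriveZ.
        by have := is_deriveB dft dl; rewrite [_ *: _]mulr1.
      move=> t; rewrite minC maxC => t_xy; have tr := btw t t_xy.
      have : `|f1 t - f1 x| <= A * `|t - x|.
        apply: (@mvt_le _ f1 f2) => u /(ball_between tr xr)/hr[Uu _ _ f2u].
          exact: (is_derive_derive1n df).
        exact: le_trans Af2.
      by move/le_trans; apply; rewrite [`|x - y|]distrC ler_wpM2l// dist_between.
    have -> : f y - f1 x * y - (f x - f1 x * x) = f y - f x - f1 x * (y - x) by ring.
    move/le_trans; apply; rewrite -mulrA [`|x - y|]distrC -expr2 real_normK ?num_real//.
    by rewrite ler_wpM2r ?sqr_ge0.
  by move=> M [M1 MP]; exists M.
have M0 : 0 < M by lra.
exists (2 * M ^+ 3 + 2 * M ^+ 2 + M); split.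
  by rewrite !addr_ge0 ?mulr_ge0 ?exprn_ge0// ltW.
move=> x y Kx Ky; have [fx f1x hx] := MP x Kx; have [fy f1y _] := MP y Ky.
have M2 : 0 <= M ^+ 2 by rewrite exprn_ge0// ltW.
have M3 : 0 <= M ^+ 3 by rewrite exprn_ge0// ltW.
have [xy|xy] := ltP `|x - y| M^-1.
  have [h1 h2] := hx y xy; split.
    by apply: (le_trans h1); rewrite ler_wpM2r//; lra.
  by apply: (le_trans h2); rewrite ler_wpM2r ?sqr_ge0//; lra.
(* For distant points [M * |x - y| >= 1], and constants are absorbed by powers of this quantity. *)
have Mxy : 1 <= M * `|x - y| by rewrite -ler_pdivrMl// mulr1.
have e0 := normr_ge0 (x - y).
have e2 : (y - x) ^+ 2 = `|x - y| ^+ 2 by rewrite real_normK ?num_real// -sqrrN opprB.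
split.
  apply: (@le_trans _ _ (2 * M)).
    by have := ler_normB (f1 x) (f1 y); lra.
  apply: (@le_trans _ _ (2 * M * (M * `|x - y|))); first by rewrite ler_peMr//; lra.
  by rewrite mulrA ler_wpM2r//; rewrite (_ : 2 * M * M = 2 * M ^+ 2); [lra|ring].
have b1 : `|f y - f x - f1 x * (y - x)| <= 2 * M + M * `|x - y|.
  apply: (le_trans (ler_normB _ _)); rewrite normrM [`|y - x|]distrC.
  apply: lerD; first by have := ler_normB (f y) (f x); lra.
  by rewrite ler_wpM2r.
apply: (le_trans b1); rewrite e2.
move: (`|x - y|) e0 Mxy => u u0 Mu.
have h1 : 1 <= (M * u) * (M * u) by nra.
have h2 : M * u <= (M * u) * (M * u) by nra.
have -> : (2 * M ^+ 3 + 2 * M ^+ 2 + M) * u ^+ 2 =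
  2 * M * ((M * u) * (M * u)) + 2 * ((M * u) * (M * u)) + M * (u * u) by ring.
have h3 : 0 <= M * (u * u) by rewrite !mulr_ge0// ltW.
have h4 : 2 * M <= 2 * M * (M * u * (M * u)) by rewrite ler_peMr//; lra.
lra.
Qed.

End uniform_bounds.

(** * Sublevel estimates uniform in the direction *)

Section uniform_sublevel.
Context {R : realType}.
Variables (K : set R) (B : R).
Hypothesis cK : compact K.
Hypothesis KB : forall x, K x -> `|x| <= B.
Variables (m : nat) (g : R -> 'rV[R]_m).
Hypothesis ftK : forall z, K z -> finite_type_at g z.

(** The derivative of order [j] of [<ze, g>], where these derivatives exist; thus
    [h = th + comb ze 1]. *)
Definition comb (ze : 'rV[R]_m) (j : nat) (y : R) : R :=
  \sum_(i < m) ze ord0 i * derive1n j (coord g i) y.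

(** Again one parameter for compactness: [M] bounds the order [k], and [1 / M] is both the radius
    and the lower bound for the derivative of order [k] of [comb p.2 1]. *)
Definition locally_curved (M : R) (p : R * 'rV[R]_m) := exists k : nat,
  [/\ (0 < k)%N, k%:R <= M,
    forall j y, (j < k)%N -> `|p.1 - y| < M^-1 ->
      is_derive y 1 (comb p.2 j.+1) (comb p.2 j.+2 y) &
    forall y, `|p.1 - y| < M^-1 -> M^-1 <= `|comb p.2 k.+1 y|].

Lemma norm_ge_half (a b c : R) : `|a - b| <= c -> `|a| = 2 * c -> c <= `|b|.
Proof. by have := ler_normD (a - b) b; rewrite subrK; lra. Qed.

Lemma cell_bound (x y e M : R) : e <= (x + B) * (2 * M) < e + 1 ->
  e <= (y + B) * (2 * M) < e + 1 -> `|(x - y) * M| < 1.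
Proof.
move=> hx hy; have d : (x + B) * (2 * M) - (y + B) * (2 * M) = 2 * ((x - y) * M) by ring.
rewrite ltr_norml; move: ((x + B) * (2 * M)) ((y + B) * (2 * M)) ((x - y) * M) hx hy d.
by move=> a b c; lra.
Qed.

Lemma compact_sphere : compact [set ze : 'rV[R]_m | `|ze| = 1].
Proof.
apply: bounded_closed_compact.
  by exists 1; split; [exact: num_real|move=> M M1 ze /= ->; exact: ltW].
apply: (@closed_comp _ _ (fun ze : 'rV[R]_m => `|ze|) [set 1]).
  by move=> ze _; exact: norm_continuous.
exact: closed_eq.
Qed.

(** The derivative that finite type provides at [z] in the direction [ze0] is jointly continuous in
    point and direction, hence stays above half its size nearby. *)
Lemma near_locally_curved z (ze0 : 'rV[R]_m) : K z -> `|ze0| = 1 ->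
  \forall p \near (z, ze0) & M \near +oo, locally_curved M p.
Proof.
move=> Kz ze1; have ze0n : ze0 != 0 by rewrite -normr_eq0 ze1 oner_eq0.
have [k [U [k2 oU Uz dg nz]]] := (ftK Kz).2 ze0 ze0n.
case: k k2 dg nz => [|[|k]]// _ dg nz.
pose c := `|comb ze0 k.+2 z| / 2.
have c0 : 0 < c by rewrite divr_gt0// normr_gt0.
have cont i : {for z, continuous (derive1n k.+2 (coord g i))}.
  by apply/differentiable_continuous/derivable1_diffP; exact: dg.
have cvgc : comb p.2 k.+2 p.1 @[p --> (z, ze0)] --> comb ze0 k.+2 z.
  apply: (cvg_big (op := +%R) (P := xpredT)) => [|i _]; first exact: add_continuous.
  apply: cvgM.
    by apply: (@cvg_comp _ _ _ snd (fun ze : 'rV[R]_m => ze ord0 i)); [exact: cvg_snd|exact: coord_continuous].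
  by apply: (@cvg_comp _ _ _ fst (derive1n k.+2 (coord g i))); [exact: cvg_fst|exact: cont].
have : nbhs (z, ze0) ([set p | U p.1] `&` [set p | c <= `|comb p.2 k.+2 p.1|]).
  apply: filterI.
    by apply: (@cvg_fst _ _ (nbhs z) (nbhs ze0)); exact: open_nbhs_nbhs.
  move/cvgrPdist_le : cvgc => /(_ c c0); apply: filterS => p h /=.
  by apply: norm_ge_half h _; rewrite /c mulrC divfK.
move=> /nbhs_ballP[r /= r0 hr].
exists (ball (z, ze0) (r / 2), [set M | Num.max (2 / r) (Num.max k.+1%:R c^-1) < M]) => /=.
  split; first by apply/nbhs_ballP; exists (r / 2); rewrite //= divr_gt0.
  by apply: nbhs_pinfty_gt; exact: num_real.
move=> [[x ze] M] /= [[zx zz] ]; rewrite !gt_max => /and3P[rM kM cM].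
have r2 : 0 < 2 / r by rewrite divr_gt0.
have M0 : 0 < M by exact: lt_trans rM.
have Mr : M^-1 < r / 2 by rewrite -(invf_div 2 r) ltf_pV2 ?posrE.
have in_r y : `|x - y| < M^-1 -> U y /\ c <= `|comb ze k.+2 y|.
  move=> xy; apply: (hr (y, ze)); split => /=.
    rewrite /ball/= (le_lt_trans (ler_distD x z y))// [ltRHS]splitr ltrD//.
    exact: lt_trans xy Mr.
  by apply: le_ball zz; rewrite ler_pdivrMr// ler_peMr ?(ltW r0)// ler1n.
exists k.+1; split => //=; first exact: ltW.
  move=> j y jk /in_r[Uy _]; apply: is_derive_lincomb => i.
  have jk2 : (j.+1 < k.+3)%N by rewrite ltnS ltnW.
  exact: (is_derive_derive1n (dg i) jk2 Uy).
move=> y /in_r[_]; apply: le_trans.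
by rewrite -[leRHS]invrK lef_pV2 ?posrE ?invr_gt0// ltW.
Qed.

Lemma uniformly_locally_curved : exists M, 1 <= M /\
  forall x (ze : 'rV[R]_m), K x -> `|ze| = 1 -> locally_curved M (x, ze).
Proof.
have cKS := compact_setX cK compact_sphere.
have [] := @filter_ex _ (pinfty_nbhs R) _ ([set M | 1 <= M] `&`
    [set M | K `*` [set ze : 'rV[R]_m | `|ze| = 1] `<=` locally_curved M]).
  apply: filterI; first exact: nbhs_pinfty_ge.
  have /compact_near_coveringP/(_ R (pinfty_nbhs R) locally_curved _) := cKS.
  by apply => -[z ze] /= [Kz ze1]; exact: near_locally_curved.
by move=> M [M1 MP]; exists M; split => // x ze Kx ze1; apply: MP.
Qed.

(** The numerical condition of [sublevel_cover] for [dl = 2 * u] with [u = (2 * M * l) ^ (1 / M)].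
    Since [u <= 1], this one exponent serves every order [k <= M]: [u ^+ k >= 2 * M * l]. *)
Lemma scale_bound (M l : R) (k : nat) : 1 <= M -> 0 < l -> 2 * M * l <= 1 ->
  k%:R <= M -> (2 / (2 * (2 * M * l) `^ M^-1)) ^+ k * l < M^-1.
Proof.
move=> M1 l0 Ml kM; pose u := (2 * M * l) `^ M^-1.
have M0 : 0 < M by exact: lt_le_trans M1.
have v0 : 0 < 2 * M * l by rewrite !mulr_gt0.
have u0 : 0 < u by exact: powR_gt0.
have u1 : u <= 1.
  rewrite /u -[leRHS](powRr0 (2 * M * l)) ger_powR// ?v0//.
  by rewrite invr_ge0 ltW.
have -> : 2 / (2 * u) = u^-1 by field; rewrite gt_eqF.
have uk : u^-1 ^+ k <= (2 * M * l)^-1.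
  rewrite exprVn lef_pV2 ?posrE ?exprn_gt0//.
  rewrite -powR_mulrn ?(ltW u0)// /u -powRrM -[leLHS]powRr1 ?(ltW v0)//.
  by rewrite ger_powR ?v0// mulrC ler_pdivrMr ?mul1r.
apply: (@le_lt_trans _ _ ((2 * M * l)^-1 * l)); first by rewrite ler_wpM2r// ltW.
have -> : (2 * M * l)^-1 * l = M^-1 / 2 by field; rewrite !gt_eqF.
by rewrite ltr_pdivrMr// ltr_pMr ?invr_gt0// ltr1n.
Qed.

(** The range of [K] is cut into cells so short that each lies in the neighbourhood controlled
    around any of its points of [K]. The order of the large derivative may vary with cell and
    direction, but is at most [M], which bounds the total number of intervals. *)
Lemma uniform_sublevel : exists (M : R) (N : nat), 1 <= M /\
  forall (ze : 'rV[R]_m) a l, `|ze| = 1 -> 0 < l -> 2 * M * l <= 1 ->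
  exists s : seq R, (size s <= N)%N /\ forall x, K x ->
    `|comb ze 1 x - a| <= l ->
    exists2 t, t \in s & t <= x <= t + 4 * (2 * M * l) `^ M^-1.
Proof.
have [M [M1 HM]] := uniformly_locally_curved.
have M0 : 0 < M by exact: lt_le_trans M1.
have M20 : 0 < 2 * M by rewrite mulr_gt0.
(* Enough cells of length [1 / (2 * M)] to cover [[-B, B]]; points of one cell are less than [1 / M]
   apart. *)
pose N0 := (Num.truncn (2 * B * (2 * M))).+1.
exists M, (N0 * 2 ^ (Num.truncn M))%N; split => // ze a l ze1 l0 Ml.
pose u := (2 * M * l) `^ M^-1.
pose cell (q : 'I_N0) x := Num.truncn ((x + B) * (2 * M)) = q.
have KB' x : K x -> 0 <= (x + B) * (2 * M).
  by move=> /KB; rewrite ler_norml => /andP[xB _]; rewrite mulr_ge0 ?(ltW M20)//; lra.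
have cell_close q x y : K x -> K y -> cell q x -> cell q y -> `|x - y| < M^-1.
  rewrite /cell => Kx Ky cx cy.
  have := truncn_itv (KB' x Kx); have := truncn_itv (KB' y Ky); rewrite cx cy.
  rewrite -[q.+1%:R]natr1; move: (q%:R : R) => e hy hx.
  have : `|(x - y) * M| < 1 by exact: (cell_bound hx hy).
  by rewrite normrM (gtr0_norm M0) -ltr_pdivlMr// div1r.
have u0 : 0 < u by rewrite powR_gt0// mulr_gt0.
have /boolp.choice[s sP] : forall q : 'I_N0, exists s : seq R,
    (size s <= 2 ^ (Num.truncn M))%N /\ forall x, K x -> cell q x ->
    `|comb ze 1 x - a| <= l -> exists2 t, t \in s & t <= x <= t + 4 * u.
  move=> q; have [[x0 [Kx0 cx0]]|nx] := pselect (exists x, K x /\ cell q x); last first.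
    by exists [::]; split => // x Kx cx; case: nx; exists x.
  have [k [k0 kM dk ck]] := HM x0 ze Kx0 ze1.
  have [|||s [ss sE]] := @sublevel_cover R k (fun j => comb ze j.+1) (x0 - M^-1) (x0 + M^-1)
      M^-1 (2 * u) l a k0 (mulr_gt0 (ltr0Sn R 1) u0).
  - move=> j y jk yx; apply: dk => //=.
    by rewrite distrC ltr_norml; move: (M^-1) yx => v; lra.
  - move=> y yx; apply: ck => /=.
    by rewrite distrC ltr_norml; move: (M^-1) yx => v; lra.
  - exact: scale_bound.
  exists s; split.
    apply: (leq_trans ss); rewrite leq_exp2l//.
    by rewrite truncn_ge_nat// ltW.
  move=> x Kx cx xl; have := cell_close q x0 x Kx0 Kx cx0 cx.
  rewrite ltr_norml => xx0; have [|t ts tx] := sE x _ xl.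
    by move: (M^-1) xx0 => v; lra.
  by exists t => //; move: tx; rewrite mulrA -[2 * 2]natrM.
exists (flatten [seq s q | q <- enum 'I_N0]); split.
  rewrite size_flatten /shape -map_comp sumnE big_map big_enum/=.
  apply: (@leq_trans (\sum_(q < N0) 2 ^ (Num.truncn M))%N).
    by apply: leq_sum => q _; have [] := sP q.
  by rewrite sum_nat_const card_ord.
move=> x Kx xl.
have qlt : (Num.truncn ((x + B) * (2 * M)) < N0)%N.
  rewrite /N0 ltnS le_truncn// ler_wpM2r ?(ltW M20)//.
  by have := KB Kx; rewrite ler_norml; lra.
have [_ /(_ x Kx erefl xl)[t ts tx]] := sP (Ordinal qlt).
exists t => //; apply/flattenP; exists (s (Ordinal qlt)) => //.
by apply: map_f; rewrite mem_enum.
Qed.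

End uniform_sublevel.

(** * Pointwise decay *)

Section decay.
Context {R : realType}.
Variable mu : probability (measurableTypeR R) R.
Notation m := (mass mu).
Local Notation represents := (represents mu).
Local Notation S := (msupport mu).
Local Notation mfun f := (measurable_fun [set: R] (f : R -> R)).
Local Notation piece := (piece (R := R)).

(** Turns the total weight of bad pieces into a mass: a piece that sends the support into [J]
    contributes its full weight to [m J]. *)
Lemma sum_weight_le_mass (L : seq piece) (c : pred piece) (J : set R) : represents L ->
  measurable J -> (forall p, p \in L -> c p -> forall x, S x -> J (aff p x)) ->
  \sum_(p <- L | c p) weight p <= m J.
Proof.
move=> [w1 s1 mE] mJ cJ; rewrite mE// big_mkcond/= big_seq [leRHS]big_seq.
apply: ler_sum => p pL; have [/ltW w0 _] := w1 p pL.
case: ifP => cp; last by rewrite mulr_ge0// mass_ge0.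
have mpJ : measurable (aff p @^-1` J) by exact: measurable_preimage_aff.
rewrite -[leLHS]mulr1 ler_wpM2l// -(mass_msupport mu); apply: le_mass => //.
  exact: measurable_msupport.
by move=> x Sx; exact: cJ.
Qed.

Lemma sum_has_le (T I : eqType) (s : seq I) (L : seq T) (c : T -> pred I) (w : T -> R) (D : R) :
  (forall p, p \in L -> 0 <= w p) ->
  (forall i, i \in s -> \sum_(p <- L | c p i) w p <= D) ->
  \sum_(p <- L | has (c p) s) w p <= (size s)%:R * D.
Proof.
move=> w0; elim: s => [|i s IH] sD; first by rewrite mul0r big1.
rewrite /= -natr1 mulrDl mul1r addrC.
apply: le_trans (lerD (sD i _) (IH _)); rewrite ?inE ?eqxx//; last first.
  by move=> j js; apply: sD; rewrite inE js orbT.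
rewrite big_mkcond [X in _ <= X + _]big_mkcond [X in _ <= _ + X]big_mkcond -big_split/=.
rewrite big_seq [leRHS]big_seq; apply: ler_sum => p /w0 wp.
by case: (c p i) => /=; case: (has (c p) s) => /=; lra.
Qed.

(** On a piece the phase is replaced by its tangent at the image of [x0]; the constant term
    disappears by [osc_shift], and the remainder is quadratic in the diameter of the piece. *)
Lemma osc_piece (L : seq piece) p phi h x0 B E : represents L -> p \in L ->
  mfun phi -> S x0 -> S `<=` `[- B, B] ->
  (forall x y, S x -> S y -> `|phi y - phi x - h x * (y - x)| <= E * (y - x) ^+ 2) -> 0 <= E ->
  osc mu (fun x => 2 * pi * phi (aff p x)) <=
  osc mu (fun x => 2 * pi * ((ratio p * h (aff p x0)) * x)) +
    2 * (2 * pi * (E * (ratio p * (2 * B)) ^+ 2)).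
Proof.
move=> Lr pL mphi Sx0 SB hphi E0.
pose y0 := aff p x0; pose k := ratio p * h y0.
pose psi x := 2 * pi * (k * x) + 2 * pi * (phi y0 - k * x0).
have mlin : mfun (fun x => 2 * pi * (k * x)).
  by apply: measurable_funM => //; exact: measurable_funM.
have mphip : mfun (fun x => 2 * pi * phi (aff p x)).
  apply: measurable_funM => //; apply: measurableT_comp => //; exact: measurable_aff.
have mpsi : mfun psi by exact: measurable_funD.
apply: (@le_trans _ _ (osc mu psi + 2 * (2 * pi * (E * (ratio p * (2 * B)) ^+ 2)))); last first.
  by rewrite lerD2r; exact: osc_shift.
apply: osc_perturb => // x Sx.
have -> : 2 * pi * phi (aff p x) - psi x = 2 * pi * (phi (aff p x) - phi y0 - h y0 * (aff p x - y0)).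
  by rewrite /psi /k /y0 /aff; ring.
have pi20 : 0 <= 2 * pi :> R by rewrite mulr_ge0// pi_ge0.
rewrite normrM (ger0_norm pi20) ler_wpM2l//.
apply: (le_trans (hphi _ _ (msupport_aff Lr pL Sx0) (msupport_aff Lr pL Sx))).
rewrite ler_wpM2l//.
have -> : aff p x - y0 = ratio p * (x - x0) by rewrite /y0 /aff; ring.
rewrite -[leLHS]real_normK ?num_real// -[leRHS]real_normK ?num_real//.
rewrite lerXn2r ?nnegrE// normrM [`|_ * (2 * B)|]normrM ler_wpM2l//.
have := SB x Sx; have := SB x0 Sx0; rewrite /= !in_itv/= => hx0 hx.
have B0 : 0 <= 2 * B by lra.
by rewrite [leRHS]ger0_norm// ler_norml; move: hx hx0; lra.
Qed.

Lemma mass_intervals (s : seq R) (J : set R) (Cf sg w : R) (N : nat) : 1 <= Cf -> 0 < w ->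
  (forall t dl, 0 < dl -> m `[t, t + dl] <= Cf * dl `^ sg) -> (size s <= N)%N ->
  J = [set x | exists2 t, t \in s & t <= x <= t + w] ->
  measurable J /\ m J <= N%:R * (Cf * w `^ sg).
Proof.
move=> Cf1 w0 fr sN ->.
have E : [set x | exists2 t, t \in s & t <= x <= t + w] =
    \big[setU/set0]_(t <- s) `[t, t + w]%classic.
  apply/seteqP; split => [x [t ts tx]|x]; rewrite -bigcup_seq.
    by exists t => //=; rewrite in_itv.
  by move=> [t /= ts]; rewrite in_itv/= => tx; exists t.
have mE : measurable [set x | exists2 t, t \in s & t <= x <= t + w].
  by rewrite E; apply: bigsetU_measurable => t _; exact: measurable_itv.
split => //; apply: (@le_trans _ _ ((size s)%:R * (Cf * w `^ sg))).
  apply: (@mass_seq_cover _ mu _ s (fun t => `[t, t + w]%classic)) => //.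
  by move=> t; exact: fr.
by rewrite ler_wpM2r ?ler_nat// mulr_ge0 ?powR_ge0//; lra.
Qed.

Lemma sum_of_powers_le (a b c C1 C2 C3 t sg : R) : 1 <= t -> 0 <= C1 -> 0 <= C2 -> 0 <= C3 ->
  sg <= a -> sg <= b -> sg <= c ->
  C1 * t `^ (- a) + C2 * t `^ (- b) + C3 * t `^ (- c) <= (C1 + C2 + C3) * t `^ (- sg).
Proof.
move=> t1 C10 C20 C30 sa sb sc; rewrite !mulrDl !lerD// ler_wpM2l//.
all: by rewrite ler_powR// lerN2.
Qed.

(** The counts of ratios and of bad intervals are each of order [t ^ (e / 4)], the mass of the
    intervals for one pair is of order [t ^ (- e)]; the product is of order [t ^ (- (e / 2))]. *)
Lemma bad_mass_exponent (t Al Cf N w0 C1 C2 e ka1 ka2 a0 s M : R) : 0 < t ->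
  0 <= w0 -> 0 <= Al -> e = s / (4 * M) -> ka1 = e / 3 -> a0 * ka2 = e / 4 -> M != 0 ->
  (C1 * (t `^ (- (3 / 4))) `^ (- ka1)) * (C2 * (Al * t `^ a0) `^ ka2) *
    (N * (Cf * (w0 * (t `^ (- (1 / 4))) `^ M^-1) `^ s)) =
  (C1 * (C2 * Al `^ ka2) * (N * (Cf * w0 `^ s))) * t `^ (- (e / 2)).
Proof.
move=> t0 w00 Al0 eE k1 k2 M0.
have p1 : (t `^ (- (3 / 4))) `^ (- ka1) = t `^ (e / 4).
  by rewrite -powRrM k1; congr (_ `^ _); field.
have p2 : (t `^ a0) `^ ka2 = t `^ (e / 4) by rewrite -powRrM k2.
have p3 : ((t `^ (- (1 / 4))) `^ M^-1) `^ s = t `^ (- e).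
  by rewrite -!powRrM eE; congr (_ `^ _); field.
rewrite powRM ?powR_ge0// [(w0 * _) `^ s]powRM ?powR_ge0// p1 p2 p3.
have -> : t `^ (- (e / 2)) = t `^ (e / 4) * t `^ (e / 4) * t `^ (- e).
  by rewrite -!powRD ?(gt_eqF t0) ?implybT//; congr (_ `^ _); field.
ring.
Qed.

Lemma dist_segment (x y B : R) : `[- B, B]%classic x -> `[- B, B]%classic y ->
  `|x - y| <= 2 * B.
Proof. by rewrite /= !in_itv/= ler_norml; lra. Qed.

(** Here [a] is a ratio, [b] and [z] values of [h] on one piece. An interval of length 2 for [a * b]
    confines [b] to within [1 / |a|] of [c], and [z] differs from [b] by at most [At]. *)
Lemma piece_near (a z b c u dl rho At B : R) : 0 < rho -> 0 < dl ->
  rho * dl <= `|a| -> `|z - b| <= At -> u <= a * b <= u + 2 ->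
  c = (u + 1) / a -> `|z - c| <= At + (rho * dl)^-1.
Proof.
move=> rho0 dl0 adl zb ub ->.
have a0 : 0 < `|a| by apply: lt_le_trans adl; rewrite mulr_gt0.
apply: (le_trans (ler_distD b _ _)); rewrite lerD//.
have -> : b - (u + 1) / a = (a * b - (u + 1)) / a by field; rewrite -normr_gt0.
rewrite normrM normfV; apply: (@le_trans _ _ (1 * `|a|^-1)).
  by rewrite ler_wpM2r ?invr_ge0// ler_norml; lra.
by rewrite mul1r lef_pV2// posrE mulr_gt0.
Qed.

(** [phi] and [h] stand for the phase and its derivative on the support. For given [mu], the
    exponent and the constant depend on them only through [A], [a0], [M] and [N], which makes the
    decay uniform in [th] and [ze]. *)
Lemma osc_decay (L0 : seq piece) (A a0 M : R) (N : nat) : represents L0 ->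
  (forall p, p \in L0 -> `|ratio p| < 1) -> non_atomic mu ->
  (forall kap : R, 0 < kap -> exists tau C : R, [/\ 0 < tau, 0 < C &
    forall T, 1 <= T -> exists s : seq R, (size s)%:R <= C * T `^ kap /\
      forall y, `|y| <= T -> T `^ (- tau) <= osc mu (fun x => 2 * pi * (y * x)) ->
        exists2 t, t \in s & t <= y <= t + 2]) ->
  1 <= A -> 0 < a0 -> 1 <= M ->
  exists sg C : R, [/\ 0 < sg, 0 < C & forall t phi h, 1 <= t -> mfun phi ->
    (forall x y, S x -> S y -> `|phi y - phi x - h x * (y - x)| <= A * t * (y - x) ^+ 2) ->
    (forall x y, S x -> S y -> `|h x - h y| <= A * t * `|x - y|) ->
    (forall x, S x -> `|h x| <= A * t `^ a0) ->
    (forall b l, 0 < l -> 2 * M * (l / t) <= 1 -> exists s : seq R, (size s <= N)%N /\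
      forall x, S x -> `|h x - b| <= l ->
        exists2 t', t' \in s & t' <= x <= t' + 4 * (2 * M * (l / t)) `^ M^-1) ->
    osc mu (fun x => 2 * pi * phi x) <= C * t `^ (- sg)].
Proof.
move=> L0r aL0 na LS A1 a00 M1.
have num34 : 1 + - (3 / 4) <= 3 / 4 :> R by lra.
have [B [B1 mB]] := mass_bounded L0r aL0.
have SB : S `<=` `[- B, B] by apply: msupport_sub => //; exact: interval_closed.
have [rho [lam [/andP[rho0 rho1] /andP[lam0 lam1] aL]]] := ratio_bounds L0r aL0.
have [s [Cf [s0 Cf1 fr]]] := frostman L0r aL0 na.
have M0 : 0 < M by exact: lt_le_trans M1.
have A0 : 0 < A by exact: lt_le_trans A1.
have B0 : 0 < B by exact: lt_le_trans B1.
(* An interval of length of order [t ^ (- (1 / (4 * M)))] has mass at most of order [t ^ (- e)]. *)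
pose e := s / (4 * M); have e0 : 0 < e by rewrite divr_gt0// mulr_gt0.
pose ka1 := e / 3; have ka10 : 0 < ka1 by rewrite divr_gt0.
have rho01 : 0 < rho < 1 by rewrite rho0.
have lam01 : 0 < lam < 1 by rewrite lam0.
have [C1 [C10 H1]] := generated_ratios rho01 lam01 aL ka10.
pose ka2 := e / 4 / a0; have ka20 : 0 < ka2 by rewrite divr_gt0// (divr_gt0 e0).
have [tau [C2 [tau0 C20 H2]]] := LS _ ka20.
(* In units of [t ^ (3 / 4)]: [2 * A * B] bounds the variation of [h] on a piece, and [rho^-1] the
   inverse of its ratio. *)
pose A' := 2 * A * B + rho^-1.
have A'0 : 0 < A' by rewrite addr_gt0 ?invr_gt0// !mulr_gt0.
pose v := 2 * M * A'; have v0 : 0 < v by rewrite !mulr_gt0.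
pose w0 := 4 * v `^ M^-1.
have w00 : 0 < w0 by rewrite mulr_gt0// powR_gt0.
pose Cb := C1 * (C2 * A `^ ka2) * (N%:R * (Cf * w0 `^ s)).
have Cb0 : 0 <= Cb.
  by rewrite /Cb !mulr_ge0 ?powR_ge0 ?(ltW C10) ?(ltW C20)// (le_trans ler01).
pose C3 := 2 * (2 * pi * (A * (2 * B) ^+ 2)).
have C30 : 0 <= C3 by rewrite /C3 !mulr_ge0 ?pi_ge0 ?exprn_ge0 ?mulr_ge0 ?ltW.
(* One exponent for each contribution: the good pieces, the weight of the bad ones, the
   linearization error. *)
pose sg := Num.min (a0 * tau) (Num.min (e / 2) (1 / 2)).
have sg0 : 0 < sg by rewrite !lt_min mulr_gt0//= (divr_gt0 e0)//= divr_gt0.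
(* From [t0] on, the level [l] below satisfies the condition [2 * M * (l / t) <= 1]; for smaller [t]
   the trivial bound by 1 suffices. *)
pose t0 := v ^+ 4; have t00 : 0 < t0 by rewrite exprn_gt0.
exists sg, (1 + Cb + C3 + t0 `^ sg); split => //.
  by rewrite ltr_wpDl ?powR_gt0// !addr_ge0.
move=> t phi h t1 mphi hphi hlip hbnd hsub.
have tt0 : 0 < t by exact: lt_le_trans t1.
have mphi2 : mfun (fun x => 2 * pi * phi x) by exact: measurable_funM.
have [tlt|tge] := ltP t t0.
  apply: (le_trans (osc_le1 mu mphi2)).
  apply: (@le_trans _ _ (t0 `^ sg * t `^ (- sg))); last first.
    by rewrite ler_wpM2r ?powR_ge0// lerDr !addr_ge0.
  rewrite powRN ler_pdivlMr ?powR_gt0// mul1r.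
  by rewrite ge0_ler_powR ?nnegrE ?(ltW sg0) ?(ltW tt0) ?(ltW t00)// ltW.
pose dl := t `^ (- (3 / 4)).
have dl0 : 0 < dl by exact: powR_gt0.
have dl01 : 0 < dl <= 1.
  by rewrite dl0 -[leRHS](powRr0 t) ler_powR// oppr_le0 divr_ge0.
have [L [Lr aLd]] := represents_scale L0r rho0 lam1 aL dl01.
have [w1 ws _] := Lr.
have [As [sAs hAs]] := H1 dl dl01.
pose T := A * t `^ a0.
have ta1 : 1 <= t `^ a0 by rewrite -[leLHS](powRr0 t) ler_powR// ltW.
have T1 : 1 <= T by rewrite -[leLHS]mulr1 ler_pM.
have [s2 [ss2 hs2]] := H2 T T1.
have [x0 Sx0] := msupport_nonempty mu.
pose k p := ratio p * h (aff p x0).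
(* The labels of the union bound: a possible ratio and the left end of an interval of bad
   frequencies. *)
pose I := [seq (a, u) | a <- As, u <- s2].
pose c p (i : R * R) := (ratio p == i.1) && (i.2 <= k p <= i.2 + 2).
pose l := A' * t `^ (3 / 4).
have l0 : 0 < l by rewrite mulr_gt0// powR_gt0.
have ltE : 2 * M * (l / t) = v * t `^ (- (1 / 4)).
  have -> : t `^ (- (1 / 4)) = t `^ (3 / 4) / t.
    have -> : - (1 / 4) = 3 / 4 - 1 :> R by field.
    by rewrite powRB ?(gt_eqF tt0) ?implybT// powRr1 ?(ltW tt0).
  by rewrite /l /v; ring.
have lt1 : 2 * M * (l / t) <= 1.
  rewrite ltE powRN ler_pdivrMr ?powR_gt0// [leRHS]mul1r.
  have -> : v = t0 `^ (1 / 4).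
    rewrite /t0 -powR_mulrn ?(ltW v0)// -powRrM (_ : 4 * (1 / 4) = 1) ?powRr1 ?(ltW v0)//.
    by field.
  by rewrite ge0_ler_powR ?nnegrE ?divr_ge0 ?(ltW t00) ?(ltW tt0).
pose w := w0 * (t `^ (- (1 / 4))) `^ M^-1.
have wE : 4 * (2 * M * (l / t)) `^ M^-1 = w.
  by rewrite ltE powRM ?(ltW v0) ?powR_ge0// mulrA.
have wpos : 0 < w by rewrite mulr_gt0// powR_gt0// powR_gt0.
pose D := N%:R * (Cf * w `^ s).
have D0 : 0 <= D by rewrite !mulr_ge0 ?powR_ge0// (le_trans ler01).
have tdl : t * dl <= t `^ (3 / 4).
  rewrite -[X in X * _](powRr1 (ltW tt0)) /dl -powRD ?(gt_eqF tt0) ?implybT//.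
  by rewrite ler_powR.
have idl : (rho * dl)^-1 = rho^-1 * t `^ (3 / 4) by rewrite invfM /dl powRN invrK.
have diamS x y : S x -> S y -> `|x - y| <= 2 * B.
  by move=> /SB hx /SB hy; exact: dist_segment.
have bad_le i : i \in I -> \sum_(p <- L | c p i) weight p <= D.
  (* The list [As] may contain values outside the range of the ratios in [L]; for these the sum is
     empty. *)
  case: i => a u _; have [/andP[a1 a2]|na'] := boolP (rho * dl <= `|a| <= dl); last first.
    rewrite big_seq_cond big1// => p /and3P[pL /eqP/= pa _].
    by have [pr _] := aLd p pL; rewrite -pa pr in na'.
  have [sJ [ssJ hJ]] := hsub ((u + 1) / a) l l0 lt1.
  have [mJ J_le] := mass_intervals Cf1 wpos fr ssJ erefl.
  apply: le_trans J_le; apply: sum_weight_le_mass => // p pL /andP[/= /eqP pa pu] x Sx.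
  rewrite /= -wE; apply: hJ; first exact: msupport_aff Lr pL Sx.
  have Sz := msupport_aff Lr pL Sx; have Sb := msupport_aff Lr pL Sx0.
  have hz : `|h (aff p x) - h (aff p x0)| <= 2 * A * B * t `^ (3 / 4).
    apply: (le_trans (hlip _ _ Sz Sb)).
    have -> : aff p x - aff p x0 = a * (x - x0) by rewrite /aff pa; ring.
    apply: (@le_trans _ _ (A * t * (dl * (2 * B)))).
      by rewrite ler_wpM2l ?mulr_ge0 ?(ltW A0) ?(ltW tt0)// normrM ler_pM// diamS.
    have -> : A * t * (dl * (2 * B)) = 2 * A * B * (t * dl) by ring.
    by rewrite ler_wpM2l// !mulr_ge0// ltW.
  rewrite /k pa in pu.
  apply: le_trans (piece_near B rho0 dl0 a1 hz pu erefl) _.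
  by rewrite idl -mulrDl.
have bad_sum : \sum_(p <- L | has (c p) I) weight p <= Cb * t `^ (- (e / 2)).
  have := @sum_has_le _ _ I L c weight D (fun p pL => ltW (w1 p pL).1) bad_le.
  move/le_trans; apply; rewrite size_allpairs natrM.
  have ka2E : a0 * ka2 = e / 4 by rewrite /ka2 mulrC divfK// gt_eqF.
  have bE : (C1 * dl `^ (- ka1)) * (C2 * T `^ ka2) * D = Cb * t `^ (- (e / 2)).
    by apply: bad_mass_exponent ka2E _ => //; [exact: ltW|exact: ltW|rewrite gt_eqF].
  rewrite -[leRHS]bE; apply: ler_wpM2r; first exact: D0.
  by apply: ler_pM; [exact: ler0n|exact: ler0n|exact: sAs|exact: ss2].
have Ttau : T `^ (- tau) <= t `^ (- (a0 * tau)).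
  rewrite !powRN lef_pV2 ?posrE ?powR_gt0// ?(lt_le_trans ltr01 T1)// powRrM.
  rewrite ge0_ler_powR ?nnegrE ?(ltW tau0) ?powR_ge0 ?(le_trans ler01 T1)//.
  by rewrite /T -[leLHS]mul1r ler_wpM2r ?powR_ge0.
have errE : 2 * (2 * pi * (A * t * (dl * (2 * B)) ^+ 2)) = C3 * t `^ (- (1 / 2)).
  have -> : t `^ (- (1 / 2)) = t * dl ^+ 2.
    have -> : - (1 / 2) = 1 + - (3 / 4) * 2%:R :> R by field.
    by rewrite powRD ?(gt_eqF tt0) ?implybT// powRr1 ?(ltW tt0)// powRrM powR_mulrn ?(ltW dl0).
  by rewrite /C3; ring.
(* A bad piece is bounded by its weight. On a good one the frequency [k p], of size at most [T],
   avoids the bad intervals, which gives the decay [T ^ (- tau)]. *)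
have piece_le p : p \in L -> weight p * osc mu ((fun x => 2 * pi * phi x) \o aff p) <=
    weight p * (t `^ (- (a0 * tau)) + C3 * t `^ (- (1 / 2))) +
    (if has (c p) I then weight p else 0).
  move=> pL; have [/ltW wp _] := w1 p pL; have [/andP[p1 p2] pg] := aLd p pL.
  have At0 : 0 <= A * t by rewrite mulr_ge0 ?ltW.
  have op := osc_piece Lr pL mphi Sx0 SB hphi At0.
  have err : 2 * (2 * pi * (A * t * (ratio p * (2 * B)) ^+ 2)) <= C3 * t `^ (- (1 / 2)).
    rewrite -errE; do 2 (rewrite ler_wpM2l ?mulr_ge0 ?pi_ge0//).
    rewrite ler_wpM2l// -[leLHS]real_normK ?num_real// lerXn2r ?nnegrE//.
      by rewrite !mulr_ge0 ?(ltW dl0) ?(ltW B0).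
    by rewrite normrM [X in _ * X]ger0_norm ?mulr_ge0 ?(ltW B0)// ler_wpM2r ?mulr_ge0 ?(ltW B0).
  have {op} := le_trans op (lerD (lexx _) err).
  rewrite -/(k p) => op.
  have mlin : mfun (fun x => 2 * pi * (k p * x)).
    by apply: measurable_funM => //; exact: measurable_funM.
  case: ifPn => bad.
    rewrite -[X in _ <= _ + X]mulr1 -mulrDr ler_wpM2l//.
    apply: (le_trans op); rewrite addrAC lerD2r.
    by apply: (le_trans (osc_le1 mu mlin)); rewrite lerDr powR_ge0.
  rewrite addr0 ler_wpM2l//; apply: (le_trans op); rewrite lerD2r.
  apply: le_trans Ttau; rewrite leNgt; apply/negP => oT.
  have kT : `|k p| <= T.
    rewrite normrM -[leRHS]mul1r ler_pM//.
      by rewrite (le_trans p2)//; case/andP: dl01.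
    by apply: hbnd; exact: msupport_aff Lr pL Sx0.
  have [u us uk] := hs2 _ kT (ltW oT).
  move/negP: bad; apply; apply/hasP; exists (ratio p, u); last by rewrite /c/= eqxx.
  by apply/allpairsP; exists (ratio p, u); split => //=; exact: hAs.
apply: (le_trans (osc_represents Lr mphi2)).
apply: (@le_trans _ _ (t `^ (- (a0 * tau)) + C3 * t `^ (- (1 / 2)) + Cb * t `^ (- (e / 2)))).
  rewrite big_seq; apply: (le_trans (ler_sum _ piece_le)); rewrite -big_seq big_split/=.
  by rewrite -mulr_suml ws mul1r lerD2l -big_mkcond.
apply: (@le_trans _ _ ((1 + Cb + C3) * t `^ (- sg))); last first.
  by rewrite ler_wpM2r ?powR_ge0// lerDl powR_ge0.
rewrite addrAC -[X in X + _ + _]mul1r; apply: sum_of_powers_le => //.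
- by rewrite /sg ge_min lexx.
- by rewrite /sg !ge_min lexx orbT.
- by rewrite /sg !ge_min lexx !orbT.
Qed.

End decay.

(** * Pointwise decay for the graph *)

Section fourier_decay.
Context {R : realType}.
Variable mu : probability (measurableTypeR R) R.
Notation m := (mass mu).
Local Notation S := (msupport mu).
Local Notation mfun f := (measurable_fun [set: R] (f : R -> R)).

(** All quantities are linear in [ze], so bounds for the coordinates of [g] add up to bounds
    proportional to [|ze|]. *)
Lemma curve_bounds (n : nat) (g : R -> 'rV[R]_n) (B : R) : compact S -> 0 < B ->
  S `<=` `[- B, B] -> (forall z, S z -> finite_type_at g z) ->
  exists A : R, 1 <= A /\ forall ze : 'rV[R]_n,
    [/\ forall x y, S x -> S y -> `|\sum_(i < n) ze ord0 i * (coord g i y - coord g i x) -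
          comb g ze 1 x * (y - x)| <= A * `|ze| * (y - x) ^+ 2,
        forall x y, S x -> S y -> `|comb g ze 1 x - comb g ze 1 y| <= A * `|ze| * `|x - y| &
        forall x, S x -> `|comb g ze 1 x| <= A * `|ze|].
Proof.
move=> cS B0 SB ft.
have /boolp.choice[M HM] : forall i : 'I_n, exists M, 0 <= M /\ forall x y, S x -> S y ->
    `|derive1n 1 (coord g i) x - derive1n 1 (coord g i) y| <= M * `|x - y| /\
    `|coord g i y - coord g i x - derive1n 1 (coord g i) x * (y - x)| <= M * (y - x) ^+ 2.
  move=> i; apply: (uniform_C2 cS) => z Sz; have [[U [oU Uz dg]] _] := ft z Sz.
  by exists U; split.
have [x0 Sx0] := msupport_nonempty mu.
pose G i := `|derive1n 1 (coord g i) x0| + M i * (2 * B).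
have M0 i : 0 <= M i by have [] := HM i.
have G0 i : 0 <= G i by rewrite addr_ge0 ?mulr_ge0 ?(ltW B0).
have GP i x : S x -> `|derive1n 1 (coord g i) x| <= G i.
  move=> Sx; have [h _] := (HM i).2 x x0 Sx Sx0.
  have := ler_normD (derive1n 1 (coord g i) x - derive1n 1 (coord g i) x0) (derive1n 1 (coord g i) x0).
  rewrite subrK => /le_trans; apply; rewrite addrC lerD2l.
  apply: (le_trans h); rewrite ler_wpM2l//.
  exact: dist_segment (SB _ Sx) (SB _ Sx0).
have ze_le (ze : 'rV[R]_n) i : `|ze ord0 i| <= `|ze|.
  by rewrite [leRHS]/Num.Def.normr/= mx_normrE; exact: (le_bigmax _ (fun ij => `|ze ij.1 ij.2|) (ord0, i)).
pose SM := \sum_(i < n) M i; pose SG := \sum_(i < n) G i.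
have SM0 : 0 <= SM by exact: sumr_ge0.
have SG0 : 0 <= SG by exact: sumr_ge0.
have sum_bound (ze : 'rV[R]_n) (F : 'I_n -> R) (c : 'I_n -> R) (e : R) : 0 <= e ->
    (forall i, `|F i| <= c i * e) ->
    `|\sum_(i < n) ze ord0 i * F i| <= (\sum_(i < n) c i) * `|ze| * e.
  move=> e0 Fc; apply: (le_trans (ler_norm_sum _ _ _)).
  rewrite 2!mulr_suml; apply: ler_sum => i _.
  by rewrite normrM [c i * _]mulrC -mulrA; apply: ler_pM.
exists (1 + SM + SG); split; first by rewrite -addrA lerDl addr_ge0.
move=> ze; have zn := normr_ge0 ze.
have leA c e : 0 <= e -> c <= 1 + SM + SG -> c * `|ze| * e <= (1 + SM + SG) * `|ze| * e.
  by move=> e0 cA; rewrite ler_wpM2r// ler_wpM2r.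
split => [x y Sx Sy|x y Sx Sy|x Sx].
- have -> : \sum_(i < n) ze ord0 i * (coord g i y - coord g i x) - comb g ze 1 x * (y - x) =
      \sum_(i < n) ze ord0 i * (coord g i y - coord g i x - derive1n 1 (coord g i) x * (y - x)).
    by rewrite /comb mulr_suml -sumrB; apply: eq_bigr => i _; ring.
  apply: (@le_trans _ _ (SM * `|ze| * (y - x) ^+ 2)).
    by apply: sum_bound; [exact: sqr_ge0|move=> i; have [] := (HM i).2 x y Sx Sy].
  by apply: leA; [exact: sqr_ge0|rewrite addrAC lerDr addr_ge0].
- have -> : comb g ze 1 x - comb g ze 1 y =
      \sum_(i < n) ze ord0 i * (derive1n 1 (coord g i) x - derive1n 1 (coord g i) y).
    by rewrite /comb -sumrB; apply: eq_bigr => i _; rewrite mulrBr.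
  apply: (@le_trans _ _ (SM * `|ze| * `|x - y|)).
    by apply: sum_bound => // i; have [] := (HM i).2 x y Sx Sy.
  by apply: leA => //; rewrite addrAC lerDr addr_ge0.
- rewrite -[leRHS]mulr1; apply: (@le_trans _ _ (SG * `|ze| * 1)).
    by apply: sum_bound => // i; rewrite mulr1; exact: GP.
  by apply: leA => //; rewrite lerDr addr_ge0.
Qed.

Lemma graph_osc_decay (n : nat) (g : R -> 'rV[R]_n.+1) (L0 : seq (piece (R := R))) (eps : R)
    (Qt : R -> 'rV[R]_(1 + n.+1)) :
  represents mu L0 -> (forall p, p \in L0 -> `|ratio p| < 1) -> non_atomic mu ->
  (forall kap : R, 0 < kap -> exists tau C : R, [/\ 0 < tau, 0 < C &
    forall T, 1 <= T -> exists s : seq R, (size s)%:R <= C * T `^ kap /\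
      forall y, `|y| <= T -> T `^ (- tau) <= osc mu (fun x => 2 * pi * (y * x)) ->
        exists2 t, t \in s & t <= y <= t + 2]) ->
  (forall z, S z -> finite_type_at g z) ->
  (forall i, mfun (fun x => Qt x ord0 i)) ->
  (forall x, S x -> Qt x = graph_curve g x) -> 0 < eps ->
  exists sg C : R, [/\ 0 < sg, 0 < C & forall xi : 'rV[R]_(1 + n.+1),
    let th := lsubmx xi ord0 ord0 in let ze := rsubmx xi in
    1 <= `|ze| -> `|th| `^ eps <= `|ze| -> osc mu (phase Qt xi) <= C * `|ze| `^ (- sg)].
Proof.
move=> L0r aL0 na LS ft mQt QtE eps0.
have [B [B1 mB]] := mass_bounded L0r aL0.
have SB : S `<=` `[- B, B] by apply: msupport_sub => //; exact: interval_closed.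
have cS := msupport_compact mB.
have B0 : 0 < B by exact: lt_le_trans B1.
have [A [A1 HA]] := curve_bounds cS B0 SB ft.
have SBn x : S x -> `|x| <= B by move=> /SB; rewrite /= in_itv/= -ler_norml.
have [M [N [M1 HM]]] := uniform_sublevel cS SBn ft.
(* On the region [|th| <= t ^ (1 / eps)], while [<ze, g'>] is at most [A * t]; for [t >= 1] both are
   controlled by [t ^ a0]. *)
pose a0 := eps^-1 + 1.
have a00 : 0 < a0 by rewrite addr_gt0 ?invr_gt0.
have A10 : 1 <= 1 + A by rewrite lerDl (le_trans ler01).
have [sg [C [sg0 C0 H]]] := osc_decay N L0r aL0 na LS A10 a00 M1.
exists sg, C; split => // xi th ze t1 tht; set t := `|ze| in t1 tht *.
have t0 : 0 < t by exact: lt_le_trans t1.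
pose phi x := \sum_(i < 1 + n.+1) xi ord0 i * Qt x ord0 i.
pose h x := th + comb g ze 1 x.
have phiE x : S x -> phi x = th * x + \sum_(i < n.+1) ze ord0 i * coord g i x.
  move=> Sx; rewrite /phi QtE// big_split_ord big_ord1/=; congr (_ + _).
    by rewrite -[graph_curve g x _ _]/(coord (graph_curve g) _ x) coord_graphl /th mxE.
  apply: eq_bigr => i _.
  by rewrite -[graph_curve g x _ _]/(coord (graph_curve g) _ x) coord_graphr /ze mxE.
have [HA1 HA2 HA3] := HA ze.
have AA (c : R) : 0 <= c -> A * t * c <= (1 + A) * t * c.
  by move=> c0; rewrite ler_wpM2r// ler_wpM2r ?(ltW t0)// lerDr.
have mphi : mfun phi.
  by apply: measurable_sum => i; exact: measurable_funM.
apply: (H t phi h) => //.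
- move=> x y Sx Sy; rewrite !phiE//.
  have -> : th * y + \sum_(i < n.+1) ze ord0 i * coord g i y -
      (th * x + \sum_(i < n.+1) ze ord0 i * coord g i x) - h x * (y - x) =
      \sum_(i < n.+1) ze ord0 i * (coord g i y - coord g i x) - comb g ze 1 x * (y - x).
    under [in RHS]eq_bigr do rewrite mulrBr.
    by rewrite sumrB /h; ring.
  by apply: le_trans (HA1 x y Sx Sy) _; apply: AA; exact: sqr_ge0.
- move=> x y Sx Sy; rewrite /h opprD addrACA subrr add0r.
  by apply: le_trans (HA2 x y Sx Sy) _; exact: AA.
- move=> x Sx; apply: (le_trans (ler_normD _ _)); rewrite mulrDl mul1r lerD//.
    apply: (@le_trans _ _ (t `^ eps^-1)); last by rewrite ler_powR// lerDl.
    have -> : `|th| = (`|th| `^ eps) `^ eps^-1.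
      by rewrite -powRrM mulfV ?gt_eqF// powRr1.
    by rewrite ge0_ler_powR ?nnegrE ?invr_ge0 ?powR_ge0 ?(ltW eps0) ?(ltW t0).
  apply: (le_trans (HA3 x Sx)); rewrite ler_wpM2l ?(le_trans ler01)//.
  by rewrite -[leLHS]powRr1 ?(ltW t0)// ler_powR// lerDr invr_ge0 ltW.
- move=> b l l0 lM.
  have zt1 : `|t^-1 *: ze| = 1.
    by rewrite normrZ normfV [`|t|]ger0_norm ?(ltW t0)// mulVf// gt_eqF.
  (* The sublevel estimate is for unit directions: everything is divided by [t], and [th] moves into
     the centre of the level. *)
  have [s [ss sE]] := HM (t^-1 *: ze) ((b - th) / t) (l / t) zt1 (divr_gt0 l0 t0) lM.
  exists s; split => // x Sx hx; apply: sE => //.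
  have -> : comb g (t^-1 *: ze) 1 x = comb g ze 1 x / t.
    by rewrite /comb mulr_suml; apply: eq_bigr => i _; rewrite mxE; ring.
  rewrite -mulrBl normrM normfV [`|t|]ger0_norm ?(ltW t0)//.
  rewrite ler_wpM2r ?invr_ge0 ?(ltW t0)//.
  by rewrite (_ : comb g ze 1 x - (b - th) = h x - b)//; rewrite /h; ring.
Qed.

End fourier_decay.

(** * Integration over the region *)

Section final_integral.
Context {R : realType}.

Lemma powR_le_exponent (W p q : R) : 0 <= W <= 1 -> 0 < q -> q <= p -> W `^ p <= W `^ q.
Proof.
move=> /andP[W0 W1] q0 qp; have [->|Wn] := eqVneq W 0.
  by rewrite !powR0 ?gt_eqF// (lt_le_trans q0).
by rewrite ger_powR// lt0r Wn W0.
Qed.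

Lemma prod_oneDsqr_le (n : nat) (xi : 'rV[R]_(1 + n)) (u t : R) :
  1 <= t -> 1 <= u -> `|lsubmx xi ord0 ord0| <= u -> `|rsubmx xi| <= t ->
  \prod_(i < 1 + n) (1 + xi ord0 i ^+ 2) <= 2 ^+ (1 + n) * (u ^+ 2 * t ^+ (2 * n)).
Proof.
move=> t1 u1 thu zet.
have bound (x c : R) : 1 <= c -> `|x| <= c -> 1 + x ^+ 2 <= 2 * c ^+ 2.
  move=> c1 xc; have c0 : 0 <= c by exact: le_trans c1.
  have : x ^+ 2 <= c ^+ 2 by rewrite -[leLHS]real_normK ?num_real// lerXn2r.
  have : 1 <= c ^+ 2 by rewrite exprn_ege1.
  lra.
rewrite big_split_ord big_ord1/= exprD expr1 mulrACA; apply: ler_pM.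
- by rewrite addr_ge0// sqr_ge0.
- by apply: prodr_ge0 => i _; rewrite addr_ge0// sqr_ge0.
- by apply: bound => //; apply: le_trans thu; rewrite mxE.
rewrite exprM -exprMn; apply: (@le_trans _ _ (\prod_(i < n) (2 * t ^+ 2))).
  apply: ler_prod => i _; rewrite addr_ge0 ?sqr_ge0//=; apply: bound => //.
  apply: le_trans zet; rewrite [leRHS]/Num.Def.normr/= mx_normrE.
  apply: le_trans (le_bigmax _ (fun ij => `|rsubmx xi ij.1 ij.2|) (ord0, i)).
  by rewrite mxE.
by rewrite prodr_const card_ord.
Qed.

(** The bound obtained does not depend on [r], and [r ^ eps >= 1]. Where [|ze| < 1], the region is
    bounded and [W <= 1] is enough. *)
Lemma region_integral_bound (n : nat) (W : 'rV[R]_(1 + n) -> R) (eps sg C : R) :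
  0 < eps -> 0 < sg -> 0 < C -> (forall xi, 0 <= W xi <= 1) ->
  (forall xi, 1 <= `|rsubmx xi| -> `|lsubmx xi ord0 ord0| `^ eps <= `|rsubmx xi| ->
    W xi <= C * `|rsubmx xi| `^ (- sg)) ->
  exists p0 C' : R, [/\ 1 < p0, 0 < C' & forall p r : R, p0 <= p -> 1 <= r ->
    (\int[lebesgue_rV (1 + n)]_(xi in fourier_region r eps) (W xi `^ p)%:E
      <= (C' * r `^ eps)%:E)%E].
Proof.
move=> eps0 sg0 C0 W01 HW.
(* For [t = |ze| >= 1] the first coordinate is at most [t ^ (1 / eps)] and the [n] others at most
   [t], so the product of the [1 + xi_i ^ 2] is at most of order [t ^ K]. *)
pose K := 2 * eps^-1 + 2 * n%:R.
have K0 : 0 <= K by rewrite addr_ge0 ?mulr_ge0 ?invr_ge0// ltW.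
(* [sg * p0 >= K] makes [W ^ p0] decay at least like [t ^ (- K)]; the 2 ensures [p0 > 1]. *)
pose p0 := 2 + K / sg.
have Ks : 0 <= K / sg by rewrite divr_ge0// ltW.
have p01 : 1 < p0 by rewrite /p0; lra.
have p00 : 0 < p0 by exact: lt_trans p01.
have p0K : K <= sg * p0.
  by rewrite /p0 mulrDr [sg * (K / sg)]mulrC divfK ?gt_eqF// lerDr mulr_ge0// ltW.
pose C1 := 1 + C; have C11 : 1 <= C1 by rewrite lerDl ltW.
have C1p : 1 <= C1 `^ p0 by rewrite -[leLHS](powRr0 C1) ler_powR// ltW.
pose Cf := 2 ^+ (1 + n) * C1 `^ p0.
have Cf0 : 0 < Cf by rewrite mulr_gt0 ?exprn_gt0// (lt_le_trans ltr01).
pose P (xi : 'rV[R]_(1 + n)) := \prod_(i < 1 + n) (1 + xi ord0 i ^+ 2)^-1.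
have Q0 (x : R) : 0 < 1 + x ^+ 2 by rewrite ltr_wpDr ?sqr_ge0.
have P0 xi : 0 < P xi by apply: prodr_gt0 => i _; rewrite invr_gt0.
have PV xi : P xi = (\prod_(i < 1 + n) (1 + xi ord0 i ^+ 2))^-1 by rewrite /P prodfV.
have Pg0 (xi : 'rV[R]_(1 + n)) : 0 < \prod_(i < 1 + n) (1 + xi ord0 i ^+ 2) by exact: prodr_gt0.
have key p r xi : p0 <= p -> fourier_region r eps xi -> W xi `^ p <= Cf * P xi.
  move=> pp /= /andP[thze zer]; set t := `|rsubmx xi| in thze zer *.
  set th := lsubmx xi ord0 ord0 in thze.
  apply: (le_trans (powR_le_exponent (W01 xi) p00 pp)).
  rewrite PV ler_pdivlMr//.
  have thV : `|th| = (`|th| `^ eps) `^ eps^-1.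
    by rewrite -powRrM mulfV ?gt_eqF// powRr1.
  have t00 : 0 <= t by exact: normr_ge0.
  have W0 : 0 <= W xi by have /andP[] := W01 xi.
  have [t1|t1] := leP 1 t; last first.
    have th1 : `|th| <= 1.
      rewrite thV (_ : 1 = 1 `^ eps^-1); last by rewrite powR1.
      by rewrite ge0_ler_powR ?nnegrE ?invr_ge0 ?powR_ge0 ?(ltW eps0)// (le_trans thze)// ltW.
    apply: (@le_trans _ _ (1 * 2 ^+ (1 + n))); last first.
      by rewrite mul1r /Cf ler_peMr// exprn_ge0.
    apply: ler_pM; [exact: powR_ge0|exact: ltW| |].
      rewrite (_ : 1 = 1 `^ p0); last by rewrite powR1.
      by rewrite ge0_ler_powR ?nnegrE ?(ltW p00)//; have /andP[] := W01 xi.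
    have := prod_oneDsqr_le (lexx 1) (lexx 1) th1 (ltW t1).
    by rewrite !expr1n !mulr1.
  have t0 : 0 < t by exact: lt_le_trans t1.
  pose u := t `^ eps^-1.
  have u1 : 1 <= u by rewrite -[leLHS](powRr0 t) ler_powR// invr_ge0 ltW.
  have thu : `|th| <= u.
    by rewrite thV ge0_ler_powR ?nnegrE ?invr_ge0 ?powR_ge0 ?(ltW eps0).
  have WK : W xi `^ p0 <= C1 `^ p0 * t `^ (- K).
    apply: (@le_trans _ _ ((C1 * t `^ (- sg)) `^ p0)).
      rewrite ge0_ler_powR ?nnegrE ?(ltW p00)//.
        by rewrite mulr_ge0 ?powR_ge0// (le_trans ler01).
      by apply: (le_trans (HW xi t1 thze)); rewrite ler_wpM2r ?powR_ge0// lerDr.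
    rewrite powRM ?powR_ge0 ?(le_trans ler01)// ler_wpM2l ?powR_ge0//.
    by rewrite -powRrM mulNr ler_powR// lerN2.
  apply: (le_trans (ler_pM (powR_ge0 _ _) (ltW (Pg0 xi)) WK (prod_oneDsqr_le t1 u1 thu (lexx t)))).
  have -> : u ^+ 2 * t ^+ (2 * n) = t `^ K.
    rewrite /u -[t ^+ _]powR_mulrn// -powR_mulrn ?powR_ge0// -powRrM -powRD ?(gt_eqF t0) ?implybT//.
    by congr (_ `^ _); rewrite /K natrM mulrC.
  rewrite powRN /Cf; have : t `^ K != 0 by rewrite gt_eqF// powR_gt0.
  by move: (t `^ K) (C1 `^ p0) (2 ^+ (1 + n)) => x y z x0; rewrite le_eqVlt; apply/orP; left; apply/eqP; field.
have pin : 0 < (@pi R) ^+ (1 + n) by rewrite exprn_gt0// pi_gt0.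
exists p0, (Cf * (@pi R) ^+ (1 + n)); split => //; first by rewrite mulr_gt0.
move=> p r pp r1.
apply: (@le_trans _ _ (\int[lebesgue_rV (1 + n)]_xi (Cf%:E * (P xi)%:E))%E).
  apply: ge0_le_integral_sup => xi; rewrite patch_setT -EFinM /patch.
  case: ifPn => [/set_mem xr|_]; rewrite !lee_fin ?lexx ?powR_ge0/=; last by rewrite mulr_ge0// ltW.
  exact: key xr.
have mf : measurable_fun [set: R] (fun x : R => (1 + x ^+ 2)^-1).
  by apply: continuous_measurable_fun; exact: continuous_oneDsqrV.
rewrite ge0_integralZl ?lee_fin ?(ltW Cf0)//.
- rewrite (@integral_prod_rV R (1 + n) (fun _ x => (1 + x ^+ 2)^-1) (fun=> pi))//.
  + rewrite prodr_const card_ord -EFinM lee_fin ler_peMr//.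
      by rewrite mulr_ge0 ?(ltW Cf0)// ltW.
    by rewrite -[leLHS](powRr0 r) ler_powR// ltW.
  + by move=> i x; rewrite invr_ge0 ltW.
  + by move=> i; exact: integral_oneDsqrV.
- by apply/measurable_EFinP; exact: (@measurable_prod_coord R (1 + n) (fun _ x => (1 + x ^+ 2)^-1)).
- by move=> xi _; rewrite lee_fin ltW.
Qed.

End final_integral.

Theorem theorem1p3 (R : realType) (mu : probability (measurableTypeR R) R)
    (d : nat) (U : set R) (g : R -> 'rV[R]_d.-1) :
  self_similar mu -> non_atomic mu ->
  (2 <= d)%N ->
  (forall eps : R, 0 < eps -> exists p C : R,
    [/\ 1 < p, 0 < C & forall r : R, 1 < r ->
      (\int[lebesgue_rV d.-1]_(xi in ball (0 : 'rV[R]_d.-1)%R r)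
         (Normc.normc (fourier (pushforward mu (moment_curve d.-1)) xi) `^ p)%:E
       <= (C * r `^ eps)%:E)%E]) ->
  open U -> msupport mu `<=` U ->
  non_trapped U (graph_curve g) \/ non_degenerate U (graph_curve g) ->
  forall eps : R, 0 < eps -> exists p0 C : R,
    [/\ 1 < p0, 0 < C & forall p r : R, p0 <= p -> 1 <= r ->
      (\int[lebesgue_rV (1 + d.-1)]_(xi in fourier_region r eps)
         (Normc.normc (fourier (pushforward_on U (graph_curve g) mu) xi) `^ p)%:E
       <= (C * r `^ eps)%:E)%E].
Proof.
case: d g => [|[|n]]// g ss na _ /= H oU SU curve eps eps0.
have [L0 [L0r aL0]] := self_similar_represents ss.
have [B [B1 mB]] := mass_bounded L0r aL0.
have ftU z : U z -> finite_type_at g z.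
  move=> Uz; case: curve => [nt|nd]; first exact: (finite_type_non_trapped oU Uz nt).
  exact: (finite_type_non_degenerate _ oU Uz nd).
have mU : measurable U by exact: open_measurable.
have mU1 : mass mu U = 1.
  apply/eqP; rewrite eq_le mass_le1//= -(mass_msupport mu).
  by apply: le_mass => //; exact: measurable_msupport.
have mUC0 : mu (~` U) = 0%E.
  by rewrite (massE mu) ?massC ?mU1 ?subrr//; exact: measurableC.
(* Outside [U] the values of [g] are arbitrary. The extension by 0 is measurable on the whole line,
   and as [U] has full mass its image measure agrees with [pushforward_on] on measurable sets. *)
pose Qt x : 'rV[R]_(1 + n.+1) := if pselect (U x) is left _ then graph_curve g x else 0.
have QtE x : U x -> Qt x = graph_curve g x by rewrite /Qt; case: pselect.
have mQt i : measurable_fun [set: R] (fun x => Qt x ord0 i).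
  have -> : (fun x => Qt x ord0 i) = coord (graph_curve g) i \_ U.
    apply/funext => x; rewrite /Qt /patch; case: pselect => Ux.
      by rewrite mem_set.
    by rewrite memNset// mxE.
  apply/(measurable_restrictT _ mU).
  apply: open_continuous_measurable_fun => // x /set_mem Ux.
  have [j ->|j ->] := split_ordP i.
    by rewrite coord_graphl; exact: cvg_id.
  rewrite coord_graphr; have [[V [_ Vx dg]] _] := ftU x Ux.
  by apply/differentiable_continuous/derivable1_diffP; exact: (dg j 0%N x).
have LS := level_set_cover B1 mB H.
have [sg [C [sg0 C0 HC]]] := graph_osc_decay L0r aL0 na LS (fun z Sz => ftU z (SU z Sz))
  mQt (fun x Sx => QtE x (SU x Sx)) eps0.
have nuE xi : Normc.normc (fourier (pushforward_on U (graph_curve g) mu) xi) = osc mu (phase Qt xi).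
  apply: fourier_set_function => // A mA.
  have mQA : measurable (Qt @^-1` A).
    have mQ' : measurable_fun [set: measurableTypeR R] Qt.
      by apply/measurable_fun_coordP => i; exact: mQt.
    by rewrite -[X in measurable X]setTI; exact: mQ'.
  have -> : pushforward_on U (graph_curve g) mu A = mu (U `&` Qt @^-1` A).
    rewrite /pushforward_on; congr (mu _); apply/seteqP.
    by split => x [Ux] /=; rewrite QtE.
  by rewrite setIC (massE mu (measurableI _ _ mQA mU)) (massE mu mQA) mass_setI_full.
have [|p0 [C' [p01 C'0 Hp]]] := @region_integral_bound R n.+1
    (fun xi => osc mu (phase Qt xi)) eps sg C eps0 sg0 C0 _ HC.
  by move=> xi; rewrite osc_le1 ?sqrtr_ge0//; exact: measurable_phase.
exists p0, C'; split; [exact: p01|exact: C'0|move=> p r pp r1].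
apply: le_trans (Hp p r pp r1).
apply: ge0_le_integral_sup => xi; rewrite /patch; case: ifPn => _; last by rewrite !lexx.
apply/andP; split; first by rewrite lee_fin powR_ge0.
by rewrite lee_fin le_eqVlt; apply/orP; left; apply/eqP; congr (_ `^ _); exact: nuE.
Qed.
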